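(* Let $\Bbbk$ be a field, let $d\ge 1$ be an integer, let $S=\Bbbk[x,y]$ with the standard grading, and let $B=\bigoplus_{n\ge 0}S_{nd}$, graded by $B_n=S_{nd}$, be the homogeneous coordinate ring of the rational normal curve of degree $d$. Let $\mathbb{B}(B)$ be the cone of Betti tables over $B$. Then the extremal rays of the subcone of $\mathbb{B}(B)$ generated by the Betti tables of Cohen--Macaulay graded $B$-modules of depth $1$ are precisely the rays spanned by the Betti tables of depth $1$ Cohen--Macaulay $B$-modules with pure resolutions of type $(d_0,d_1;\ell)$, where $d_0<d_1$ are integers and $\ell=0$ or $\ell=d-1$.
   Context: All modules are finitely generated and graded. For a $B$-module $M$, the graded Betti numbers are $\beta^B_{i,j}(M)=\dim_\Bbbk \operatorname{Tor}^B_i(\Bbbk,M)_j$, and the Betti table of $M$ is $\beta^B(M)=(\beta^B_{i,j}(M))_{i\ge 0,\,j\in\mathbb{Z}}$, an element of the $\mathbb{Q}$-vector space $\prod_{i\ge 0}\bigoplus_{j\in\mathbb{Z}}\mathbb{Q}$. The cone of Betti tables $\mathbb{B}(B)$ is the cone (closed under finite nonnegative rational linear combinations) generated by the rays $\mathbb{Q}_{\ge 0}\cdot\beta^B(M)$, with $M$ ranging over all finitely generated graded $B$-modules. For $0\le \ell\le d-1$ let $M^{(\ell)}=\bigoplus_{n\ge 0}S_{nd+\ell}$, a graded $B$-module with $n$-th graded piece $S_{nd+\ell}$ (so $M^{(0)}=B$). Twists are defined by $N(a)_n=N_{a+n}$. Let $\mathfrak m$ be the homogeneous maximal ideal of $B$.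 A Cohen--Macaulay $B$-module $M$ of depth $1$ (equivalently, Cohen--Macaulay of dimension $1$) has a pure resolution of type $(d_0,d_1;\ell)$ if there is an exact sequence of graded $B$-modules with degree-zero maps $$0\to E_1\to F_0\to M\to 0$$ which is minimal (the image of $E_1$ lies in $\mathfrak m F_0$), where $F_0$ is free and generated in the single degree $d_0$, and $E_1= M^{(\ell)}(-d_1)^{\oplus r}$ for some integer $r$. *)

(* Defs.v *)
From HB Require Import structures.
From mathcomp Require Import all_boot all_order all_algebra.
From mathcomp Require Import mpoly.
Set Implicit Arguments.
Unset Strict Implicit.
Unset Printing Implicit Defensive.
Import GRing.Theory.
Local Open Scope ring_scope.

Section Veronese.
Variables (k : fieldType) (d : nat).

Local Notation S := {mpoly k[2]}.

(* The underlying set of \bigoplus_(n >= 0) S_(n d + l). *)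
Definition in_veronese (l : nat) : {pred S} :=
  fun p => all (fun m => (l <= mdeg m)%N && (d %| mdeg m - l)%N) (msupp p).

Lemma in_veroneseP l (p : S) :
  reflect (forall m, p@_m != 0 -> exists n, mdeg m = (n * d + l)%N)
          (p \in in_veronese l).
Proof.
apply: (iffP allP) => [H m | H m].
  rewrite -mcoeff_msupp => /H /andP[le_l /dvdnP[n eq_n]].
  by exists n; rewrite -eq_n subnK.
rewrite mcoeff_msupp => /H[n ->].
by rewrite leq_addl addnK dvdn_mull.
Qed.

Lemma in_veroneseM l (p q : S) :
  p \in in_veronese 0 -> q \in in_veronese l -> p * q \in in_veronese l.
Proof.
move=> /in_veroneseP Hp /in_veroneseP Hq; apply/in_veroneseP => m.
rewrite -mcoeff_msupp => /msuppM_le /allpairsP[[m1 m2] /= [h1 h2 ->]].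
move: h1 h2; rewrite !mcoeff_msupp => /Hp[n1 e1] /Hq[n2 e2].
by exists (n1 + n2)%N; rewrite mdegD e1 e2 addn0 mulnDl addnA.
Qed.

Lemma in_veronese_zmod l : zmod_closed (in_veronese l).
Proof.
split=> [|p q /in_veroneseP Hp /in_veroneseP Hq]; apply/in_veroneseP => m.
  by rewrite mcoeff0 eqxx.
rewrite mcoeffB => pq0; have [p0|] := eqVneq p@_m 0; last exact: Hp.
by apply: Hq; move: pq0; rewrite p0 sub0r oppr_eq0.
Qed.

Lemma in_veronese_subring : subring_closed (in_veronese 0).
Proof.
split; [|exact: (in_veronese_zmod 0).2 | by move=> p q; apply: in_veroneseM].
apply/in_veroneseP => m; rewrite mcoeff1.
by case: (altP (m =P 0%MM)) => [-> _|]; rewrite ?eqxx //; exists 0%N; rewrite mdeg0.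
Qed.

HB.instance Definition _ l :=
  GRing.isZmodClosed.Build S (in_veronese l) (in_veronese_zmod l).

Definition in_vring : {pred S} := in_veronese 0.
HB.instance Definition _ :=
  GRing.isSubringClosed.Build S in_vring in_veronese_subring.

(* B = \bigoplus_(n >= 0) S_(n d), as a subring of S. *)
Record vring := VRing { vval : S; _ : vval \in in_vring }.
HB.instance Definition _ := [isSub for vval].
HB.instance Definition _ := [Choice of vring by <:].
HB.instance Definition _ := [SubChoice_isSubComNzRing of vring by <:].

(* The group underlying M^(l). *)
Record vmod (l : nat) := VMod { mval : S; _ : mval \in in_veronese l }.
HB.instance Definition _ l := [isSub for @mval l].
HB.instance Definition _ l := [Choice of vmod l by <:].
HB.instance Definition _ l := [SubChoice_isSubZmodule of vmod l by <:].

Lemma vvalP (b : vring) : vval b \in in_veronese 0.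
Proof. by case: b. Qed.

Definition vscale l (b : vring) (x : vmod l) : vmod l :=
  VMod (in_veroneseM (vvalP b) (valP x)).

Fact vscaleA l b c (x : vmod l) : vscale b (vscale c x) = vscale (b * c) x.
Proof. by apply: val_inj; rewrite /= mulrA. Qed.
Fact vscale1 l : left_id 1 (@vscale l).
Proof. by move=> x; apply: val_inj; rewrite /= mul1r. Qed.
Fact vscaleDr l : right_distributive (@vscale l) +%R.
Proof. by move=> b x y; apply: val_inj; rewrite /= mulrDr. Qed.
Fact vscaleDl l (x : vmod l) : {morph (fun b => vscale b x) : b c / b + c}.
Proof. by move=> b c; apply: val_inj; rewrite /= mulrDl. Qed.

HB.instance Definition _ l := GRing.Zmodule_isLmodule.Build vring (vmod l)
  (@vscaleA l) (@vscale1 l) (@vscaleDr l) (@vscaleDl l).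
(* The piece M^(l)_n: S_(n d + l) for n >= 0, and 0 for n < 0; for l = 0
   this is B_n. *)
Definition in_piece (l : nat) (n : int) (p : S) : bool :=
  if n is Posz m then p \is (m * d + l).-homog else p == 0.

Lemma in_piece0 l n : in_piece l n 0.
Proof. by case: n => n /=; rewrite ?rpred0 ?eqxx. Qed.

Lemma in_pieceD l n p q : in_piece l n p -> in_piece l n q -> in_piece l n (p + q).
Proof.
case: n => n /=; first exact: rpredD.
by move=> /eqP-> /eqP->; rewrite addr0.
Qed.

Lemma in_pieceM l a n p q :
  in_piece 0 a p -> in_piece l n q -> in_piece l (a + n) (p * q).
Proof.
case: a => [a|a /eqP->]; last by rewrite mul0r in_piece0.
case: n => [n|n _ /eqP->]; last by rewrite mulr0 in_piece0.
rewrite -PoszD /= addn0 => hp hq.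
by rewrite mulnDl -addnA; apply: dhomogM.
Qed.

Lemma piece_span l (p : S) : (0 < d)%N -> p \in in_veronese l ->
  exists s : seq (int * S),
    (forall q, q \in s -> q.2 \in in_veronese l /\ in_piece l q.1 q.2)
    /\ p = \sum_(q <- s) q.2.
Proof.
move=> d_gt0 /in_veroneseP Hp.
exists [seq (Posz ((mdeg m - l) %/ d), p@_m *: 'X_[m]) | m <- msupp p]; split.
  move=> q /mapP[m]; rewrite mcoeff_msupp => /Hp[n En] -> /=; split.
    apply/in_veroneseP => m'; rewrite -mcoeff_msupp => /msuppZ_le.
    by rewrite msuppX inE => /eqP->; exists n.
  by apply: rpredZ; rewrite dhomogX /= En addnK mulnK.
by rewrite big_map /= -mpolyE.
Qed.

Lemma piece_free l (s : seq int) (c : int -> S) : (0 < d)%N ->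
  uniq s -> (forall n, in_piece l n (c n)) ->
  \sum_(n <- s) c n = 0 -> forall n, n \in s -> c n = 0.
Proof.
move=> d_gt0 us hc s0 [n|n] sn; last by apply/eqP; exact: (hc (Negz n)).
have := congr1 (pihomog [measure of mdeg] (n * d + l)) s0.
rewrite raddf_sum (bigD1_seq (Posz n)) //= pihomog_dE; last exact: (hc (Posz n)).
rewrite big1 ?addr0 ?pihomog0 // => -[m|m] ne; last first.
  by have /eqP-> := hc (Negz m); rewrite pihomog0.
apply: (pihomog_ne0 _ (hc (Posz m))).
by apply: contraNneq ne => /eqP; rewrite eqn_add2r eqn_pmul2r // => /eqP->.
Qed.
End Veronese.

(* Graded B-modules, as internal direct sums of the pieces [gpiece n]. *)
Record gmod (k : fieldType) (d : nat) := GMod {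
  gcarrier :> lmodType (vring k d);
  gpiece : int -> gcarrier -> Prop;
  gpiece0 : forall n, gpiece n 0;
  gpieceD : forall n x y, gpiece n x -> gpiece n y -> gpiece n (x + y);
  gpieceZ : forall a n (b : vring k d) x,
    in_piece d 0 a (vval b) -> gpiece n x -> gpiece (a + n) (b *: x);
  gpiece_span : forall x, exists s : seq (int * gcarrier),
    (forall p, p \in s -> gpiece p.1 p.2) /\ x = \sum_(p <- s) p.2;
  gpiece_free : forall (s : seq int) (c : int -> gcarrier),
    uniq s -> (forall n, gpiece n (c n)) ->
    \sum_(n <- s) c n = 0 -> forall n, n \in s -> c n = 0
}.

Section Constructions.
Variables (k : fieldType) (d : nat) (d_gt0 : (0 < d)%N).
Local Notation B := (vring k d).

Section Submodules.
Variables (l : nat) (M : lmodType B) (v : {additive M -> {mpoly k[2]}}).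
Hypothesis v_inj : injective v.
Hypothesis v_in : forall x, v x \in in_veronese d l.
Hypothesis v_onto : forall p, p \in in_veronese d l -> exists x, v x = p.

Lemma sub_span (x : M) : exists s : seq (int * M),
  (forall p, p \in s -> in_piece d l p.1 (v p.2)) /\ x = \sum_(p <- s) p.2.
Proof.
have [s [hs sx]] := piece_span d_gt0 (v_in x).
have [t [ht st]] : exists t : seq (int * M),
    (forall p, p \in t -> in_piece d l p.1 (v p.2)) /\
    \sum_(q <- s) q.2 = v (\sum_(q <- t) q.2).
  elim: s hs {sx} => [|q s IHs] hs.
    by exists [::]; rewrite !big_nil raddf0.
  have [|t [ht st]] := IHs; first by move=> r sr; apply: hs; rewrite inE sr orbT.
  have [/v_onto[y vy] gq] := hs q (mem_head _ _).
  exists ((q.1, y) :: t); split; last by rewrite !big_cons raddfD /= vy st.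
  by move=> p; rewrite inE => /predU1P[-> /=|/ht//]; rewrite vy.
by exists t; split=> //; apply: v_inj; rewrite sx.
Qed.

Lemma sub_free (s : seq int) (c : int -> M) :
  uniq s -> (forall n, in_piece d l n (v (c n))) ->
  \sum_(n <- s) c n = 0 -> forall n, n \in s -> c n = 0.
Proof.
move=> us hc s0 n sn; apply: v_inj; rewrite raddf0.
by apply: (piece_free (c := v \o c) d_gt0 us hc _ sn); rewrite -raddf_sum s0 raddf0.
Qed.
End Submodules.

Lemma mval_additive l : zmod_morphism (@mval k d l).
Proof. by []. Qed.
HB.instance Definition _ l :=
  GRing.isZmodMorphism.Build (vmod k d l) {mpoly k[2]} (@mval k d l)
    (@mval_additive l).

Definition rval (b : B^o) : {mpoly k[2]} := vval b.
Lemma rval_additive : zmod_morphism rval.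
Proof. by []. Qed.
HB.instance Definition _ :=
  GRing.isZmodMorphism.Build B^o {mpoly k[2]} rval rval_additive.

(* M^(l) *)
Definition gvmod (l : nat) : gmod k d.
Proof.
refine (@GMod k d (vmod k d l) (fun n x => in_piece d l n (mval x)) _ _ _ _ _).
- by move=> n; apply: in_piece0.
- by move=> n x y; apply: in_pieceD.
- by move=> a n b x; apply: in_pieceM.
- apply: (sub_span (v := @mval k d l)); [exact: val_inj|exact: valP|].
  by move=> p hp; exists (VMod hp).
- by apply: (sub_free (v := @mval k d l)); exact: val_inj.
Defined.

(* B as a graded module over itself *)
Definition greg : gmod k d.
Proof.
refine (@GMod k d B^o (fun n x => in_piece d 0 n (vval x)) _ _ _ _ _).
- by move=> n; apply: in_piece0.
- by move=> n x y; apply: in_pieceD.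
- by move=> a n b x; apply: in_pieceM.
- apply: (sub_span (v := rval)); [exact: val_inj|exact: valP|].
  by move=> p hp; exists (VRing hp).
- by apply: (sub_free (v := rval)); exact: val_inj.
Defined.

(* The direct sum of the twists N(- a i), i < r, where N(a)_n = N_(a + n). *)
Definition gsum_twist (N : gmod k d) (r : nat) (a : 'I_r -> int) : gmod k d.
Proof.
refine (@GMod k d {ffun 'I_r -> N} (fun n f => forall i, gpiece (n - a i) (f i))
          _ _ _ _ _).
- by move=> n i; rewrite ffunE; apply: gpiece0.
- by move=> n x y hx hy i; rewrite ffunE; apply: gpieceD.
- by move=> b n e x hb hx i; rewrite ffunE -addrA; apply: gpieceZ.
- move=> f; pose D i (x : N) : {ffun 'I_r -> N} := [ffun j => if j == i then x else 0].
  have -> : f = \sum_i D i (f i).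
    apply/ffunP => j; rewrite sum_ffunE (bigD1 j) //= ffunE eqxx big1 ?addr0 //.
    by move=> i ne; rewrite ffunE eq_sym (negPf ne).
  elim/big_ind: _ => [|x y [s [hs ->]] [t [ht ->]]|i _].
  + by exists [::]; rewrite big_nil.
  + exists (s ++ t); rewrite big_cat; split=> // p.
    by rewrite mem_cat => /orP[/hs|/ht].
  have [s [hs Ef]] := gpiece_span (f i).
  exists [seq (p.1 + a i, D i p.2) | p <- s]; split.
    move=> p /mapP[q sq ->] j; rewrite ffunE; case: eqP => [->|_].
      by rewrite addrK; apply: hs.
    exact: gpiece0.
  rewrite big_map; apply/ffunP => j; rewrite sum_ffunE ffunE.
  case: eqP => [->|ne].
    by rewrite {1}Ef; apply: eq_bigr => p _; rewrite ffunE eqxx.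
  by rewrite big1 // => p _; rewrite ffunE; case: eqP.
- move=> s c us hc s0 n sn; apply/ffunP => i; rewrite ffunE.
  pose c' m := c (m + a i) i.
  have -> : c n i = c' (n - a i) by rewrite /c' subrK.
  apply: (@gpiece_free _ _ N [seq m - a i | m <- s]).
  + by rewrite map_inj_uniq //; apply: addIr.
  + by move=> m; have := hc (m + a i) i; rewrite addrK.
  + rewrite big_map; move/ffunP/(_ i): s0; rewrite sum_ffunE ffunE; apply: etrans.
    by apply: eq_bigr => m _; rewrite /c' subrK.
  + exact: map_f.
Defined.

Definition gfree (r : nat) (a : 'I_r -> int) : gmod k d := gsum_twist greg a.
End Constructions.

Section CohenMacaulay.
Variables (k : fieldType) (d : nat).
Local Notation B := (vring k d).

(* The homogeneous maximal ideal \bigoplus_(n > 0) B_n. *)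
Definition irrelevant (b : B) : Prop := (vval b)@_0%MM = 0.

Definition fin_gen (M : lmodType B) : Prop :=
  exists (n : nat) (g : 'I_n -> M),
    forall x, exists b : 'I_n -> B, x = \sum_(i < n) b i *: g i.

(* x lies in the submodule (xs)M. *)
Definition in_seqM (M : lmodType B) (xs : seq B) (x : M) : Prop :=
  exists y : 'I_(size xs) -> M, x = \sum_(i < size xs) xs`_i *: y i.

Definition regular_seq (M : lmodType B) (xs : seq B) : Prop :=
  [/\ forall b, b \in xs -> irrelevant b,
      forall i, (i < size xs)%N -> forall x : M,
        in_seqM (take i xs) (xs`_i *: x) -> in_seqM (take i xs) x
    & ~ forall x : M, in_seqM xs x].

Definition has_depth (M : lmodType B) (n : nat) : Prop :=
  (exists2 xs, regular_seq M xs & size xs = n) /\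
  (forall xs, regular_seq M xs -> (size xs <= n)%N).

Definition annihilates (M : lmodType B) (b : B) : Prop :=
  forall x : M, b *: x = 0.

(* Chains p 0 < ... < p n of prime ideals containing Ann M. *)
Definition prime_chain (M : lmodType B) (n : nat) (p : nat -> {pred B}) : Prop :=
  [/\ forall i, (i <= n)%N -> idealr_closed (p i) /\ prime_idealr_closed (p i),
      forall b, annihilates M b -> b \in p 0%N
    & forall i, (i < n)%N ->
        {subset p i <= p i.+1} /\ ~ {subset p i.+1 <= p i}].

(* dim M = dim B / Ann M *)
Definition has_dim (M : lmodType B) (n : nat) : Prop :=
  (exists p, prime_chain M n p) /\
  (forall m p, prime_chain M m p -> (m <= n)%N).

Definition cohen_macaulay (M : lmodType B) : Prop :=
  exists n, has_depth M n /\ has_dim M n.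

Definition CM_depth1 (M : gmod k d) : Prop :=
  cohen_macaulay M /\ has_depth M 1.

End CohenMacaulay.

Section Betti.
Variables (k : fieldType) (d : nat) (d_gt0 : (0 < d)%N).
Local Notation B := (vring k d).

Definition degree0 (M N : gmod k d) (f : M -> N) : Prop :=
  forall n x, gpiece n x -> gpiece n (f x).

(* x lies in m M, m the homogeneous maximal ideal. *)
Definition in_mM (M : lmodType B) (x : M) : Prop :=
  exists (n : nat) (b : 'I_n -> B) (y : 'I_n -> M),
    (forall i, irrelevant (b i)) /\ x = \sum_(i < n) b i *: y i.

Record resolution (M : gmod k d) := Resolution {
  res_rank : nat -> nat;
  res_deg : forall i, 'I_(res_rank i) -> int;
  res_diff : forall i,
    {linear gfree k d_gt0 (@res_deg i.+1) -> gfree k d_gt0 (@res_deg i)};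
  res_aug : {linear gfree k d_gt0 (@res_deg 0%N) -> M};
  res_diff_degree0 : forall i, degree0 (res_diff i);
  res_aug_degree0 : degree0 res_aug;
  res_aug_surj : forall x, exists y, res_aug y = x;
  res_aug_exact : forall y, res_aug y = 0 <-> exists z, res_diff 0%N z = y;
  res_diff_exact : forall i y,
    res_diff i y = 0 <-> exists z, res_diff i.+1 z = y
}.

Fact vconst_subproof (c : k) : (c%:MP : {mpoly k[2]}) \in in_vring d.
Proof.
apply/in_veroneseP => m; rewrite mcoeffC.
by case: (altP (m =P 0%MM)) => [->|]; [exists 0%N; rewrite mdeg0 | rewrite mulr0 eqxx].
Qed.

(* The structure map k -> B. *)
Definition vconst (c : k) : B := VRing (vconst_subproof c).

(* dim_k (U / W) = n, for k-subspaces W \subset U of M. *)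
Definition has_quot_dim (M : lmodType B) (U W : M -> Prop) (n : nat) : Prop :=
  exists e : 'I_n -> M,
  [/\ forall i, U (e i),
      forall c : 'I_n -> k,
        W (\sum_(i < n) vconst (c i) *: e i) -> forall i, c i = 0
    & forall x, U x ->
        exists c : 'I_n -> k, W (x - \sum_(i < n) vconst (c i) *: e i)].

Section Tor.
Variables (M : gmod k d) (F : resolution M).

Definition resF (i : nat) : gmod k d := gfree k d_gt0 (@res_deg M F i).

(* Tor_i(k, M) is the i-th homology of k (x)_B F = F / m F. The cycles and
   the boundaries of degree j in F_i / m F_i are represented by their
   inverse images in (F_i)_j. *)
Definition tor_cycle (i : nat) (j : int) : resF i -> Prop :=
  match i return resF i -> Prop with
  | 0 => fun x => gpiece j x
  | i'.+1 => fun x => gpiece j x /\ in_mM (res_diff F i' x)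
  end.

Definition tor_boundary (i : nat) (j : int) (x : resF i) : Prop :=
  gpiece j x /\ exists y : resF i.+1, in_mM (x - res_diff F i y).

Definition has_tor_dim (i : nat) (j : int) (n : nat) : Prop :=
  has_quot_dim (@tor_cycle i j) (@tor_boundary i j) n.
End Tor.

(* beta i j = dim_k Tor_i(k, M)_j *)
Definition graded_betti (M : gmod k d) (beta : nat -> int -> nat) : Prop :=
  exists F : resolution M, forall i j, has_tor_dim F i j (beta i j).

Definition btable := nat -> int -> rat.

Definition betti_table (M : gmod k d) (T : btable) : Prop :=
  exists2 beta, graded_betti M beta & forall i j, T i j = (beta i j)%:R.

Definition cone (G : btable -> Prop) (T : btable) : Prop :=
  exists (n : nat) (c : 'I_n -> rat) (g : 'I_n -> btable),
    (forall a, 0 <= c a /\ G (g a)) /\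
    (forall i j, T i j = \sum_(a < n) c a * g a i j).

(* The cone generated by the Betti tables of the finitely generated graded
   B-modules satisfying P; the whole cone of Betti tables is the case where
   P always holds. *)
Definition betti_cone (P : gmod k d -> Prop) : btable -> Prop :=
  cone (fun T => exists M : gmod k d, [/\ fin_gen M, P M & betti_table M T]).

Definition ray (T U : btable) : Prop :=
  exists2 c : rat, 0 <= c & forall i j, U i j = c * T i j.

Definition extremal_ray (C R : btable -> Prop) : Prop :=
  (exists T : btable,
    [/\ C T, exists i j, T i j != 0 & forall U, R U <-> ray T U]) /\
  (forall U V : btable, C U -> C V ->
     R (fun i j => U i j + V i j) -> R U /\ R V).

(* A minimal exact sequence 0 -> M^(l)(-d1)^r -> B(-d0)^a -> M -> 0. *)
Definition pure_resolution (M : gmod k d) (d0 d1 : int) (l : nat) : Prop :=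
  exists (a r : nat)
    (phi : {linear gsum_twist (gvmod k d_gt0 l) (fun _ : 'I_r => d1)
                   -> gfree k d_gt0 (fun _ : 'I_a => d0)})
    (psi : {linear gfree k d_gt0 (fun _ : 'I_a => d0) -> M}),
  [/\ degree0 phi /\ degree0 psi,
      injective phi,
      forall x, psi x = 0 <-> exists y, phi y = x,
      forall z, exists x, psi x = z
    & forall y, in_mM (phi y)].

End Betti.

(* Main.v *)
Require Import Defs.
From HB Require Import structures.
From mathcomp Require Import all_boot all_order all_algebra.
From mathcomp Require Import mpoly zify ring.
From Stdlib Require Import Classical ClassicalEpsilon.
From Stdlib Require Import FunctionalExtensionality PropExtensionality.
Set Implicit Arguments.
Unset Strict Implicit.
Unset Printing Implicit Defensive.
Import Order.TTheory GRing.Theory Num.Theory.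
Local Open Scope ring_scope.

(** Write u = x^d and v = y^d.  Everything rests on two facts about B: u, v is
    a regular sequence, and m^2 = (u, v) m for the homogeneous maximal ideal m,
    with B / (u, v) having as basis 1 and the d - 1 monomials x^i y^(d-i),
    0 < i < d, of degree one.

    Let M be Cohen-Macaulay of depth 1.  Then no nonzero element of M is killed
    by u and v, and a nonzero homogeneous element of B kills M ([CM_depth1P]).
    So every syzygy module K in a free resolution of M is saturated, that is,
    it contains every element of the free module whose products with u and v it
    contains, and hence u, v is regular on K.  Counting dimensions of m K / (u, v) K
    in two ways, with T the Betti table of M, gives
      T(i+1, j+1) = (d-1) T(i, j) for i > 1,  and  T(2, j+1) <= (d-1) T(1, j)
    ([dim_linear_syzygies], [dim_mK_upK]).  Next, K is free over k[u, v], on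
    a lift of a basis of K / (u, v) K.  Applied to the first syzygy module this
    bounds, for each t, the number of generators of K of degree at most t by
    the growth of the free module generated in degrees below t ([rank_upper]),
    and since M is torsion the ranks agree in the end ([rank_lower]):
      sum_(j <= t) (d T(1, j) - T(2, j+1)) <= d sum_(j < t) T(0, j),
    with equality for t large ([growth_upper], [growth_lower], [betti_numerics]).

    These inequalities say that numerically the first syzygy module is a sum of
    modules M^(0)(-j) and M^(d-1)(-j), of rank T(1, j) - T(2, j+1)/d in all for
    each j, and that these can be matched with generators of M of smaller degree.
    Greedy matching ([tab_cone], [betti_cone_pure]) writes T as a nonnegative
    combination of the pure tables pureT d0 d1 l with d0 < d1 and l = 0 or d - 1.

    Conversely the Betti table of a module with a pure resolution of type
    (d0, d1; l) is a positive multiple of pureT d0 d1 l ([pure_betti]), and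
    B / (x^(nd-l) S \cap B) has such a resolution with d1 - d0 = n
    ([quotient_pure]) and is Cohen-Macaulay of depth 1 ([q_CM]).  So the subcone
    of the theorem is the cone on the pure tables.  Each of these is extremal:
    the support of a table determines d0 and d1, and what separates l = 0 from
    l = d - 1 is the functional (d-1) T(1, d1) - T(2, d1 + 1), nonnegative on
    all pure tables ([pure_extremal]). *)

(** * Dimensions of quotients of vector spaces *)
Section LinearAlgebra.
Variables (k : fieldType) (d : nat).
Local Notation B := (vring k d).
Local Notation kc := (@vconst k d).

Lemma vconst_zmod : zmod_morphism kc.
Proof. by move=> a b; apply: val_inj; rewrite /= mpolyCB. Qed.
HB.instance Definition _ := GRing.isZmodMorphism.Build k B kc vconst_zmod.
Lemma vconst_monoid : monoid_morphism kc.
Proof. by split=> [|a b]; apply: val_inj; rewrite /= ?mpolyCM. Qed.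
HB.instance Definition _ := GRing.isMonoidMorphism.Build k B kc vconst_monoid.

Section Fix.
Variable M : lmodType B.
Implicit Types (U V W : M -> Prop).

Definition subsp U : Prop :=
  U 0 /\ forall c x y, U x -> U y -> U (kc c *: x + y).

Lemma subspD U x y : subsp U -> U x -> U y -> U (x + y).
Proof. by move=> [_ h] hx hy; have := h 1 x y hx hy; rewrite rmorph1 scale1r. Qed.
Lemma subspZ U c x : subsp U -> U x -> U (kc c *: x).
Proof. by move=> [h0 h] hx; have := h c x 0 hx h0; rewrite addr0. Qed.
Lemma subspN U x : subsp U -> U x -> U (- x).
Proof. by move=> hU hx; have := subspZ (-1) hU hx; rewrite rmorphN1 scaleN1r. Qed.
Lemma subspB U x y : subsp U -> U x -> U y -> U (x - y).
Proof. by move=> hU hx hy; apply: subspD => //; apply: subspN. Qed.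
Lemma subsp_sum U (I : Type) (r : seq I) (P : pred I) (F : I -> M) :
  subsp U -> (forall i, P i -> U (F i)) -> U (\sum_(i <- r | P i) F i).
Proof.
by move=> hU h; elim/big_ind: _ => //; [exact: hU.1 | move=> x y; exact: subspD].
Qed.

Lemma subsp0 : subsp (fun x => x = 0).
Proof. by split=> // c x y -> ->; rewrite scaler0 addr0. Qed.

Definition lincomb (I : finType) (g : I -> M) (c : I -> k) : M :=
  \sum_i kc (c i) *: g i.

Lemma lincomb_delta (I : finType) (g : I -> M) i :
  lincomb g (fun j => (j == i)%:R) = g i.
Proof.
rewrite /lincomb (bigD1 i) //= eqxx rmorph1 scale1r big1 ?addr0 // => j /negPf->.
by rewrite rmorph0 scale0r.
Qed.

Lemma lincombP (I : finType) (g : I -> M) a c1 c2 :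
  kc a *: lincomb g c1 + lincomb g c2 = lincomb g (fun i => a * c1 i + c2 i).
Proof.
rewrite /lincomb scaler_sumr -big_split /=; apply: eq_bigr => i _.
by rewrite rmorphD rmorphM scalerDl scalerA.
Qed.
Lemma lincomb0 (I : finType) (g : I -> M) : lincomb g (fun=> 0) = 0.
Proof. by rewrite /lincomb big1 // => i _; rewrite rmorph0 scale0r. Qed.
Lemma lincomb_comb (I J : finType) (g : J -> M) (c : I -> k) (b : I -> J -> k) :
  \sum_i kc (c i) *: lincomb g (b i) = lincomb g (fun j => \sum_i c i * b i j).
Proof.
rewrite /lincomb; under eq_bigr do rewrite scaler_sumr.
rewrite exchange_big; apply: eq_bigr => j _ /=.
by rewrite rmorph_sum scaler_suml; apply: eq_bigr => i _; rewrite rmorphM scalerA.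
Qed.

Definition indep W (I : finType) (e : I -> M) : Prop :=
  forall c : I -> k, W (lincomb e c) -> forall i, c i = 0.

Definition spans U W (I : finType) (g : I -> M) : Prop :=
  forall x, U x -> exists c : I -> k, W (x - lincomb g c).

Lemma steinitz U W (I J : finType) (e : I -> M) (g : J -> M) :
  subsp W -> (forall i, U (e i)) -> indep W e -> spans U W g -> (#|I| <= #|J|)%N.
Proof.
move=> hW hU he hg.
have [b hb] := fin_all_exists (fun i => hg _ (hU i)).
pose C := \matrix_(i < #|I|, j < #|J|) b (enum_val i) (enum_val j).
rewrite leqNgt; apply/negP => lt.
have : kermx C != 0.
  rewrite -mxrank_eq0 mxrank_ker subn_eq0 -ltnNge.
  exact: leq_ltn_trans (rank_leq_col C) lt.
move=> /rowV0Pn[v /sub_kermxP vC /eqP v0]; apply: v0; apply/rowP => i.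
pose c j := v 0 (enum_rank j).
suff /he/(_ (enum_val i)) : W (lincomb e c) by rewrite /c enum_valK mxE.
have -> : lincomb e c = \sum_i kc (c i) *: (e i - lincomb g (b i)) +
    lincomb g (fun j => \sum_i c i * b i j).
  rewrite -lincomb_comb -big_split; apply: eq_bigr => j _ /=.
  by rewrite -scalerDr subrK.
apply: subspD => //; first by apply: subsp_sum => // j _; apply: subspZ.
suff -> : lincomb g (fun j => \sum_i c i * b i j) = 0 by exact: hW.1.
rewrite /lincomb big1 // => j _.
suff -> : \sum_i c i * b i j = 0 by rewrite rmorph0 scale0r.
have := congr1 (fun A : 'rV_ _ => A 0 (enum_rank j)) vC; rewrite !mxE; apply: etrans.
rewrite [RHS](reindex_onto enum_rank enum_val) /=; last by move=> ? _; rewrite enum_valK.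
apply: eq_big => [l|l _]; first by rewrite enum_rankK eqxx.
by rewrite /C mxE !enum_rankK.
Qed.

(** Bases of U / W indexed by any finite type; [has_quot_dim] uses 'I_n. *)
Definition qbasis U W (I : finType) (e : I -> M) : Prop :=
  [/\ forall i, U (e i), indep W e & spans U W e].

Lemma qdE U W n : has_quot_dim U W n <-> exists e : 'I_n -> M, qbasis U W e.
Proof. by split=> -[e [h1 h2 h3]]; exists e; split. Qed.

Lemma qd_fin U W (I : finType) (e : I -> M) : qbasis U W e -> has_quot_dim U W #|I|.
Proof.
move=> [h1 h2 h3]; apply/qdE; exists (fun i : 'I_#|I| => e (enum_val i)).
have E (c : I -> k) :
    lincomb e c = lincomb (fun i : 'I_#|I| => e (enum_val i)) (fun i => c (enum_val i)).
  rewrite /lincomb (reindex_onto (@enum_val I predT) enum_rank) /=;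
    last by move=> ? _; rewrite enum_rankK.
  by apply: eq_bigl => i; rewrite enum_valK eqxx.
split=> [i //|c hc i|x /h3[c hc]]; last first.
  by exists (fun i => c (enum_val i)); rewrite -E.
rewrite -(enum_valK i); apply: (h2 (fun x => c (enum_rank x))).
by rewrite E /lincomb; under eq_bigr do rewrite enum_valK.
Qed.

Lemma qd_uniq U W n m : subsp W -> has_quot_dim U W n -> has_quot_dim U W m -> n = m.
Proof.
move=> hW /qdE[e [e1 e2 e3]] /qdE[g [g1 g2 g3]]; apply/eqP; rewrite eqn_leq.
have := steinitz hW e1 e2 g3; have := steinitz hW g1 g2 e3.
by rewrite !card_ord => -> ->.
Qed.

Lemma qd_ext U U' W W' n : (forall x, U x <-> U' x) -> (forall x, W x <-> W' x) ->
  has_quot_dim U W n -> has_quot_dim U' W' n.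
Proof.
move=> hU hW [e [h1 h2 h3]]; exists e; split=> [i|c /hW|x /hU/h3[c /hW hc]].
- exact/hU.
- exact: h2.
- by exists c.
Qed.

Lemma qd_add U V W n m : subsp U -> subsp V -> subsp W ->
  (forall x, W x -> V x) -> (forall x, V x -> U x) ->
  has_quot_dim V W n -> has_quot_dim U V m -> has_quot_dim U W (n + m).
Proof.
move=> hU hV hW WV VU /qdE[e [e1 e2 e3]] /qdE[g [g1 g2 g3]].
pose q (i : 'I_n + 'I_m) := match i with inl i => e i | inr i => g i end.
have qE c : lincomb q c = lincomb e (c \o inl) + lincomb g (c \o inr).
  by rewrite /lincomb big_sumType.
have -> : (n + m = #|{: 'I_n + 'I_m}|)%N by rewrite card_sum !card_ord.
apply: (qd_fin (e := q)); split=> [[i|i]|c|x Ux] /=.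
- exact/VU.
- exact: g1.
- rewrite qE => h.
  have gz : forall i, (c \o inr) i = 0.
    apply: g2; rewrite -[X in V X](addKr (lincomb e (c \o inl))) addrC.
    by apply: subspB => //; [exact: WV | apply: subsp_sum => // i _; apply: subspZ].
  have ez : forall i, (c \o inl) i = 0.
    apply: e2; move: h; rewrite [X in _ + X]big1 ?addr0 // => i _.
    by rewrite gz rmorph0 scale0r.
  by case=> i; [exact: (ez i) | exact: (gz i)].
have [c2 h2] := g3 _ Ux; have [c1 h1] := e3 _ h2.
exists (fun i => match i with inl i => c1 i | inr i => c2 i end).
by rewrite qE [lincomb e _ + _]addrC opprD addrA.
Qed.

(** A maximal independent family, of size at most #|J| by the exchange lemma, is
    a basis. *)
Lemma qd_exists U W (J : finType) (g : J -> M) :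
  subsp U -> subsp W -> spans U W g -> exists n, has_quot_dim U W n.
Proof.
move=> hU hW hg.
pose P n := exists e : 'I_n -> M, (forall i, U (e i)) /\ indep W e.
have P0 : P 0%N by exists (fun=> 0); split=> [[]|c _ []].
have Pb n : P n -> (n <= #|J|)%N.
  by move=> [e [e1 e2]]; have := steinitz hW e1 e2 hg; rewrite card_ord.
have [n [Pn Pmax]] : exists n, P n /\ ~ P n.+1.
  apply: NNPP => h.
  have H n : P n by elim: n => // n IH; apply: NNPP => h'; apply: h; exists n.
  by have := Pb _ (H #|J|.+1); rewrite ltnn.
case: Pn => e [e1 e2]; exists n; apply/qdE; exists e; split=> // x Ux.
apply: NNPP => h; apply: Pmax.
exists (fun i : 'I_n.+1 => if unlift ord0 i is Some j then e j else x).
split=> [i|c]; first by case: unliftP.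
rewrite /lincomb big_ord_recl unlift_none.
under eq_bigr do rewrite liftK.
move=> hc.
have c0 : c ord0 = 0.
  apply: NNPP => /eqP c0; apply: h.
  exists (fun i => - (c ord0)^-1 * c (lift ord0 i)).
  have := subspZ (c ord0)^-1 hW hc.
  rewrite scalerDr scalerA -rmorphM mulVf // rmorph1 scale1r scaler_sumr.
  congr W; congr (_ + _); rewrite -sumrN; apply: eq_bigr => i _.
  by rewrite rmorphM rmorphN scalerA mulNr scaleNr opprK.
have cl : forall i, c (lift ord0 i) = 0.
  by apply: e2; move: hc; rewrite c0 rmorph0 scale0r add0r.
by move=> i; case: (unliftP ord0 i) => [j|] ->.
Qed.

Lemma qd0 U W : (forall x, U x -> W x) -> has_quot_dim U W 0.
Proof.
move=> h; apply/qdE; exists (fun=> 0); split=> [[]//|c _ []//|x /h].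
by exists (fun=> 0); rewrite lincomb0 subr0.
Qed.

End Fix.

Lemma lincomb_map (M N : lmodType B) (f : M -> N) (I : finType) (e : I -> M) c :
  linear f -> f (lincomb e c) = lincomb (f \o e) c.
Proof.
move=> hf; have f0 : f 0 = 0.
  by have := hf (-1) 0 0; rewrite scaler0 addr0 scaleN1r addNr.
rewrite /lincomb; apply: (big_ind2 (fun x y => f x = y)) => // [x y z t h1 h2|i _].
  by have := hf 1 x z; rewrite !scale1r => ->; rewrite h1 h2.
by have := hf (kc (c i)) (e i) 0; rewrite f0 !addr0.
Qed.

Section Map.
Variables (M N : lmodType B) (f : M -> N) (hf : linear f).
Variables (U W : M -> Prop) (U' W' : N -> Prop).
Hypothesis (hW' : subsp W').
Hypothesis fU : forall x, U x -> U' (f x).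
Hypothesis fsurj : forall y, U' y -> exists2 x, U x & W' (y - f x).
Hypothesis fW : forall x, U x -> (W' (f x) <-> W x).
Hypothesis hU : subsp U.

Lemma linB : forall x y, f (x - y) = f x - f y.
Proof. by move=> x y; rewrite addrC -scaleN1r hf scaleN1r addrC. Qed.

Lemma qd_map n : has_quot_dim U W n -> has_quot_dim U' W' n.
Proof.
move=> /qdE[e [e1 e2 e3]]; apply/qdE; exists (f \o e); split=> [i|c|y /fsurj[x Ux xy]].
- exact: fU.
- rewrite -lincomb_map // => h; apply: (e2 c); apply: (fW _).1 h.
  by apply: subsp_sum => // i _; apply: subspZ.
have [c hc] := e3 _ Ux; exists c; rewrite -lincomb_map //.
rewrite -(subrK (f x) y) -addrA; apply: subspD => //.
rewrite -linB; apply/fW => //; apply: subspB => //.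
by apply: subsp_sum => // i _; apply: subspZ.
Qed.

(** A basis of U' / W' lifts along a map that is injective modulo W and W'. *)
Lemma qd_map_back n : has_quot_dim U' W' n -> has_quot_dim U W n.
Proof.
move=> /qdE[g [g1 g2 g3]].
have hx i : exists x, U x /\ W' (g i - f x).
  by have [x] := fsurj (g1 i); exists x.
have [e /all_and2[e1 e2]] := fin_all_exists hx.
have Ue c : U (lincomb e c) by apply: subsp_sum => // i _; apply: subspZ.
have gf c : W' (lincomb g c - f (lincomb e c)).
  rewrite lincomb_map // /lincomb -sumrB; apply: subsp_sum => // i _.
  by rewrite -scalerBr; apply: subspZ.
apply/qdE; exists e; split=> // [c /(fW (Ue c)).2 h|x Ux].
  apply: g2; rewrite -(subrK (f (lincomb e c)) (lincomb g c)).
  exact: subspD.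
have [c hc] := g3 _ (fU Ux); exists c; apply/fW; first exact: subspB.
rewrite linB -(subrK (lincomb g c) (f x)) -addrA; apply: subspD => //.
Qed.
End Map.
End LinearAlgebra.

(** * Homogeneous components *)
Section GradedProjection.
Variables (k : fieldType) (d : nat).
Local Notation B := (vring k d).

Section One.
Variable M : gmod k d.

Lemma gpieceB n (x y : M) : gpiece n x -> gpiece n y -> gpiece n (x - y).
Proof.
move=> hx hy; apply: gpieceD => //; rewrite -scaleN1r -[n]add0r; apply: gpieceZ => //.
by rewrite /= mul0n addn0 rpredN dhomog1.
Qed.

Lemma gpiece_kc c n (x : M) : gpiece n x -> gpiece n (vconst d c *: x).
Proof.
move=> hx; rewrite -[n]add0r; apply: gpieceZ => //=.
by rewrite mul0n addn0 -[X in X \is _]mulr1 mul_mpolyC rpredZ ?dhomog1.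
Qed.

Lemma gpiece_subsp n : subsp (@gpiece _ _ M n).
Proof.
split=> [|c x y hx hy]; first exact: gpiece0.
by apply: gpieceD => //; apply: gpiece_kc.
Qed.

Lemma group_by_degree (L : seq int) (s : seq (int * M)) :
  uniq L -> (forall p, p \in s -> p.1 \in L) ->
  \sum_(m <- L) \sum_(p <- s | p.1 == m) p.2 = \sum_(p <- s) p.2.
Proof.
move=> uL hs; rewrite (exchange_big_dep predT) //= [RHS]big_seq.
rewrite big_seq; apply: eq_bigr => p /hs pL.
rewrite big_mkcond (bigD1_seq p.1) //= eqxx big1 ?addr0 // => m.
by rewrite eq_sym => /negPf->.
Qed.

Lemma piece_sum (s : seq (int * M)) n : (forall p, p \in s -> gpiece p.1 p.2) ->
  gpiece n (\sum_(p <- s | p.1 == n) p.2).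
Proof.
move=> hs; rewrite big_seq_cond; apply: subsp_sum; first exact: gpiece_subsp.
by move=> p /andP[/hs + /eqP <-].
Qed.

Lemma component_unique (s t : seq (int * M)) n :
  (forall p, p \in s -> gpiece p.1 p.2) -> (forall p, p \in t -> gpiece p.1 p.2) ->
  \sum_(p <- s) p.2 = \sum_(p <- t) p.2 ->
  \sum_(p <- s | p.1 == n) p.2 = \sum_(p <- t | p.1 == n) p.2.
Proof.
move=> hs ht est; pose L := undup (map fst s ++ map fst t).
pose c m := \sum_(p <- s | p.1 == m) p.2 - \sum_(p <- t | p.1 == m) p.2.
have sL p : p \in s -> p.1 \in L
  by move=> ps; rewrite mem_undup mem_cat (map_f fst ps).
have tL p : p \in t -> p.1 \in L
  by move=> ps; rewrite mem_undup mem_cat (map_f fst ps) orbT.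
have [nL|nL] := boolP (n \in L); last first.
  rewrite big_seq_cond [RHS]big_seq_cond !big_pred0 // => p; apply/negP.
    by case/andP=> /tL pL /eqP pn; rewrite -pn pL in nL.
  by case/andP=> /sL pL /eqP pn; rewrite -pn pL in nL.
apply/eqP; rewrite -subr_eq0; apply/eqP.
apply: (gpiece_free (c := c) (s := L)) => //.
- exact: undup_uniq.
- by move=> m; apply: gpieceB; apply: piece_sum.
by rewrite /c sumrB !group_by_degree ?undup_uniq // est subrr.
Qed.

(** A decomposition of x into homogeneous elements, picked by choice; the
    components below do not depend on it, by [component_unique]. *)
Definition gdec (x : M) : seq (int * M) :=
  proj1_sig (constructive_indefinite_description _ (gpiece_span x)).
Lemma gdecP x : (forall p, p \in gdec x -> gpiece p.1 p.2) /\ x = \sum_(p <- gdec x) p.2.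
Proof. by rewrite /gdec; case: constructive_indefinite_description. Qed.

Definition gpr (n : int) (x : M) : M := \sum_(p <- gdec x | p.1 == n) p.2.

Lemma gpr_piece n x : gpiece n (gpr n x).
Proof. by apply: piece_sum; case: (gdecP x). Qed.

Lemma gprE (s : seq (int * M)) x n : (forall p, p \in s -> gpiece p.1 p.2) ->
  x = \sum_(p <- s) p.2 -> gpr n x = \sum_(p <- s | p.1 == n) p.2.
Proof.
by move=> hs xs; have [h1 h2] := gdecP x; apply: component_unique; rewrite // -h2.
Qed.

Lemma gprD n x y : gpr n (x + y) = gpr n x + gpr n y.
Proof.
have [h1 h2] := gdecP x; have [h3 h4] := gdecP y.
rewrite (gprE (s := gdec x ++ gdec y)) ?big_cat //=.
- by move=> p; rewrite mem_cat => /orP[/h1|/h3].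
- by rewrite -h2 -h4.
Qed.

Lemma gpr_sum n (I : Type) (r : seq I) (P : pred I) (F : I -> M) :
  gpr n (\sum_(i <- r | P i) F i) = \sum_(i <- r | P i) gpr n (F i).
Proof.
apply: (big_morph _ (gprD n)).
by rewrite (gprE (s := [::])) // ?big_nil.
Qed.

Lemma gpr_homog m n (x : M) : gpiece m x -> gpr n x = if m == n then x else 0.
Proof.
move=> hx; rewrite (gprE (s := [:: (m, x)])) //=.
- by rewrite big_cons big_nil /= addr0.
- by move=> p; rewrite inE => /eqP->.
- by rewrite big_cons big_nil addr0.
Qed.

Lemma gpr_id n (x : M) : gpiece n x -> gpr n x = x.
Proof. by move=> /gpr_homog->; rewrite eqxx. Qed.

Lemma gprZ a n (b : B) x : in_piece d 0 a (vval b) ->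
  gpr (a + n) (b *: x) = b *: gpr n x.
Proof.
move=> hb; have [h1 h2] := gdecP x.
rewrite {1}h2 scaler_sumr gpr_sum [X in _ = b *: X]/gpr scaler_sumr [RHS]big_mkcond big_seq [RHS]big_seq /=.
apply: eq_bigr => p ps; have /gpr_homog-> := gpieceZ hb (h1 _ ps).
by rewrite (inj_eq (addrI a)).
Qed.

Lemma gpr_span x : exists2 L : seq int, uniq L & x = \sum_(n <- L) gpr n x.
Proof.
have [h1 h2] := gdecP x; exists (undup (map fst (gdec x))); first exact: undup_uniq.
rewrite group_by_degree ?undup_uniq // => p pp.
by rewrite mem_undup map_f.
Qed.
End One.

Lemma gpr_map (M N : gmod k d) (f : M -> N) n x : linear f -> degree0 f ->
  gpr n (f x) = f (gpr n x).
Proof.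
move=> lf df; have [h1 h2] := gdecP x.
have f0 : f 0 = 0 by have := lf (-1) 0 0; rewrite scaler0 addr0 scaleN1r addNr.
have fD y z : f (y + z) = f y + f z by have := lf 1 y z; rewrite !scale1r.
rewrite (gprE (s := [seq (p.1, f p.2) | p <- gdec x])).
- by rewrite big_map /= (big_morph f fD f0).
- by move=> p /mapP[q /h1 hq ->]; apply: df.
- by rewrite {1}h2 (big_morph f fD f0) big_map.
Qed.

End GradedProjection.

(** * Monomials and the ring B *)
Section Monomials.
Variable k : fieldType.
Local Notation S := {mpoly k[2]}.

(** The exponent of x^i y^j. *)
Definition m2 (i j : nat) : 'X_{1..2} := [multinom (if t == ord0 then i else j) | t < 2].

Lemma m2_0 i j : m2 i j ord0 = i. Proof. by rewrite mnmE. Qed.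
Lemma m2_1 i j : m2 i j ord_max = j. Proof. by rewrite mnmE. Qed.
Lemma m2P (m : 'X_{1..2}) : m = m2 (m ord0) (m ord_max).
Proof.
apply/mnmP => t; rewrite mnmE; case: eqP => [->//|ne]; congr (m _); apply: val_inj.
by case: t ne => -[|[|[]]] //= h ne; case: ne; apply: val_inj.
Qed.
Lemma eq_m2 m i j : (m == m2 i j) = (m ord0 == i) && (m ord_max == j).
Proof.
apply/eqP/andP => [->|[/eqP h0 /eqP h1]]; first by rewrite m2_0 m2_1.
by rewrite (m2P m) h0 h1.
Qed.
Lemma mdeg_m2 (m : 'X_{1..2}) : mdeg m = (m ord0 + m ord_max)%N.
Proof.
by rewrite mdegE !big_ord_recl big_ord0 addn0; congr (_ + m _)%N; apply: val_inj.
Qed.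
Lemma m2D i j i' j' : (m2 i j + m2 i' j')%MM = m2 (i + i') (j + j').
Proof. by apply/mnmP => t; rewrite mnmDE !mnmE; case: eqP. Qed.

Lemma mcoeff_sumE (I : Type) (r : seq I) (P : pred I) (F : I -> S) m :
  (\sum_(i <- r | P i) F i)@_m = \sum_(i <- r | P i) (F i)@_m.
Proof. exact: raddf_sum. Qed.

Lemma mcoeffXM_notle (m m' : 'X_{1..2}) (p : S) : ~~ (m <= m')%MM -> ('X_[m] * p)@_m' = 0.
Proof.
move=> h; apply: memN_msupp_eq0; apply: contra h => /msuppM_le /allpairsP[[a b] /= [ha _ ->]].
by move: ha; rewrite msuppX inE => /eqP->; rewrite lem_addr.
Qed.

Lemma mcoeffXM (m m' : 'X_{1..2}) (p : S) : ('X_[m] * p)@_(m + m')%MM = p@_m'.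
Proof. by rewrite mulrC mcoeffMX. Qed.

Lemma mulX_inj (e : 'X_{1..2}) (p : S) : 'X_[e] * p = 0 -> p = 0.
Proof.
move=> h; apply/mpolyP => e'; rewrite mcoeff0 -(mcoeffXM e) h; exact: mcoeff0.
Qed.

Lemma mcoeffXM_supp (e m : 'X_{1..2}) (p : S) : ('X_[e] * p)@_m != 0 ->
  exists2 m', m = (e + m')%MM & p@_m' != 0.
Proof.
move=> h; have le : (e <= m)%MM by apply: contraNT h => h; rewrite mcoeffXM_notle.
have Em : m = (e + (m - e))%MM by rewrite addmC submK.
by exists (m - e)%MM => //; move: h; rewrite {1}Em mcoeffXM.
Qed.

Lemma mpoly_divX (m : 'X_{1..2}) (p : S) :
  (forall m', p@_m' != 0 -> (m <= m')%MM) -> exists q, p = 'X_[m] * q.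
Proof.
move=> h; exists (\sum_(m' <- msupp p) p@_m' *: 'X_[m' - m]).
rewrite mulr_sumr {1}[p]mpolyE big_seq [RHS]big_seq; apply: eq_bigr => m'.
by rewrite mcoeff_msupp => /h hm; rewrite -scalerAr -mpolyXD addmC submK.
Qed.

(** The degree n may be negative: the equality then fails for every monomial,
    as l < d, and p is 0. *)
Lemma in_pieceP d l n (p : S) : (l < d)%N ->
  reflect (forall m, p@_m != 0 -> (mdeg m)%:Z = n * d%:Z + l%:Z) (in_piece d l n p).
Proof.
move=> ld; apply: (iffP idP) => [|h].
  case: n => [n /dhomogP h m|n /eqP-> m]; last by rewrite mcoeff0 eqxx.
  by rewrite -mcoeff_msupp => /h ->; lia.
case: n h => [n|n] h /=.
  by apply/dhomogP => m; rewrite mcoeff_msupp => /h /=; lia.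
apply/eqP/mpolyP => m; rewrite mcoeff0; apply/eqP; apply: contraT => /h.
rewrite NegzE; nia.
Qed.

Lemma hom_expand e (p : S) : (forall m, p@_m != 0 -> mdeg m = e) ->
  p = \sum_(i < e.+1) p@_(m2 i (e - i)) *: 'X_[m2 i (e - i)].
Proof.
move=> h; apply/mpolyP => m; rewrite raddf_sum /=.
have [me|me] := eqVneq (mdeg m) e; last first.
  rewrite big1 => [|i _].
    by apply/eqP; apply: contraR me => /h ->.
  rewrite mcoeffZ mcoeffX; case: eqP => [Em|_]; rewrite ?mulr0 //.
  by move: me; rewrite -Em mdeg_m2 m2_0 m2_1; have := ltn_ord i; lia.
have lt : (m ord0 < e.+1)%N by move: me; rewrite mdeg_m2; lia.
have Em : m = m2 (m ord0) (e - m ord0).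
  by apply/eqP; rewrite eq_m2 eqxx /=; move: me; rewrite mdeg_m2; lia.
rewrite (bigD1 (Ordinal lt)) //= mcoeffZ mcoeffX -Em eqxx mulr1.
rewrite big1 ?addr0 // => i ne; rewrite mcoeffZ mcoeffX.
case: eqP => [E|_]; rewrite ?mulr0 //; case/eqP: ne; apply: val_inj => /=.
by rewrite -E m2_0.
Qed.

End Monomials.

Section VeroneseRing.
Variables (k : fieldType) (d : nat).
Local Notation S := {mpoly k[2]}.
Local Notation B := (vring k d).
Local Notation kc := (@vconst k d).

Lemma vval_inj : injective (@vval k d). Proof. exact: val_inj. Qed.
Lemma vvalM (a b : B) : vval (a * b) = vval a * vval b. Proof. by []. Qed.
Lemma vvalD (a b : B) : vval (a + b) = vval a + vval b. Proof. by []. Qed.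
Lemma vval0 : vval (0 : B) = 0. Proof. by []. Qed.
Lemma vval_sum (I : Type) (r : seq I) (P : pred I) (F : I -> B) :
  vval (\sum_(i <- r | P i) F i) = \sum_(i <- r | P i) vval (F i).
Proof. exact: (big_morph _ vvalD vval0). Qed.
Lemma vval_kc c (b : B) : vval (kc c * b) = c *: vval b.
Proof. by rewrite vvalM /= mul_mpolyC. Qed.

Fact bmon_subproof n i : ('X_[m2 (minn i (n * d)) (n * d - i)] : S) \in in_vring d.
Proof.
apply/in_veroneseP => m; rewrite mcoeffX; case: (_ =P m) => [<- _|]; last by rewrite eqxx.
by exists n; rewrite mdeg_m2 m2_0 m2_1; lia.
Qed.
(** The monomial x^i y^(nd - i), for i <= nd; truncating i makes it total. *)
Definition bmon n i : B := VRing (bmon_subproof n i).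

Lemma bmonE n i : (i <= n * d)%N -> vval (bmon n i) = 'X_[m2 i (n * d - i)].
Proof. by move=> h; rewrite /= (minn_idPl h). Qed.

Lemma bmonM n m i j : (i <= n * d)%N -> (j <= m * d)%N ->
  bmon n i * bmon m j = bmon (n + m) (i + j).
Proof.
move=> hi hj; apply: vval_inj.
rewrite vvalM !bmonE ?mulnDl ?leq_add // -mpolyXD m2D; congr 'X_[m2 _ _]; lia.
Qed.

Lemma bmon_piece n i : in_piece d 0 n%:Z (vval (bmon n i)).
Proof.
by rewrite /= dhomogX /= mdeg_m2 m2_0 m2_1; apply/eqP; lia.
Qed.

Lemma bmon_neq0 n i : bmon n i != 0.
Proof.
apply/eqP => /(congr1 (@vval k d)) /= /(congr1 (fun p : S => p@_(m2 (minn i (n * d)) (n * d - i)))).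
by rewrite mcoeffX eqxx mcoeff0 => /eqP; rewrite oner_eq0.
Qed.

Lemma bmon00 : bmon 0 0 = 1.
Proof.
apply: val_inj => /=; rewrite -mpolyX0; congr 'X_[_].
by apply/eqP; rewrite eq_sym eq_m2 !mnm0E.
Qed.

(** The generators x^i y^(d-i) of B; u and v are the two extreme ones. *)
Definition w (i : nat) : B := bmon 1 i.
Definition u : B := w d.
Definition v : B := w 0.

Lemma w_piece i : in_piece d 0 1 (vval (w i)). Proof. exact: bmon_piece. Qed.

Lemma vmul_eq0 (a b : B) : a * b = 0 -> a = 0 \/ b = 0.
Proof.
move=> /(congr1 (@vval k d)) /eqP; rewrite vvalM mulf_eq0 => /orP[]/eqP h; [left|right];
  exact: val_inj.
Qed.

Variable d_gt0 : (0 < d)%N.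

Lemma piece_expand n (b : B) : in_piece d 0 n%:Z (vval b) ->
  b = \sum_(i < (n * d).+1) kc ((vval b)@_(m2 i (n * d - i))) * bmon n i.
Proof.
move=> /(in_pieceP _ _ d_gt0) h; apply: vval_inj.
rewrite vval_sum {1}(@hom_expand k (n * d) (vval b)); last first.
  by move=> m /h; lia.
by apply: eq_bigr => i _; rewrite vval_kc bmonE // -ltnS.
Qed.

Lemma bmonS n i : (i <= n.+1 * d)%N ->
  bmon n.+1 i = w (i - minn i (n * d)) * bmon n (minn i (n * d)).
Proof.
move=> hi; rewrite /w bmonM ?mul1n; try lia.
by rewrite add1n subnK ?geq_minl.
Qed.

Lemma wE i : (i <= d)%N -> vval (w i) = 'X_[m2 i (d - i)].
Proof. by move=> h; rewrite bmonE mul1n. Qed.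

(** This is m^2 = (u, v) m: if i + j >= d the product of the two monomials is
    divisible by x^d, otherwise by y^d. *)
Lemma w_mul_uv i j : (i <= d)%N -> (j <= d)%N -> exists l, (l <= d)%N /\
  (w i * w j = u * w l \/ w i * w j = v * w l).
Proof.
move=> hi hj; rewrite /u /v /w bmonM ?mul1n //.
case: (leqP d (i + j)) => h.
  exists (i + j - d)%N; split; first lia.
  by left; rewrite bmonM ?mul1n; [congr bmon| |]; lia.
exists (i + j)%N; split; first lia.
by right; rewrite bmonM ?mul1n // ltnW.
Qed.

(** B is generated in degree one, so the w i generate its maximal ideal. *)
Lemma irrelevantE (b : B) : irrelevant b ->
  exists c : 'I_d.+1 -> B, b = \sum_(i < d.+1) w i * c i.
Proof.
move=> hb.
pose P (b : B) := exists c : 'I_d.+1 -> B, b = \sum_(i < d.+1) w i * c i.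
have P0 : P 0 by exists (fun=> 0); rewrite big1 // => i _; rewrite mulr0.
have PD x y : P x -> P y -> P (x + y).
  move=> [c ->] [e ->]; exists (fun i => c i + e i).
  by rewrite -big_split; apply: eq_bigr => i _; rewrite mulrDr.
have PM c x : P x -> P (c * x).
  move=> [e ->]; exists (fun i => c * e i); rewrite mulr_sumr.
  by apply: eq_bigr => i _; rewrite mulrCA.
have hbm m : m \in msupp (vval b) -> exists2 n, mdeg m = (n.+1 * d)%N &
    (m ord0 <= n.+1 * d)%N.
  rewrite mcoeff_msupp => bm; have /in_veroneseP/(_ _ bm)[[|n] En] := vvalP b.
    have /eqP : mdeg m = 0%N by lia.
    by rewrite mdeg_eq0 => /eqP E; case/eqP: bm; rewrite E.
  by exists n; move: En; rewrite mdeg_m2; lia.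
have Eb : b = \sum_(m <- msupp (vval b)) kc ((vval b)@_m) * bmon (mdeg m %/ d) (m ord0).
  apply: vval_inj.
  rewrite vval_sum {1}[vval b]mpolyE big_seq [RHS]big_seq; apply: eq_bigr => m /hbm[n En hn].
  rewrite vval_kc En mulnK // bmonE //; congr (_ *: 'X_[_]).
  by apply/eqP; rewrite eq_m2 eqxx /=; move: En; rewrite mdeg_m2; lia.
rewrite -/(P b) Eb big_seq; elim/big_ind: _ => // m /hbm[n En hn]; apply: PM.
rewrite En mulnK // bmonS //.
have lt : (m ord0 - minn (m ord0) (n * d) < d.+1)%N by rewrite mulSn in hn; lia.
exists (fun j => if j == Ordinal lt then bmon n (minn (m ord0) (n * d)) else 0).
by rewrite (bigD1 (Ordinal lt)) //= eqxx big1 ?addr0 // => j /negPf->; rewrite mulr0.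
Qed.

(** A form of membership in m M with a fixed number of terms, one for each w i. *)
Lemma in_mM_w (M : lmodType B) (x : M) : in_mM x <->
  exists z : 'I_d.+1 -> M, x = \sum_(i < d.+1) w i *: z i.
Proof.
split=> [[n [b [y [hb ->]]]]|[z ->]]; last first.
  exists d.+1, (fun i => w i), z; split=> // i; rewrite /irrelevant mcoeffX.
  case: eqP => // /(congr1 mdeg); rewrite mdeg0 mdeg_m2 m2_0 m2_1; have := ltn_ord i; lia.
have [c hc] := fin_all_exists (fun i => irrelevantE (hb i)).
exists (fun j => \sum_(i < n) c i j *: y i).
rewrite (eq_bigr (fun i => \sum_(j < d.+1) w j *: (c i j *: y i))); last first.
  by move=> i _; rewrite {1}hc scaler_suml; apply: eq_bigr => j _; rewrite scalerA.
by rewrite exchange_big; apply: eq_bigr => j _; rewrite scaler_sumr.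
Qed.

Lemma vval_u : vval u = 'X_[m2 d 0]. Proof. by rewrite wE // subnn. Qed.
Lemma vval_v : vval v = 'X_[m2 0 d]. Proof. by rewrite wE // subn0. Qed.

(** If x^d f = - y^d g in S, then y^d divides f; the quotient lies in B because
    its degree is still a multiple of d. *)
Lemma uv_regular n (f g : B) : in_piece d 0 n (vval f) -> u * f + v * g = 0 ->
  exists h, [/\ in_piece d 0 (n - 1) (vval h), f = v * h & g = - (u * h)].
Proof.
move=> /(in_pieceP _ _ d_gt0) hf E.
have ES : 'X_[m2 d 0] * vval f = - ('X_[m2 0 d] * vval g).
  by apply/eqP; rewrite -addr_eq0 -vval_u -vval_v -!vvalM -vvalD E.
have [q Eq] : exists q, vval f = 'X_[m2 0 d] * q.
  apply: mpoly_divX => m; apply: contraNT => hm.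
  rewrite -(mcoeffXM (m2 d 0)) ES mcoeffN mcoeffXM_notle ?oppr0 //.
  apply: contra hm => /mnm_lepP hm; apply/mnm_lepP => t.
  have := hm t; rewrite mnmDE !mnmE; case: eqP => // _; lia.
have hq m : q@_m != 0 -> (mdeg m)%:Z = (n - 1) * d%:Z + 0%:Z.
  rewrite -(mcoeffXM (m2 0 d)) -Eq => /hf; rewrite mdegD mdeg_m2 m2_0 m2_1; lia.
have qB : q \in in_vring d.
  have [q0|/eqP q0] := eqVneq q 0; first by rewrite q0 rpred0.
  have nn : (0 <= n - 1).
    apply: NNPP => h; apply: q0; apply/mpolyP => m; rewrite mcoeff0.
    apply/eqP; apply: contraT => /hq; nia.
  by apply/in_veroneseP => m /hq; exists `|n - 1|%N; nia.
exists (VRing qB); split; first exact/in_pieceP.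
  by apply: val_inj; rewrite /= Eq -vval_v.
apply: val_inj; change (vval g = - (vval u * q)); rewrite vval_u.
apply/eqP; rewrite -subr_eq0 opprK; apply/eqP/(@mulX_inj k (m2 0 d)).
by rewrite mulrDr mulrCA -Eq -[X in X + _]opprK -ES addNr.
Qed.

(** The middle monomials x^i y^(d-i), 0 < i < d, are independent modulo (u, v),
    as none of them occurs in a multiple of x^d or y^d. *)
Lemma w_indep_uv (c : 'I_d.-1 -> k) (f g : B) :
  \sum_(i < d.-1) kc (c i) * w i.+1 = u * f + v * g -> forall i, c i = 0.
Proof.
move=> /(congr1 (@vval k d)) E i.
have := congr1 (fun p : S => p@_(m2 i.+1 (d - i.+1))) E.
have lti := ltn_ord i.
rewrite vvalD !vvalM vval_u vval_v mcoeffD !mcoeffXM_notle ?addr0; first last.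
- by apply/mnm_lepP => h; have := h ord0; have := h ord_max; rewrite !m2_0 !m2_1; lia.
- by apply/mnm_lepP => h; have := h ord0; have := h ord_max; rewrite !m2_0 !m2_1; lia.
move=> <-; rewrite vval_sum mcoeff_sumE (bigD1 i) // vval_kc mcoeffZ wE; last lia.
rewrite mcoeffX eqxx mulr1 big1 => [|j ne]; first by rewrite /= addr0.
have ltj := ltn_ord j.
rewrite vval_kc mcoeffZ wE; last lia.
rewrite mcoeffX eq_m2 m2_0 eqSS; case: eqP => [E'|_]; rewrite ?mulr0 //.
by case/eqP: ne; apply: val_inj.
Qed.

Lemma bmon_indep n (c : 'I_(n * d).+1 -> k) :
  \sum_(i < (n * d).+1) kc (c i) * bmon n i = 0 -> forall i, c i = 0.
Proof.
move=> /(congr1 (@vval k d)) E i.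
have := congr1 (fun p : S => p@_(m2 i (n * d - i))) E.
rewrite mcoeff0 => <-; rewrite vval_sum mcoeff_sumE (bigD1 i) // vval_kc mcoeffZ.
rewrite bmonE; last by rewrite -ltnS.
rewrite mcoeffX eqxx mulr1 big1 => [|j ne]; first by rewrite /= addr0.
rewrite vval_kc mcoeffZ bmonE; last by rewrite -ltnS.
rewrite mcoeffX eq_m2 m2_0; case: eqP => [E'|_]; rewrite ?mulr0 //.
by case/eqP: ne; apply: val_inj.
Qed.

End VeroneseRing.

(** * Graded submodules and the ideals m and (u, v) *)
Section GradedSubmodules.
Variables (k : fieldType) (d : nat) (d_gt0 : (0 < d)%N).
Local Notation kc := (@vconst k d).
Local Notation w := (@w k d).
Local Notation u := (@u k d).
Local Notation v := (@v k d).

Section One.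
Variable X : gmod k d.
Implicit Types (K : X -> Prop) (x y : X).

Definition allp (x : X) : Prop := True.
(** For a graded submodule K of X, the three predicates below are the pieces
    K_j, (m K)_j and ((u, v) K)_j; [allp] is X itself. *)
Definition hp K (j : int) x : Prop := gpiece j x /\ K x.
Definition mp K (j : int) x : Prop :=
  exists z : 'I_d.+1 -> X, (forall i, hp K (j - 1) (z i)) /\ x = \sum_(i < d.+1) w i *: z i.
Definition up K (j : int) x : Prop :=
  exists a b, [/\ hp K (j - 1) a, hp K (j - 1) b & x = u *: a + v *: b].

Definition gsub K : Prop :=
  [/\ K 0, forall b x y, K x -> K y -> K (b *: x + y) & forall n x, K x -> K (gpr n x)].

Lemma gsub_all : gsub allp. Proof. by []. Qed.

Lemma gsubZ K b x : gsub K -> K x -> K (b *: x).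
Proof. by move=> [h0 h _] hx; rewrite -[_ *: _]addr0; apply: h. Qed.
Lemma gsubD K x y : gsub K -> K x -> K y -> K (x + y).
Proof. by move=> [_ h _] hx hy; rewrite -[x]scale1r; apply: h. Qed.
Lemma gsub_subsp K : gsub K -> subsp K.
Proof. by move=> [h0 h _]; split=> // c x y; apply: h. Qed.
Lemma gsubN K x : gsub K -> K x -> K (- x).
Proof. by move=> hK hx; apply: subspN => //; apply: gsub_subsp. Qed.

Lemma hp_subsp K j : gsub K -> subsp (hp K j).
Proof.
move=> hK; split=> [|c x y [hx Kx] [hy Ky]].
  by split; [apply: gpiece0 | case: hK].
by split; [apply: gpieceD => //; apply: gpiece_kc | case: hK => _ h _; apply: h].
Qed.

Lemma mp_subsp K j : gsub K -> subsp (mp K j).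
Proof.
move=> hK; have hS := hp_subsp (j - 1) hK; split=> [|c x y [z [hz ->]] [t [ht ->]]].
  exists (fun=> 0); split=> [i|]; first exact: hS.1.
  by rewrite big1 // => i _; rewrite scaler0.
exists (fun i => kc c *: z i + t i); split=> [i|]; first by apply: hS.2.
rewrite scaler_sumr -big_split; apply: eq_bigr => i _ /=.
by rewrite scalerDr !scalerA mulrC.
Qed.

Lemma up_subsp K j : gsub K -> subsp (up K j).
Proof.
move=> hK; have hS := hp_subsp (j - 1) hK; split.
  by exists 0, 0; split; rewrite ?scaler0 ?addr0 //; apply: hS.1.
move=> c x y [a [b [ha hb ->]]] [a' [b' [ha' hb' ->]]].
exists (kc c *: a + a'), (kc c *: b + b'); split; try exact: hS.2.
by rewrite !scalerDr !scalerA ![kc c * _]mulrC -!addrA; congr (_ + _); rewrite addrCA.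
Qed.

Lemma mp_hp K j x : gsub K -> mp K j x -> hp K j x.
Proof.
move=> hK [z [hz ->]]; apply: subsp_sum => [|i _]; first exact: hp_subsp.
have [h1 h2] := hz i; split; last exact: gsubZ.
by rewrite -[j](subrKC 1) ; apply: gpieceZ => //; apply: w_piece.
Qed.

Lemma hp_mp K j x (i : 'I_d.+1) : gsub K -> hp K j x -> mp K (j + 1) (w i *: x).
Proof.
move=> hK hx; exists (fun l => if l == i then x else 0); split=> [l|].
  by rewrite addrK; case: eqP => // _; apply: (hp_subsp _ hK).1.
by rewrite (bigD1 i) //= eqxx big1 ?addr0 // => l /negPf->; rewrite scaler0.
Qed.

Lemma up_mp K j x : gsub K -> up K j x -> mp K j x.
Proof.
move=> hK [a [b [ha hb ->]]]; rewrite -[j](subrK 1).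
apply: subspD; first exact: mp_subsp.
  exact: (hp_mp ord_max).
exact: (hp_mp ord0).
Qed.

Lemma hp_up K j x y : gsub K -> hp K j x -> hp K j y -> up K (j + 1) (u *: x + v *: y).
Proof. by move=> hK hx hy; exists x, y; rewrite addrK. Qed.

(** m^2 K = (u, v) m K is contained in (u, v) K. *)
Lemma mp_w_up K j x (i : nat) : (i <= d)%N -> gsub K -> mp K j x -> up K (j + 1) (w i *: x).
Proof.
move=> hi hK [z [hz ->]]; rewrite scaler_sumr; apply: subsp_sum => [|l _]; first exact: up_subsp.
have ll : (l <= d)%N by rewrite -ltnS.
rewrite scalerA; have [m [hm E]] := @w_mul_uv k d d_gt0 i l hi ll.
have hwm : hp K j (w (inord m : 'I_d.+1) *: z l).
  by rewrite -[j](subrK 1); apply: mp_hp => //; apply: hp_mp.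
rewrite inordK ?ltnS // in hwm; have h0 : hp K j 0 := (hp_subsp j hK).1.
case: E => ->; rewrite -scalerA.
  by have := hp_up hK hwm h0; rewrite scaler0 addr0.
by have := hp_up hK h0 hwm; rewrite scaler0 add0r.
Qed.

Lemma mp_sub K K' j x : (forall x, K x -> K' x) -> mp K j x -> mp K' j x.
Proof. by move=> h [z [hz ->]]; exists z; split=> // i; have [h1 h2] := hz i; split=> //; apply: h. Qed.
Lemma up_sub K K' j x : (forall x, K x -> K' x) -> up K j x -> up K' j x.
Proof.
move=> h [a [b [[h1 h2] [h3 h4] ->]]]; exists a, b.
by split=> //; split=> //; apply: h.
Qed.

(** The coefficients of a homogeneous element of m K can be taken homogeneous. *)
Lemma homog_mp K j x (z : 'I_d.+1 -> X) : gsub K -> gpiece j x ->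
  (forall i, K (z i)) -> x = \sum_(i < d.+1) w i *: z i -> mp K j x.
Proof.
move=> [_ _ hK] hx hz E; exists (fun i => gpr (j - 1) (z i)); split=> [i|].
  by split; [apply: gpr_piece | apply: hK].
rewrite -(gpr_id hx) E gpr_sum; apply: eq_bigr => i _.
by rewrite -[in LHS](subrKC 1 j) (gprZ _ _ (@w_piece k d i)).
Qed.

Lemma in_mM_mp j x : gpiece j x -> (in_mM x <-> mp allp j x).
Proof.
move=> hx; rewrite in_mM_w //; split=> [[z E]|[z [_ E]]]; last by exists z.
exact: (homog_mp gsub_all hx _ E).
Qed.

(** X / K has no nonzero element killed by u and v.  Kernels of maps to free
    modules, or to modules of positive depth, are of this kind. *)
Definition sat K : Prop := forall x, K (u *: x) -> K (v *: x) -> K x.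

(** Regularity of u, v on K, in the form of exactness of the Koszul complex at
    its middle term. *)
Definition uvreg K : Prop := forall n a b, hp K n a -> hp K n b -> u *: a + v *: b = 0 ->
  exists c, [/\ hp K (n - 1) c, a = v *: c & b = - (u *: c)].

(** The Koszul relation has a solution c in X, with u c and v c in K. *)
Lemma sat_uvreg K : uvreg allp -> gsub K -> sat K -> uvreg K.
Proof.
move=> hX hK hs n a b [ha Ka] [hb Kb] E.
have [c [[hc _] Ea Eb]] := hX n a b (conj ha I) (conj hb I) E.
exists c; split=> //; split=> //; apply: hs; last by rewrite -Ea.
by rewrite -[u *: c]opprK -Eb; apply: gsubN.
Qed.

End One.

Section Maps.
Variables (X Y : gmod k d) (f : {linear X -> Y}) (df : degree0 f).

Definition kerp (x : X) : Prop := f x = 0.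
Definition imp (y : Y) : Prop := exists x, f x = y.

Lemma gsub_ker : gsub kerp.
Proof.
split=> [|b x y hx hy|n x hx]; rewrite /kerp.
- exact: linear0.
- by rewrite linearP hx hy scaler0 addr0.
by rewrite -(gpr_map _ _ (@linearP _ _ _ _ f) df) hx (gpr_homog _ (gpiece0 _ n)) eqxx.
Qed.

Lemma gsub_im : gsub imp.
Proof.
split=> [|b _ _ [x <-] [y <-]|n _ [x <-]].
- by exists 0; rewrite linear0.
- by exists (b *: x + y); rewrite linearP.
by exists (gpr n x); rewrite -(gpr_map _ _ (@linearP _ _ _ _ f) df).
Qed.

Lemma hp_im j y : hp imp j y -> exists2 x, gpiece j x & f x = y.
Proof.
move=> [hy [x E]]; exists (gpr j x); first exact: gpr_piece.
by rewrite -(gpr_map _ _ (@linearP _ _ _ _ f) df) E gpr_id.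
Qed.

Lemma im_hp j x : gpiece j x -> hp imp j (f x).
Proof. by move=> /df hx; split=> //; exists x. Qed.

Lemma mp_im j x : mp (@allp X) j x -> mp imp j (f x).
Proof.
move=> [z [hz ->]]; exists (fun i => f (z i)); split=> [i|].
  by apply: im_hp; have [] := hz i.
by rewrite linear_sum; apply: eq_bigr => i _; rewrite linearZ_LR.
Qed.

Lemma im_mp j y : mp imp j y -> exists2 x, mp (@allp X) j x & f x = y.
Proof.
move=> [z [hz ->]].
have hz' i : exists x, gpiece (j - 1) x /\ f x = z i by have [x] := hp_im (hz i); exists x.
have [t /all_and2[h1 h2]] := fin_all_exists hz'.
exists (\sum_(i < d.+1) w i *: t i); first by exists t; split.
by rewrite linear_sum; apply: eq_bigr => i _; rewrite linearZ_LR h2.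
Qed.

Lemma up_im j x : up (@allp X) j x -> up imp j (f x).
Proof.
move=> [a [b [[ha _] [hb _] ->]]]; exists (f a), (f b).
by split; [exact: im_hp | exact: im_hp | rewrite linearD !linearZ_LR].
Qed.

Lemma im_up j y : up imp j y -> exists2 x, up (@allp X) j x & f x = y.
Proof.
move=> [a [b [/hp_im[a' ha <-] /hp_im[b' hb <-] ->]]].
by exists (u *: a' + v *: b'); [exists a', b' | rewrite linearD !linearZ_LR].
Qed.
End Maps.

End GradedSubmodules.
Arguments allp {k d X}.

(** * Free modules *)
(** For d = 1 both sides are 0. *)
Lemma sum_middle (V : zmodType) (d : nat) (G : nat -> V) : (0 < d)%N ->
  \sum_(i < d.+1) (if (0 < i < d)%N then G i else 0) = \sum_(i < d.-1) G i.+1.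
Proof.
case: d => // d _; rewrite big_ord_recl /= add0r big_ord_recr /= /bump /= add1n ltnn addr0.
by apply: eq_bigr => i _; rewrite /= /bump add1n ltnS ltn_ord.
Qed.

Section SumSpaces.
Variables (k : fieldType) (d : nat) (M : lmodType (vring k d)).
Implicit Types (U V W : M -> Prop).

Definition sumsp U V x : Prop := exists y z, [/\ U y, V z & x = y + z].

Lemma sumsp_subsp U V : subsp U -> subsp V -> subsp (sumsp U V).
Proof.
move=> hU hV; split=> [|c x y [a [b [ha hb ->]]] [a' [b' [ha' hb' ->]]]].
  by exists 0, 0; split; rewrite ?addr0 //; [exact: hU.1 | exact: hV.1].
exists (vconst d c *: a + a'), (vconst d c *: b + b'); split; [exact: hU.2 | exact: hV.2|].
by rewrite scalerDr addrACA.
Qed.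

Lemma sumsp_l U V x : subsp V -> U x -> sumsp U V x.
Proof. by move=> hV hx; exists x, 0; split; rewrite ?addr0 //; exact: hV.1. Qed.
Lemma sumsp_r U V x : subsp U -> V x -> sumsp U V x.
Proof. by move=> hV hx; exists 0, x; split; rewrite ?add0r //; exact: hV.1. Qed.

(** The second isomorphism theorem: (U + V) / U = V / (U \cap V). *)
Lemma qd_second U V W n : subsp U -> subsp V -> (forall x, V x -> (U x <-> W x)) ->
  has_quot_dim V W n -> has_quot_dim (sumsp U V) U n.
Proof.
move=> hU hV h; apply: (@qd_map k d M M id) => // [x Vx|y [a [b [ha hb ->]]]].
  exact: sumsp_r.
by exists b => //; rewrite addrK.
Qed.
End SumSpaces.

Section FreeModules.
Variables (k : fieldType) (d : nat) (d_gt0 : (0 < d)%N).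
Local Notation B := (vring k d).
Local Notation kc := (@vconst k d).
Local Notation w := (@w k d).
Local Notation u := (@u k d).
Local Notation v := (@v k d).

Lemma kc_inj0 c : kc c = 0 -> c = 0.
Proof. by move=> /(congr1 (@vval k d)) /= /eqP; rewrite mpolyC_eq0 => /eqP. Qed.

Lemma piece0_const (b : B) : in_piece d 0 0 (vval b) -> b = kc ((vval b)@_(m2 0 0)).
Proof.
by move=> /(@piece_expand k d d_gt0 0%N) {1}->; rewrite mul0n big_ord1 bmon00 mulr1.
Qed.

Section Free.
Variables (r : nat) (a : 'I_r -> int).
Let F := gfree k d_gt0 a.

Lemma free_scaleE (b : B) (f : F) i : (b *: f) i = b * (f i : B).
Proof. by rewrite ffunE. Qed.

Lemma free_sumE (I : Type) (s : seq I) (P : pred I) (G : I -> F) i :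
  (\sum_(l <- s | P l) G l) i = \sum_(l <- s | P l) (G l i : B).
Proof. by rewrite sum_ffunE. Qed.

Lemma free_torsionfree (b : B) (f : F) : b != 0 -> b *: f = 0 -> f = 0.
Proof.
move=> /eqP b0 E; apply/ffunP => i; rewrite ffunE.
have := congr1 (fun g : F => g i) E; rewrite free_scaleE ffunE => /vmul_eq0[] //.
Qed.

Lemma free_uvreg : uvreg (@allp k d F).
Proof.
move=> n f g [hf _] [hg _] E.
have hc i : exists h : B, [/\ in_piece d 0 (n - a i - 1) (vval h), f i = v * h & g i = - (u * h)].
  apply: uv_regular => //; first exact: hf.
  by have := congr1 (fun h : F => h i) E; rewrite !ffunE.
have [h hh] := fin_all_exists hc.
exists ([ffun i => h i] : F); split.
- by split=> // i; have [] := hh i; rewrite ffunE addrAC.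
- by apply/ffunP => i; have [] := hh i; rewrite !ffunE.
- by apply/ffunP => i; have [] := hh i; rewrite !ffunE.
Qed.

Lemma free_sat_uvreg (K : F -> Prop) : gsub K -> sat K -> uvreg K.
Proof. exact: (sat_uvreg free_uvreg). Qed.

(** The standard basis of F. *)
Definition gbas (i : 'I_r) : F := [ffun j => if j == i then 1 else 0].

Lemma gbas_piece i : gpiece (a i) (gbas i).
Proof.
move=> j; rewrite ffunE; case: eqP => [->|_]; last exact: in_piece0.
by rewrite subrr /= mul0n addn0 dhomog1.
Qed.

Lemma gbas_expand (f : F) : f = \sum_i (f i : B) *: gbas i.
Proof.
apply/ffunP => j; rewrite free_sumE (bigD1 j) //= big1 => [|i ne].
  by rewrite !ffunE eqxx /= addr0 [_ *: _]mulr1.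
by rewrite !ffunE eq_sym (negPf ne) [_ *: _]mulr0.
Qed.

Section Lift.
Variables (N : gmod k d) (y : 'I_r -> N).
Definition lift_fun (f : F) : N := \sum_i (f i : B) *: y i.
Fact lift_linear : linear lift_fun.
Proof.
move=> b f g; rewrite /lift_fun scaler_sumr -big_split; apply: eq_bigr => i _ /=.
by rewrite !ffunE scalerA -scalerDl.
Qed.
HB.instance Definition _ := GRing.isLinear.Build B F N *:%R lift_fun lift_linear.

Lemma free_lift : (forall i, gpiece (a i) (y i)) ->
  exists h : {linear F -> N}, degree0 h /\ forall f, h f = \sum_i (f i : B) *: y i.
Proof.
move=> hy; exists lift_fun; split=> // n f hf; rewrite /= /lift_fun.
apply: subsp_sum => [|i _]; first exact: gpiece_subsp.
by rewrite -[n](subrK (a i)); apply: gpieceZ; [apply: hf | apply: hy].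
Qed.
End Lift.

(** An element of F_j is in m F as soon as its coordinates of degree 0 vanish,
    all others having entries in m. *)
Lemma free_noconst j (f : F) : gpiece j f -> (forall i, a i = j -> f i = 0) -> mp allp j f.
Proof.
move=> hf h0.
have hi i : exists c : 'I_d.+1 -> B, (f i : B) = \sum_(l < d.+1) w l * c l.
  apply: irrelevantE => //; rewrite /irrelevant.
  have [E|ne] := eqVneq (a i) j; first by rewrite h0 // mcoeff0.
  have /(in_pieceP _ _ d_gt0) h := hf i.
  apply/eqP; apply: contraNT ne => /h; rewrite mdeg0 => E; apply/eqP; nia.
have [c hc] := fin_all_exists hi.
apply: (@homog_mp k d F allp j f (fun l => [ffun i => c i l])) => //.
apply/ffunP => i; rewrite hc free_sumE; apply: eq_bigr => l _.
by rewrite !ffunE.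
Qed.

Lemma mp_free_const j (f : F) i : mp allp j f -> a i = j -> f i = 0.
Proof.
move=> [z [hz ->]] E; rewrite free_sumE big1 // => l _.
have [h _] := hz l; have := h i; rewrite E.
have -> : j - 1 - j = Negz 0 by lia.
by move=> /eqP h0; rewrite ffunE; have -> : z l i = 0 by [apply: val_inj]; rewrite [_ *: _]mulr0.
Qed.

Lemma gens_qd j : has_quot_dim (@hp _ _ F allp j) (mp allp j) #|[pred i | a i == j]|.
Proof.
pose I := {i : 'I_r | a i == j}.
have -> : #|[pred i | a i == j]| = #|{: I}| by rewrite card_sig.
have hcoord (c : I -> k) (i : I) : lincomb (fun i : I => gbas (val i)) c (val i) = kc (c i).
  rewrite /lincomb free_sumE (bigD1 i) //= big1 => [|l ne].
    by rewrite !ffunE eqxx addr0 [_ *: _]mulr1.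
  by rewrite !ffunE eq_sym (inj_eq val_inj) (negPf ne) [_ *: _]mulr0.
apply: (qd_fin (e := fun i : I => gbas (val i))); split=> [[i /= /eqP <-]|c hc i|x [hx _]].
- by split=> //; apply: gbas_piece.
- apply: kc_inj0; rewrite -hcoord; apply: mp_free_const hc _.
  exact/eqP/(valP i).
exists (fun i => (vval (x (val i)))@_(m2 0 0)).
apply: free_noconst => [|i E].
  apply: (@gpieceB k d F j) => //.
  apply: (@subsp_sum k d F (gpiece (g := F) j)) => [|l _]; first exact: gpiece_subsp.
  by apply: (@gpiece_kc k d F); have := gbas_piece (val l); rewrite (eqP (valP l)).
have Ei : a i == j by apply/eqP.
have := hcoord (fun i => (vval (x (val i)))@_(m2 0 0)) (exist _ i Ei).
rewrite /= !ffunE => ->; rewrite -piece0_const ?subrr //.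
by have := hx i; rewrite E subrr.
Qed.

(** With c = dim K_j / (K \cap m F)_j, the space (m K + (u, v) F) / (u, v) F has
    dimension (d-1) c in degree j + 1: a basis is given by the products of the
    d - 1 middle monomials with a lift of a basis of K / (K \cap m F).  An
    element of K \cap m F contributes nothing, as m^2 = (u, v) m. *)
Lemma qd_middle (K : F -> Prop) j c : gsub K ->
  has_quot_dim (hp K j) (fun x => hp K j x /\ mp allp j x) c ->
  has_quot_dim (mp K (j + 1)) (fun x => mp K (j + 1) x /\ up allp (j + 1) x) (d.-1 * c).
Proof.
move=> hK /qdE[e [e1 e2 e3]].
pose W (x : F) := mp K (j + 1) x /\ up allp (j + 1) x.
have hW : subsp W.
  have h1 := mp_subsp (j + 1) hK; have h2 := up_subsp (j + 1) (@gsub_all k d F).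
  split=> [|b x y [hx hx'] [hy hy']]; first by split; [exact: h1.1 | exact: h2.1].
  by split; [exact: h1.2 | exact: h2.2].
have lt_d (i : 'I_d.-1) : (i.+1 < d.+1)%N by have := ltn_ord i; lia.
have hwK i x : (i <= d)%N -> hp K j x -> mp K (j + 1) (w i *: x).
  by move=> hi; rewrite -ltnS in hi; exact: (hp_mp (Ordinal hi)).
pose q (p : 'I_d.-1 * 'I_c) : F := w p.1.+1 *: e p.2.
have qE (b : 'I_d.-1 * 'I_c -> k) :
    lincomb q b = \sum_(i < d.-1) w i.+1 *: lincomb e (fun l => b (i, l)).
  rewrite /lincomb.
  under [RHS]eq_bigr do rewrite scaler_sumr.
  rewrite pair_bigA /=; apply: eq_bigr => -[i l] _ /=.
  by rewrite /q !scalerA mulrC.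
have -> : (d.-1 * c = #|{: 'I_d.-1 * 'I_c}|)%N by rewrite card_prod !card_ord.
apply: (qd_fin (e := q)); split=> [[i l]|b [_ [f [g [_ _ E]]]] [i l]|x [z [hz ->]]].
- by apply: hwK => //; rewrite -ltnS; apply: lt_d.
- rewrite qE in E.
  suff /e2/(_ l) : hp K j (lincomb e (fun l => b (i, l))) /\
      mp allp j (lincomb e (fun l => b (i, l))) by [].
  have hy i' : hp K j (lincomb e (fun l => b (i', l))).
    by apply: subsp_sum => [|l' _]; [|apply: subspZ => //]; exact: hp_subsp.
  split=> //; apply: free_noconst => [|t Et]; first by have [] := hy i.
  have hconst i' : (lincomb e (fun l => b (i', l)) t : B) =
      kc ((vval (lincomb e (fun l => b (i', l)) t))@_(m2 0 0)).
    by apply: piece0_const; have [/(_ t)] := hy i'; rewrite Et subrr.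
  rewrite hconst.
  have := congr1 (fun h : F => h t) E; rewrite free_sumE !ffunE /= => Et'.
  rewrite (@w_indep_uv k d d_gt0 (fun i' => (vval (lincomb e (fun l => b (i', l)) t))@_(m2 0 0))
    (f t) (g t)) ?rmorph0 //.
  rewrite -[RHS]Et'; apply: eq_bigr => i' _.
  by rewrite -hconst free_scaleE mulrC.
have hb i : exists b : 'I_c -> k, mp allp j (z i - lincomb e b).
  have [h1 h2] := hz i; rewrite addrK in h1.
  by have [b [_ hb]] := e3 (z i) (conj h1 h2); exists b.
have [b hb'] := fin_all_exists hb.
pose bq (p : 'I_d.-1 * 'I_c) := b (inord p.1.+1) p.2.
exists bq.
have hzi i : hp K j (z i) by have := hz i; rewrite addrK.
have -> : \sum_(i < d.+1) w i *: z i - lincomb q bq =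
    \sum_(i < d.+1) (w i *: z i - if (0 < i < d)%N then w i *: lincomb e (b i) else 0).
  have S := sum_middle (fun i => w i *: lincomb e (b (inord i)) : F) d_gt0.
  rewrite sumrB qE; congr (_ - _); apply: etrans (esym S) _.
  by apply: eq_bigr => i _; rewrite inord_val.
have hlc b' : hp K j (lincomb e b').
  by apply: subsp_sum => [|l' _]; [|apply: subspZ => //]; exact: hp_subsp.
rewrite -/(W _); apply: subsp_sum => // i _; rewrite /W.
have hi : (i <= d)%N by rewrite -ltnS.
have hA := @gsub_all k d F.
have hzA : hp allp j (z i) by have [h _] := hzi i.
case: ifP => hid; last first.
  rewrite subr0; split; first exact: hwK.
  have h0 : hp (@allp k d F) j 0 := (hp_subsp j hA).1.
  have [E|E] : i = 0%N :> nat \/ i = d :> nat by lia.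
    by rewrite E; have := hp_up hA h0 hzA; rewrite scaler0 add0r.
  by rewrite E; have := hp_up hA hzA h0; rewrite scaler0 addr0.
rewrite -scalerBr; split; last exact: (mp_w_up d_gt0 hi hA).
by apply: hwK => //; apply: subspB => //; exact: hp_subsp.
Qed.

Lemma qd_middle_all j : has_quot_dim (@mp _ _ F allp (j + 1)) (up allp (j + 1))
  (d.-1 * #|[pred i | a i == j]|).
Proof.
have hA := @gsub_all k d F.
apply: (qd_ext _ _ (qd_middle hA (j := j) (c := #|[pred i | a i == j]|) _)) => // [x|].
  by split=> [[]|hx] //; split=> //; apply: up_mp.
apply: qd_ext (gens_qd j) => // x; split=> [hx|[]] //; split=> //; exact: mp_hp.
Qed.

End Free.
End FreeModules.

(** * Counting linear syzygies *)
Section Covers.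
Variables (k : fieldType) (d : nat) (d_gt0 : (0 < d)%N).
Local Notation B := (vring k d).
Local Notation kc := (@vconst k d).
Local Notation w := (@w k d).
Local Notation u := (@u k d).
Local Notation v := (@v k d).

Lemma and_subsp (M : lmodType B) (U V : M -> Prop) : subsp U -> subsp V ->
  subsp (fun x => U x /\ V x).
Proof.
move=> hU hV; split=> [|c x y [hx hx'] [hy hy']]; first by split; [exact: hU.1 | exact: hV.1].
by split; [exact: hU.2 | exact: hV.2].
Qed.

(** The piece (K \cap m X)_j. *)
Definition nomin (X : gmod k d) (K : X -> Prop) j x : Prop := hp K j x /\ mp allp j x.

Lemma nomin_subsp (X : gmod k d) (K : X -> Prop) j : gsub K -> subsp (nomin K j).
Proof. by move=> hK; apply: and_subsp; [exact: hp_subsp | exact: mp_subsp]. Qed.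

Section One.
Variables (r : nat) (a : 'I_r -> int).
Let F := gfree k d_gt0 a.
(** The number of generators of F in degree j. *)
Definition ngens (j : int) : nat := #|[pred i | a i == j]|.
Variables (X : gmod k d) (f : {linear F -> X}) (df : degree0 f).
Let K : F -> Prop := kerp f.
Let N : X -> Prop := imp f.
Let hK : gsub K. Proof. exact: gsub_ker. Qed.
Let hN : gsub N. Proof. exact: gsub_im. Qed.
Let hA : gsub (@allp k d F). Proof. exact: gsub_all. Qed.
Let lf : linear f. Proof. exact: linearP. Qed.

(** F / m F is an extension of N / m N by K / (K \cap m F), where N = F / K. *)
Lemma dim_gens j c t : has_quot_dim (hp K j) (nomin K j) c ->
  has_quot_dim (hp N j) (mp N j) t -> ngens j = (c + t)%N.
Proof.
move=> hc ht.
have hm := mp_subsp j hA; have hh := hp_subsp j hK.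
suff h : has_quot_dim (@hp _ _ F allp j) (mp allp j) (c + t).
  exact: (qd_uniq hm (gens_qd _ d_gt0 a j) h).
apply: (@qd_add k d F _ (sumsp (mp allp j) (hp K j)) _) => //.
- exact: hp_subsp.
- exact: sumsp_subsp.
- by move=> x; apply: sumsp_l.
- move=> x [y [z [hy [hz _] ->]]]; split=> //.
  by apply: (@gpieceD k d F) => //; have [] := mp_hp hA hy.
- apply: (qd_second (W := nomin K j)) => // x hx; split=> [h|[]//]; by split.
apply: (qd_map_back lf (U' := hp N j) (W' := mp N j)) => //.
- exact: mp_subsp.
- by move=> x [hx _]; apply: im_hp.
- move=> y /(hp_im df)[x hx <-]; exists x; rewrite ?subrr //; exact: (mp_subsp _ hN).1.
- move=> x [hx _]; split=> [/(im_mp df)[y hy E]|[y [z [hy [_ hz] ->]]]].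
    exists y, (x - y); split; rewrite ?subrKC //; split.
      by apply: (@gpieceB k d F) => //; have [] := mp_hp hA hy.
    by rewrite /K /kerp linearB E subrr.
  by rewrite linearD hz addr0; apply: mp_im.
exact: hp_subsp.
Qed.

Section Regular.
Hypothesis hreg : uvreg N.

(** (u, v) F meets K in (u, v) K, as u, v is regular on N = F / K: the
    first Koszul homology of N vanishes. *)
Lemma up_ker j x : up allp j x -> K x -> up K j x.
Proof.
move=> [g [h [[hg _] [hh _] Ex]]] Kx.
have E : u *: f g + v *: f h = 0.
  by rewrite -!linearZ_LR -linearD -Ex.
have [c [hc Eg Eh]] := hreg (im_hp df hg) (im_hp df hh) E.
have [y hy Ey] := hp_im df hc.
exists (g - v *: y), (h + u *: y).
have gp (i : 'I_d.+1) : gpiece (j - 1) (w i *: y).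
  by have := gpieceZ (@w_piece k d i) hy; rewrite addrC subrK.
split.
- split; first by apply: (@gpieceB k d F) => //; exact: (gp ord0).
  by rewrite /K /kerp linearB linearZ_LR Ey Eg subrr.
- split; first by apply: (@gpieceD k d F) => //; exact: (gp ord_max).
  by rewrite /K /kerp linearD linearZ_LR Ey Eh addNr.
rewrite Ex scalerBr scalerDr addrACA -[LHS]addr0; congr (_ + _).
by rewrite !scalerA mulrC addNr.
Qed.

(** Both sides are the dimension of (m F / (u, v) F)_(j+1), filtered by
    (u, v) F + m K and (u, v) F + (K \cap m F).  The first layer has
    dimension (d-1) c by [qd_middle], the second is (K \cap m F) / m K by
    [up_ker], a Tor group, and the third is m N / (u, v) N. *)
Lemma dim_linear_syzygies j c s t : has_quot_dim (hp K j) (nomin K j) c ->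
  has_quot_dim (mp N (j + 1)) (up N (j + 1)) s ->
  has_quot_dim (nomin K (j + 1)) (mp K (j + 1)) t ->
  (s + t + d.-1 * c = d.-1 * ngens j)%N.
Proof.
move=> hc hs ht; set J := j + 1 in hs ht *.
have hu := up_subsp J hA; have hmK := mp_subsp J hK; have hn := nomin_subsp J hK.
pose W1 := sumsp (@up k d F allp J) (mp K J).
pose W2 := sumsp (@up k d F allp J) (nomin K J).
have mpn x : mp K J x -> nomin K J x.
  by move=> hx; split; [exact: mp_hp | exact: mp_sub hx].
have q1 : has_quot_dim W1 (up allp J) (d.-1 * c).
  apply: (qd_second (W := fun x => mp K J x /\ up allp J x)) => //.
    by move=> x hx; split=> [|[]].
  exact: qd_middle.
have q2 : has_quot_dim W2 W1 t.
  apply: (@qd_map k d F F id _ (nomin K J) (mp K J)) => //; first exact: sumsp_subsp.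
  - by move=> x hx; apply: sumsp_r.
  - move=> y [g [h [hg hh ->]]]; exists h => //; rewrite addrK; exact: sumsp_l.
  move=> x hx; split=> [[g [h [hg hh E]]]|]; last exact: sumsp_r.
  have [[_ Kx] _] := hx.
  have [_ Kh] := mp_hp hK hh.
  have Kg : K g by rewrite -[g](addrK h) -E; apply: gsubD => //; apply: gsubN.
  rewrite E; apply: subspD => //; apply: up_mp => //; exact: up_ker.
have q3 : has_quot_dim (mp allp J) W2 s.
  apply: (qd_map_back lf (U' := mp N J) (W' := up N J)) => //.
  - exact: up_subsp.
  - by move=> x; apply: mp_im.
  - move=> y /(im_mp df)[x hx <-]; exists x; rewrite ?subrr //; exact: (up_subsp _ hN).1.
  - move=> x hx; split=> [/(im_up df)[y hy E]|[y [z [hy [[_ hz] _] ->]]]]; last first.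
      by rewrite linearD hz addr0; apply: up_im.
    exists y, (x - y); split; rewrite ?subrKC //; split.
      split; last by rewrite /K /kerp linearB E subrr.
      by apply: (@gpieceB k d F); [have [] := mp_hp hA hx | have [] := mp_hp hA (up_mp hA hy)].
    by apply: subspB => //; [exact: mp_subsp | exact: up_mp].
  exact: mp_subsp.
have hW1 : subsp W1 by apply: sumsp_subsp.
have hW2 : subsp W2 by apply: sumsp_subsp.
have W2mp x : W2 x -> mp allp J x.
  move=> [y [z [hy [_ hz] ->]]]; apply: subspD => //; first exact: mp_subsp.
  exact: up_mp.
have hm := mp_subsp J hA.
have q21 : has_quot_dim W2 (up allp J) (d.-1 * c + t).
  apply: (qd_add (V := W1)) => //; first by move=> x; apply: sumsp_l.
  by move=> x [y [z [hy hz ->]]]; exists y, z; split=> //; apply: mpn.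
have := qd_uniq hu (qd_middle_all _ d_gt0 a j) (qd_add hm hW2 hu _ W2mp q21 q3).
rewrite -/(ngens j) => -> //; first by rewrite addnC addnA addnAC addnC addnA.
by move=> x; apply: sumsp_l.
Qed.

(** By [up_ker], m K / (u, v) K is the image of m K in F / (u, v) F. *)
Lemma dim_mK_upK j c : has_quot_dim (hp K j) (nomin K j) c ->
  has_quot_dim (mp K (j + 1)) (up K (j + 1)) (d.-1 * c).
Proof.
move=> /(qd_middle hK); apply: qd_ext => // x; split=> [[hx hx']|hx].
  by apply: up_ker => //; have [] := mp_hp hK hx.
by split; [exact: up_mp | exact: up_sub hx].
Qed.
End Regular.

(** Without regularity of the image, (u, v) K may be smaller than
    K \cap (u, v) F, so only an inequality remains. *)
Lemma dim_mK_ge j c s : has_quot_dim (hp K j) (nomin K j) c ->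
  has_quot_dim (mp K (j + 1)) (up K (j + 1)) s -> (d.-1 * c <= s)%N.
Proof.
move=> /(qd_middle hK)/qdE[e [e1 e2 e3]] /qdE[g [g1 g2 g3]].
have := steinitz (up_subsp (j + 1) hK) e1 _ g3; rewrite !card_ord; apply.
move=> c' hc'; apply: e2; split; last exact: up_sub hc'.
exact: up_mp.
Qed.
End One.

Section Span.
Variable M : lmodType B.
Definition inspan (I : finType) (g : I -> M) (x : M) : Prop := exists c, x = lincomb g c.
Lemma inspan_subsp (I : finType) (g : I -> M) : subsp (inspan g).
Proof.
split=> [|c x y [b ->] [b' ->]]; first by exists (fun=> 0); rewrite lincomb0.
by exists (fun i => c * b i + b' i); rewrite lincombP.
Qed.
Lemma inspan_gen (I : finType) (g : I -> M) i : inspan g (g i).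
Proof. by exists (fun j => (j == i)%:R); rewrite lincomb_delta. Qed.
Lemma inspan_spans (I : finType) (g : I -> M) (U W : M -> Prop) : subsp W ->
  (forall x, U x -> inspan g x) -> spans U W g.
Proof. by move=> hW h x /h[c ->]; exists c; rewrite subrr; exact: hW.1. Qed.
End Span.

Section Finite.
Variables (r : nat) (a : 'I_r -> int).
Let F := gfree k d_gt0 a.

(** The monomials of degree j - a i times the i-th basis vector, for i in P,
    numbered by p < N; when N is larger than the number of such monomials the
    remaining values are 0.  For N large they span the degree j part of the free
    submodule on P. *)
Definition mongen (P : pred 'I_r) (N : nat) (j : int) (p : {i | P i} * 'I_N) : F :=
  if j - a (val p.1) is Posz n then
    (if (p.2 <= n * d)%N then bmon k d n p.2 *: gbas k d_gt0 a (val p.1) else 0) else 0.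

Lemma mongen_span (P : pred 'I_r) (N : nat) (j : int) (x : F) :
  (forall i, P i -> (j - a i) * d%:Z + 1 <= N%:Z) ->
  gpiece j x -> (forall i, ~~ P i -> x i = 0) -> inspan (@mongen P N j) x.
Proof.
move=> hN hx h0; have hS := inspan_subsp (@mongen P N j).
rewrite (gbas_expand (x : F)); apply: subsp_sum => // i _.
have [Pi|/h0->] := boolP (P i); last by rewrite scale0r; exact: hS.1.
have := hx i; have := hN i Pi; case E : (j - a i) => [n|n] hn hxi; last first.
  have -> : x i = 0 by apply: val_inj; apply/eqP.
  by rewrite scale0r; exact: hS.1.
rewrite (piece_expand d_gt0 hxi) scaler_suml; apply: subsp_sum => // l _.
rewrite -scalerA; apply: subspZ => //.
have lt : (l < N)%N by have := ltn_ord l; lia.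
have := inspan_gen (@mongen P N j) (exist _ i Pi, Ordinal lt).
by rewrite /mongen /= E -ltnS ltn_ord.
Qed.

Lemma mongen_card (P : pred 'I_r) (N : nat) :
  #|{: {i | P i} * 'I_N}| = (#|P| * N)%N.
Proof. by rewrite card_prod card_ord card_sig. Qed.

Lemma free_finite j : exists N, forall x : F, gpiece j x ->
  inspan (@mongen predT N j) x.
Proof.
exists (\sum_i `|((j - a i) * d%:Z + 1)%R|)%N => x hx; apply: mongen_span => // i _.
by rewrite (bigD1 i) //=; lia.
Qed.

Lemma free_qd_exists (U W : F -> Prop) j : subsp U -> subsp W ->
  (forall x, U x -> gpiece j x) -> exists n, has_quot_dim U W n.
Proof.
move=> hU hW h; have [N hN] := free_finite j.
apply: (qd_exists hU hW (g := @mongen predT N j)).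
by apply: inspan_spans => // x /h/hN.
Qed.

(** The first N monomials in each coordinate; they are independent, which bounds
    dim F_j from below. *)
Definition lowmon (N : nat) (j : int) (p : 'I_r * 'I_N) : F :=
  bmon k d `|(j - a p.1)%R|%N p.2 *: gbas k d_gt0 a p.1.

Lemma lowmon_indep (N : nat) (j : int) :
  (forall i, N%:Z <= (j - a i) * d%:Z + 1) -> indep (fun x => x = 0) (@lowmon N j).
Proof.
move=> hN c hc [i l].
have hle : (N <= (`|(j - a i)%R| * d).+1)%N by have := hN i; nia.
pose b (m : 'I_(`|(j - a i)%R| * d).+1) : k :=
  if insub (val m) is Some m' then c (i, m') else 0.
have /bmon_indep/(_ (widen_ord hle l)) : \sum_m kc (b m) * bmon k d `|(j - a i)%R|%N m = 0.
  have := congr1 (fun f : F => f i) hc; rewrite /lincomb free_sumE ffunE => E.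
  have : \sum_i' \sum_l' (if i' == i then kc (c (i', l')) * bmon k d `|(j - a i')%R|%N l'
      else 0) = 0 :> B.
    rewrite pair_bigA /= -[RHS]E; apply: eq_bigr => -[i' l'] _ /=.
    rewrite /lowmon !ffunE /= eq_sym.
    by case: eqP => _; [rewrite [_ *: 1]mulr1 | rewrite [_ *: 0]mulr0 [_ *: _]mulr0].
  apply: etrans.
  rewrite [RHS](bigD1 i) //= [X in _ = _ + X]big1 ?addr0; last first.
    by move=> i' /negPf ne; apply: big1 => l' _; rewrite ne.
  pose G (l' : nat) : B :=
    kc (if insub l' is Some m' then c (i, m') else 0) * bmon k d `|(j - a i)%R|%N l'.
  transitivity (\sum_(l' < N) G l'); last first.
    by apply: eq_bigr => l' _; rewrite /G valK eqxx.
  rewrite (big_ord_widen _ G hle) [RHS]big_mkcond /=; apply: eq_bigr => m _.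
  by rewrite /b /G; case: insubP => [m' -> _ //|/negPf->]; rewrite rmorph0 mul0r.
by rewrite /b /= valK.
Qed.
End Finite.
End Covers.

(** * Independence over k[u, v] *)
(** A step of [indep_mod_v], stated over an abstract module to keep unification
    away from the concrete one. *)
Lemma scale2_eq (R : comNzRingType) (M : lmodType R) (u c0 c1 c p p' : R) (x : M) :
  c0 + c1 * (u * p') = c * p -> c0 *: x + u *: (c1 *: (p' *: x)) = c *: (p *: x).
Proof. by move=> E; rewrite !scalerA -scalerDl -mulrA mulrCA E. Qed.

Section Rank.
Variables (k : fieldType) (d : nat) (d_gt0 : (0 < d)%N).
Local Notation kc := (@vconst k d).
Local Notation w := (@w k d).
Local Notation u := (@u k d).
Local Notation v := (@v k d).
Variables (r : nat) (a : 'I_r -> int).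
Let F := gfree k d_gt0 a.

Lemma v_inj (x : F) : v *: x = 0 -> x = 0.
Proof. by apply: free_torsionfree; apply: bmon_neq0. Qed.

Variable K : F -> Prop.
Hypothesis hK : gsub K.

Lemma hpKw n (i : nat) x : (i <= d)%N -> hp K n x -> hp K (n + 1) (w i *: x).
Proof. by rewrite -ltnS => hi hx; apply: mp_hp => //; exact: (hp_mp (Ordinal hi)). Qed.
Lemma hpKu n x : hp K n x -> hp K (n + 1) (u *: x).
Proof. exact: hpKw. Qed.
Lemma hpKv n x : hp K n x -> hp K (n + 1) (v *: x).
Proof. exact: hpKw. Qed.

Lemma pow_uv (H : int -> F -> Prop) n (i j : nat) x :
  (forall n x, H n x -> H (n + 1) (u *: x) /\ H (n + 1) (v *: x)) ->
  H n x -> H (n + i%:Z + j%:Z) (u ^+ i * v ^+ j *: x).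
Proof.
move=> Huv hx; elim: i => [|i IH].
  rewrite expr0 mul1r addr0; elim: j => [|j IH]; first by rewrite expr0 scale1r addr0.
  by have [_] := Huv _ _ IH; rewrite scalerA -exprS -addrA; congr (H (_ + _) _); lia.
by have [+ _] := Huv _ _ IH; rewrite scalerA mulrA -exprS; congr (H _ _); lia.
Qed.

Lemma hp_uv n (i j : nat) x : hp K n x -> hp K (n + i%:Z + j%:Z) (u ^+ i * v ^+ j *: x).
Proof. by apply: pow_uv => n' y hy; split; [exact: hpKu | exact: hpKv]. Qed.

Section Family.
Variables (I : finType) (e : I -> int) (q : I -> F).
Hypothesis hq : forall i, hp K (e i) (q i).

Section Indep.
Hypothesis hreg : uvreg K.
(* independence modulo (u, v) K, degree by degree *)
Hypothesis hI : forall n (c : I -> k), (forall i, c i != 0 -> e i = n) ->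
  up K n (lincomb q c) -> forall i, c i = 0.

(** A relation modulo v among the u^(n - e i) q i, in degree n, is peeled off by
    its terms with e i = n: these are independent modulo (u, v) K, so they are
    absent, and then the relation u z = v y forces z into v K by regularity and
    has degree one less.  M bounds n - e i. *)
Lemma indep_mod_v M (n : int) (c : I -> k) y :
  (forall i, c i != 0 -> e i <= n <= e i + M%:Z) -> hp K (n - 1) y ->
  \sum_i kc (c i) *: (u ^+ `|n - e i|%N *: q i) = v *: y -> forall i, c i = 0.
Proof.
elim: M n c y => [|M IH] n c y hc hy E.
  apply: (hI (n := n)) => [i /hc|]; first by lia.
  exists 0, y; split=> //; first exact: (hp_subsp _ hK).1.
  rewrite scaler0 add0r -E; apply: eq_bigr => i _.
  have [->|/hc h] := eqVneq (c i) 0; first by rewrite rmorph0 !scale0r.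
  have -> : n - e i = 0 by lia.
  by rewrite absz0 expr0 scale1r.
pose c0 i := if e i == n then c i else 0.
pose c1 i := if e i == n then 0 else c i.
pose z : F := \sum_i kc (c1 i) *: (u ^+ `|(n - 1 - e i)%R|%N *: q i).
have c1e i : c1 i != 0 -> e i <= n - 1 <= e i + M%:Z.
  rewrite /c1; case: (e i =P n) => [_|ne]; first by rewrite eqxx.
  by move=> /hc; lia.
have hz : hp K (n - 1) z.
  apply: subsp_sum => [|i _]; first exact: hp_subsp.
  have [->|/c1e h] := eqVneq (c1 i) 0.
    by rewrite rmorph0 scale0r; exact: (hp_subsp _ hK).1.
  apply: subspZ; first exact: hp_subsp.
  have := hp_uv `|(n - 1 - e i)%R|%N 0 (hq i); rewrite expr0 mulr1.
  by congr (hp K _ _); lia.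
have Ez : lincomb q c0 + u *: z = v *: y.
  rewrite -E /lincomb scaler_sumr -big_split; apply: eq_bigr => i _ /=.
  apply: scale2_eq; rewrite -exprS /c0 /c1; have [En|ne] := eqVneq (e i) n.
    by rewrite rmorph0 mul0r addr0 En subrr absz0 expr0 mulr1.
  have [->|h] := eqVneq (c i) 0; first by rewrite rmorph0 !mul0r addr0.
  rewrite rmorph0 add0r; congr (_ * _ ^+ _); have := hc i h; move/eqP: ne; lia.
have c00 : forall i, c0 i = 0.
  apply: (hI (n := n)) => [i|]; first by rewrite /c0; case: (e i =P n) => // _; rewrite eqxx.
  exists (- z), y; split=> //; first by apply: subspN => //; exact: hp_subsp.
  by rewrite scalerN addrC -Ez addrK.
have c10 : forall i, c1 i = 0.
  have E1 : u *: z + v *: (- y) = 0.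
    rewrite scalerN -Ez [lincomb _ _]big1 ?add0r ?subrr // => i _.
    by rewrite c00 rmorph0 scale0r.
  have hy' : hp K (n - 1) (- y) by apply: subspN => //; exact: hp_subsp.
  have [y' [hy'' Ey _]] := hreg hz hy' E1.
  exact: (IH (n - 1) c1 y' c1e hy'' Ey).
by move=> i; have := c00 i; have := c10 i; rewrite /c0 /c1; case: eqP.
Qed.

(** The q i generate a free k[u, v]-module.  The terms without v form a relation
    modulo v, so they vanish by [indep_mod_v]; what is left is divisible by v. *)
Lemma indep_uv N (n : int) (c : I -> nat -> k) : (forall i, e i + N%:Z <= n) ->
  \sum_i \sum_(b < N.+1) kc (c i b) *: (u ^+ (`|n - e i| - b) * v ^+ b *: q i) = 0 ->
  forall i b, (b <= N)%N -> c i b = 0.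
Proof.
elim: N n c => [|N IH] n c hn E.
  have c0 : forall i, c i 0%N = 0.
    have hM i : c i 0%N != 0 -> e i <= n <= e i + (\sum_i `|(n - e i)%R|)%N%:Z.
      by move=> _; have := hn i; rewrite (bigD1 i) //=; lia.
    apply: (indep_mod_v hM (y := 0)); first exact: (hp_subsp _ hK).1.
    rewrite scaler0 -[RHS]E; apply: eq_bigr => i _.
    by rewrite big_ord1 subn0 expr0 mulr1.
  by move=> i b; rewrite leqn0 => /eqP->.
pose z : F := \sum_i \sum_(b < N.+1) kc (c i b.+1) *: (u ^+ (`|(n - 1 - e i)%R| - b) * v ^+ b *: q i).
have hz : hp K (n - 1) z.
  apply: subsp_sum => [|i _]; first exact: hp_subsp.
  apply: subsp_sum => [|b _]; first exact: hp_subsp.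
  apply: subspZ; first exact: hp_subsp.
  have := hp_uv (`|(n - 1 - e i)%R| - b)%N b (hq i); congr (hp K _ _).
  by have := hn i; have := ltn_ord b; lia.
have Ez : \sum_i kc (c i 0%N) *: (u ^+ `|n - e i|%N *: q i) + v *: z = 0.
  rewrite -[RHS]E /z scaler_sumr -big_split; apply: eq_bigr => i _ /=.
  rewrite [RHS]big_ord_recl subn0 expr0 mulr1; congr (_ + _).
  rewrite scaler_sumr; apply: eq_bigr => b _ /=.
  rewrite /bump /= add1n !scalerA -mulrA mulrCA; congr ((_ * _) *: _).
  rewrite mulrCA -exprS; congr (_ ^+ _ * _).
  by have := hn i; have := ltn_ord b; lia.
have c0 : forall i, c i 0%N = 0.
  have hM i : c i 0%N != 0 -> e i <= n <= e i + (\sum_i `|(n - e i)%R|)%N%:Z.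
    by move=> _; have := hn i; rewrite (bigD1 i) //=; lia.
  apply: (indep_mod_v hM (y := - z)); first by apply: subspN => //; exact: hp_subsp.
  by apply/eqP; rewrite scalerN -addr_eq0 Ez.
move=> i [_|b hb]; first exact: c0.
apply: (IH (n - 1) (fun i b => c i b.+1)) => // [i'|]; first by have := hn i'; lia.
apply: v_inj; rewrite -/z -[RHS]Ez big1 ?add0r // => i' _.
by rewrite c0 rmorph0 scale0r.
Qed.

(** H stands for a graded k[u, v]-submodule whose dimension in degree lo + N is at
    most rho (N d + 1).  It contains the free k[u, v]-module on the q i, whose
    dimension grows like #|I| N; comparing slopes gives #|I| <= rho d. *)
Lemma rank_upper (H : int -> F -> Prop) (lo : int) (D rho : nat) :
  (forall n x, H n x -> H (n + 1) (u *: x) /\ H (n + 1) (v *: x)) ->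
  (forall i, H (e i) (q i)) -> (forall i, lo <= e i <= lo + D%:Z) ->
  (forall N : nat, exists (J : finType) (g : J -> F),
    (#|J| <= rho * (N * d).+1)%N /\ forall x, H (lo + N%:Z) x -> inspan g x) ->
  (#|I| <= rho * d)%N.
Proof.
move=> Huv Hq he Hspan.
have key N : (#|I| * N.+1 <= rho * ((D + N) * d).+1)%N.
  have [J [g [hJ hg]]] := Hspan (D + N)%N.
  apply: leq_trans hJ; set n := lo + _ in hg.
  pose p (t : I * 'I_N.+1) : F := u ^+ (`|n - e t.1| - t.2) * v ^+ t.2 *: q t.1.
  have <- : (#|{: I * 'I_N.+1}| = #|I| * N.+1)%N by rewrite card_prod card_ord.
  have s0 := subsp0 F.
  apply: (steinitz (U := H n) (e := p) (g := g) s0).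
  - move=> [i b] /=; have := pow_uv (`|n - e i| - b)%N b Huv (Hq i); congr (H _ _).
    by have := he i; have := ltn_ord b; rewrite /n; lia.
  - move=> c hc [i b].
    pose c' i l := if insub l is Some m then c (i, m) else 0 : k.
    have /(_ i b) : forall i b, (b <= N)%N -> c' i b = 0.
      apply: (@indep_uv N n c') => [i'|]; first by have := he i'; rewrite /n; lia.
      rewrite pair_bigA /= -[RHS]hc; apply: eq_bigr => -[i' b'] _ /=.
      by rewrite /c' valK.
    by rewrite -ltnS ltn_ord /c' valK; apply.
  exact: (inspan_spans s0).
rewrite leqNgt; apply/negP => lt.
(* N is chosen beyond the constant term, so that only the slopes matter *)
have := key (rho * (D * d).+1)%N; move: lt; set x := (rho * d)%N => lt h.
have : (x.+1 * (rho * (D * d).+1).+1 <= rho * ((D + rho * (D * d).+1) * d).+1)%N.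
  by apply: leq_trans h; rewrite leq_mul2r lt orbT.
rewrite /x; nia.
Qed.
End Indep.
End Family.
End Rank.

(** * Ranks and finite generation of saturated submodules *)
Section Powers.
Variables (k : fieldType) (d : nat) (M : lmodType (vring k d)).
Local Notation u := (@u k d).
Local Notation v := (@v k d).

Lemma inspan_scale (I J : finType) (g : I -> M) (h : J -> M) (b : vring k d) x :
  (forall i, inspan h (b *: g i)) -> inspan g x -> inspan h (b *: x).
Proof.
move=> hb [c ->]; rewrite /lincomb scaler_sumr; have hS := inspan_subsp h.
by apply: subsp_sum => // i _; rewrite scalerA mulrC -scalerA; apply: subspZ.
Qed.

Lemma scale_lincomb (I : finType) (g : I -> M) (b : vring k d) c :
  b *: lincomb g c = lincomb (fun i => b *: g i) c.
Proof.
by rewrite /lincomb scaler_sumr; apply: eq_bigr => i _; rewrite scalerA mulrC -scalerA.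
Qed.

Variables (I : finType) (e : I -> nat) (q : I -> M).
(** The monomials of degree N - e i in u and v times the q i, for e i <= N. *)
Definition pgen (N : nat) (p : I * 'I_N.+1) : M :=
  if (e p.1 + p.2 <= N)%N then u ^+ (N - e p.1 - p.2) * v ^+ p.2 *: q p.1 else 0.

Lemma pgen_u N (p : I * 'I_N.+1) : inspan (@pgen N.+1) (u *: pgen p).
Proof.
case: p => i l; have hS := inspan_subsp (@pgen N.+1); rewrite /pgen /=.
case: ifP => hle; last by rewrite scaler0; exact: hS.1.
have lt : (l < N.+2)%N by have := ltn_ord l; lia.
have := inspan_gen (@pgen N.+1) (i, Ordinal lt).
rewrite /pgen /= leqW //; congr (inspan _ _); rewrite scalerA; congr (_ *: _).
by rewrite mulrA -exprS; congr (_ ^+ _ * _); lia.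
Qed.

Lemma pgen_v N (p : I * 'I_N.+1) : inspan (@pgen N.+1) (v *: pgen p).
Proof.
case: p => i l; have hS := inspan_subsp (@pgen N.+1); rewrite /pgen /=.
case: ifP => hle; last by rewrite scaler0; exact: hS.1.
have lt : (l.+1 < N.+2)%N by have := ltn_ord l; lia.
have := inspan_gen (@pgen N.+1) (i, Ordinal lt).
rewrite /pgen /= addnS ltnS hle; congr (inspan _ _); rewrite scalerA; congr (_ *: _).
by rewrite mulrCA -exprS; congr (_ ^+ _ * _); lia.
Qed.
End Powers.

Section RankDims.
Variables (k : fieldType) (d : nat) (d_gt0 : (0 < d)%N).
Local Notation B := (vring k d).
Local Notation kc := (@vconst k d).
Local Notation u := (@u k d).
Local Notation v := (@v k d).
Variables (r : nat) (a : 'I_r -> int).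
Let F := gfree k d_gt0 a.
Variable K : F -> Prop.
Hypothesis hK : gsub K.
Variable lo : int.

Section Blocks.
Variables (D : nat) (m : 'I_D -> nat) (U : 'I_D -> F -> Prop).
Hypothesis hm : forall J, has_quot_dim (U J) (up K (lo + J%:Z)) (m J).
Hypothesis hU : forall J x, U J x -> hp K (lo + J%:Z) x.

(** The index type of a union of bases, one for each degree lo + J. *)
Definition blk := {J : 'I_D & 'I_(m J)}.
Definition mkblk J (l : 'I_(m J)) : blk := existT _ J l.
Definition blkdeg (i : blk) : nat := tag i.

(** Bases of the quotients in all degrees, put together. *)
Lemma block_basis : exists q : blk -> F,
  [/\ forall i, U (tag i) (q i),
      forall n (c : blk -> k), (forall i, c i != 0 -> lo + (tag i)%:Z = n) ->
        up K n (lincomb q c) -> forall i, c i = 0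
    & forall J x, U J x -> exists c : blk -> k,
        (forall i, c i != 0 -> tag i = J) /\ up K (lo + J%:Z) (x - lincomb q c)].
Proof.
have hb J : exists e : 'I_(m J) -> F, qbasis (U J) (up K (lo + J%:Z)) e by apply/qdE; exact: hm.
have [e he] := fin_all_exists hb.
pose q (i : blk) := e (tag i) (tagged i).
have qE (c : blk -> k) : lincomb q c = \sum_J lincomb (e J) (fun l => c (mkblk l)).
  by rewrite /lincomb sig_big_dep /=; apply: eq_bigr => -[].
have qJ (c : blk -> k) J : (forall i, c i != 0 -> tag i = J) ->
    lincomb q c = lincomb (e J) (fun l => c (mkblk l)).
  move=> hc; rewrite qE (bigD1 J) //= big1 ?addr0 // => J' ne.
  rewrite /lincomb big1 // => l _.
  have [->|/hc /= E] := eqVneq (c (mkblk l)) 0; first by rewrite rmorph0 scale0r.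
  by rewrite E eqxx in ne.
exists q; split=> [i|n c hc hup [J l]|J x hx].
- by have [h _ _] := he (tag i); apply: h.
- have [//|h] := eqVneq (c (mkblk l)) 0.
  have /= En := hc _ h.
  have hc' i : c i != 0 -> tag i = J.
    by move=> /hc E; apply: val_inj => /=; lia.
  rewrite (qJ c J hc') -En in hup.
  by have [_ hi _] := he J; apply: (hi _ hup l).
have [_ _ hs] := he J; have [b hb'] := hs x hx.
pose c (i : blk) : k := if tag i =P J is ReflectT E then b (cast_ord (congr1 m E) (tagged i)) else 0.
exists c; have hc i : c i != 0 -> tag i = J by rewrite /c; case: eqP => //; rewrite eqxx.
split; first exact: hc.
rewrite (qJ c J hc).
suff -> : lincomb (e J) (fun l => c (mkblk l)) = lincomb (e J) b by [].
apply: eq_bigr => l _; congr (kc _ *: _); rewrite /c /=; case: eqP => // E.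
by congr b; apply: val_inj.
Qed.

Lemma card_blk : #|{: blk}| = (\sum_J m J)%N.
Proof.
have := sum1_card (@predT blk); rewrite /= => <-.
transitivity (\sum_J \sum_(l < m J) 1)%N; last first.
  by apply: eq_bigr => J _; rewrite sum1_card card_ord.
by rewrite sig_big_dep.
Qed.

Lemma rank_upper_dims (H : int -> F -> Prop) (rho : nat) : uvreg K ->
  (forall n x, H n x -> H (n + 1) (u *: x) /\ H (n + 1) (v *: x)) ->
  (forall J x, U J x -> H (lo + J%:Z) x) ->
  (forall N : nat, exists (J : finType) (g : J -> F),
    (#|J| <= rho * (N * d).+1)%N /\ forall x, H (lo + N%:Z) x -> inspan g x) ->
  (\sum_J m J <= rho * d)%N.
Proof.
move=> hreg Huv HU Hspan; have [q [q1 q2 _]] := block_basis.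
rewrite -card_blk; apply: (@rank_upper k d d_gt0 r a K hK blk
  (fun i => lo + (tag i)%:Z) q _ hreg q2 H lo D rho) => //.
- by move=> i; apply: hU.
- by move=> i; apply: HU.
by move=> i; have := ltn_ord (tag i); lia.
Qed.
End Blocks.

Hypothesis hlo : forall i, lo <= a i.

Lemma free_low n (x : F) : n < lo -> gpiece n x -> x = 0.
Proof.
move=> hn hx; apply/ffunP => i; have := hx i; rewrite ffunE.
have := hlo i; case E: (n - a i) => [N|N]; first lia.
by move=> _ /eqP h; apply: val_inj.
Qed.

Lemma full_growth N : exists (J : finType) (g : J -> F),
  (#|J| <= r * (N * d).+1)%N /\ forall x, hp allp (lo + N%:Z) x -> inspan g x.
Proof.
exists _, (@mongen k d d_gt0 r a predT (N * d).+1 (lo + N%:Z)); split.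
  by rewrite mongen_card cardT size_enum_ord.
by move=> x [hx _]; apply: mongen_span => // i _; have := hlo i; nia.
Qed.

Lemma up_low x : up K lo x -> x = 0.
Proof.
move=> [y [z [[hy _] [hz _] ->]]].
rewrite (free_low _ hy) ?(free_low _ hz) ?scaler0 ?addr0 //; lia.
Qed.

Section Span.
Variables (D : nat) (m : 'I_D -> nat).
Hypothesis hm : forall J : 'I_D, has_quot_dim (hp K (lo + J%:Z)) (up K (lo + J%:Z)) (m J).
Hypothesis hD : forall n x, lo + D%:Z <= n -> hp K n x -> up K n x.

Local Notation PG q N := (@pgen k d F (blk m) (@blkdeg _ m) q N).

(** Graded Nakayama: K is generated over k[u, v] by a lift of a basis of
    K / (u, v) K, by induction on the degree from lo on. *)
Lemma uv_generate : exists (q : blk m -> F),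
  (forall i, hp K (lo + (blkdeg i)%:Z) (q i)) /\
  forall N x, hp K (lo + N%:Z) x -> inspan (PG q N) x.
Proof.
have [q [q1 _ q3]] := block_basis hm; exists q; split=> //.
have upspan N x : (forall y, hp K (lo + N%:Z) y -> inspan (PG q N) y) ->
    up K (lo + N.+1%:Z) x -> inspan (PG q N.+1) x.
  move=> IH [y [z [hy hz ->]]]; have E : lo + N.+1%:Z - 1 = lo + N%:Z by lia.
  rewrite E in hy hz.
  apply: subspD; first exact: inspan_subsp.
    exact: inspan_scale (@pgen_u _ _ _ _ _ _ _) (IH _ hy).
  exact: inspan_scale (@pgen_v _ _ _ _ _ _ _) (IH _ hz).
have genspan N (J : 'I_D) x : N = J :> nat -> hp K (lo + N%:Z) x -> exists2 y,
    inspan (PG q N) y & up K (lo + N%:Z) (x - y).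
  move=> -> hx; have [c [hc hup]] := q3 J x hx; exists (lincomb q c) => //.
  have hS := inspan_subsp (PG q J).
  apply: subsp_sum => // i _.
  have [->|/hc E] := eqVneq (c i) 0; first by rewrite rmorph0 scale0r; exact: hS.1.
  apply: subspZ => //.
  have := inspan_gen (PG q J) (i, ord0).
  by rewrite /pgen /= /blkdeg E addn0 leqnn subnn subn0 !expr0 mulr1 scale1r.
have step N x : (forall y, up K (lo + N%:Z) y -> inspan (PG q N) y) ->
    hp K (lo + N%:Z) x -> inspan (PG q N) x.
  move=> h hx; have hS := inspan_subsp (PG q N).
  have [lt|ge] := ltnP N D; last by apply: h; apply: hD => //; lia.
  have [y h1 h2] := genspan N (Ordinal lt) x erefl hx.
  by rewrite -(subrK y x); apply: subspD => //; apply: h.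
elim=> [|N IH] x hx; apply: step => // y.
  rewrite addr0 => /up_low ->; exact: (inspan_subsp _).1.
exact: upspan.
Qed.

(** If a nonzero homogeneous b maps F into K, then K has the rank of F, and its
    number of generators over k[u, v] is at least that of F, which is r d.
    Multiplication by b embeds F into K, and dimensions in degree N grow like
    r d N for F and at most like \sum_J m J times N for K. *)
Lemma rank_lower (b : B) (beta : nat) : b != 0 -> in_piece d 0 beta%:Z (vval b) ->
  (forall x, K (b *: x)) -> (r * d <= \sum_J m J)%N.
Proof.
move=> b0 hb bK; have [q [q1 q2]] := uv_generate.
pose h := (\sum_i `|(a i - lo)%R|)%N.
have hi i : a i <= lo + h%:Z by rewrite /h (bigD1 i) //=; have := hlo i; lia.
have key N : (r * (N * d).+1 <= (\sum_J m J) * (N + beta + h).+1)%N.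
  have s0 := subsp0 F.
  pose n := (N + beta + h)%N.
  pose g := @lowmon k d d_gt0 r a (N * d).+1 (lo + n%:Z - beta%:Z).
  have hN i : (N * d).+1%:Z <= (lo + n%:Z - beta%:Z - a i) * d%:Z + 1.
    by have := hi i; rewrite /n; nia.
  have -> : (r * (N * d).+1 = #|{: 'I_r * 'I_(N * d).+1}|)%N by rewrite card_prod !card_ord.
  rewrite -card_blk -/n.
  have <- : (#|{: blk m * 'I_n.+1}| = #|{: blk m}| * n.+1)%N by rewrite card_prod card_ord.
  apply: (steinitz (U := hp K (lo + n%:Z)) (e := fun p => b *: g p) s0).
  - move=> p; split; last exact: bK.
    have := gpieceZ hb (_ : gpiece (lo + n%:Z - beta%:Z) (g p)).
    have -> : beta%:Z + (lo + n%:Z - beta%:Z) = lo + n%:Z by lia.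
    apply.
    rewrite /g /lowmon; set i := p.1.
    have := gpieceZ (bmon_piece k d `|(lo + n%:Z - beta%:Z - a i)%R|%N p.2) (gbas_piece k d_gt0 a i).
    by congr (gpiece _ _); have := hi i; rewrite /n; lia.
  - move=> c hc; apply: (lowmon_indep hN); apply: (free_torsionfree b0).
    by rewrite scale_lincomb.
  exact: (inspan_spans s0 (q2 n)).
rewrite leqNgt; apply/negP; set Q := (\sum_J m J)%N in key * => lt.
(* a degree in which the slopes outweigh the constant terms *)
have := key (Q * (beta + h).+1)%N; set N := (Q * _)%N => hN.
have r0 : (0 < r)%N by case: (r) lt.
have h1 : (Q.+1 * N <= r * d * N)%N by rewrite leq_mul2r lt orbT.
have h2 : (r * (N * d).+1 = r * d * N + r)%N by rewrite mulnS mulnCA mulnC addnC.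
have h3 : (Q * (N + beta + h).+1 = Q * N + N)%N.
  by rewrite /N -addnA -addnS mulnDr.
move: hN h1; rewrite h2 h3 mulSn; lia.
Qed.
End Span.

(** By [rank_upper] the dimensions of K / (u, v) K have bounded partial sums, so
    they vanish in large degrees. *)
Lemma sat_vanish : sat K -> exists D : nat, forall n x, lo + D%:Z <= n -> hp K n x -> up K n x.
Proof.
move=> hs; have hreg := free_sat_uvreg hK hs.
have hex N : exists n, has_quot_dim (hp K (lo + N%:Z)) (up K (lo + N%:Z)) n.
  by apply: (@free_qd_exists k d d_gt0 r a _ _ (lo + N%:Z)) => [||x []//];
    [exact: hp_subsp | exact: up_subsp].
have [m hm] : exists m : nat -> nat, forall N, has_quot_dim (hp K (lo + N%:Z)) (up K (lo + N%:Z)) (m N).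
  by exists (fun N => proj1_sig (constructive_indefinite_description _ (hex N))) => N;
    case: constructive_indefinite_description.
have hsum D : (\sum_(J < D) m J <= r * d)%N.
  apply: (@rank_upper_dims D (fun J => m J) (fun J => hp K (lo + J%:Z)) (fun J => hm J) _
    (hp allp) r hreg).
  - by [].
  - by move=> n x hx; split; [exact: hpKu | exact: hpKv].
  - by move=> J x [].
  exact: full_growth.
have [D hD] : exists D, forall J, (D <= J)%N -> m J = 0%N.
  apply: NNPP => hn.
  suff /(_ (r * d).+1)[D hD] : forall t, exists D, (t <= \sum_(J < D) m J)%N.
    by have := leq_trans hD (hsum D); rewrite ltnn.
  elim=> [|t [D hD]]; first by exists 0%N.
  have [J [hJ mJ]] : exists J, (D <= J)%N /\ m J <> 0%N.
    apply: NNPP => h; apply: hn; exists D => J hJ; apply: NNPP => h'; apply: h; by exists J.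
  exists J.+1; rewrite big_ord_recr /=.
  have : (\sum_(i < D) m i <= \sum_(i < J) m i)%N.
    rewrite (big_ord_widen _ (fun i => m i) hJ) [X in (X <= _)%N]big_mkcond.
    by apply: leq_sum => i _; case: ifP.
  move=> h; rewrite -addn1; apply: leq_add; first exact: leq_trans hD h.
  by rewrite lt0n; apply/eqP.
exists D => n x hn hx.
have [N EN] : exists N : nat, n = lo + N%:Z by exists `|(n - lo)%R|%N; lia.
subst n; have := hm N; rewrite hD; last lia.
move=> /qdE[e [_ _ he]]; have [c] := he x hx.
by rewrite /lincomb big_ord0 subr0.
Qed.

(** Saturated submodules are finitely generated: the case of Noetherianity of B
    that syzygy modules require, obtained from the rank bound. *)
Lemma sat_cover : sat K -> exists (r' : nat) (a' : 'I_r' -> int)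
  (psi : {linear gfree k d_gt0 a' -> F}), degree0 psi /\ forall x, K x <-> imp psi x.
Proof.
move=> hs; have [D hD] := sat_vanish hs.
have hex (J : 'I_D) : exists n, has_quot_dim (hp K (lo + J%:Z)) (up K (lo + J%:Z)) n.
  by apply: (@free_qd_exists k d d_gt0 r a _ _ (lo + J%:Z)) => [||x []//];
    [exact: hp_subsp | exact: up_subsp].
have [m hm] := fin_all_exists hex.
have [q [q1 q2]] := uv_generate hm hD.
pose q' (i : 'I_#|{: blk m}|) := q (enum_val i).
have [psi [dpsi psiE]] := @free_lift k d d_gt0 _ (fun i : 'I_#|{: blk m}| => lo + (blkdeg (enum_val i))%:Z)
  F q' (fun i => (q1 (enum_val i)).1).
exists _, _, psi; split=> // x; split=> [Kx|[y <-]]; last first.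
  rewrite psiE; apply: subsp_sum => [|i _]; first exact: gsub_subsp.
  by apply: gsubZ => //; case: (q1 (enum_val i)).
have himp := gsub_im dpsi; have hS := gsub_subsp himp.
have [L _ ->] := gpr_span x; apply: subsp_sum => // n _.
have hx : hp K n (gpr n x) by split; [exact: gpr_piece | case: hK => _ _; apply].
have [lt|ge] := ltP n lo.
  by rewrite (free_low lt hx.1); exact: hS.1.
have [N EN] : exists N : nat, n = lo + N%:Z by exists `|(n - lo)%R|%N; lia.
rewrite EN in hx *; have [c ->] := q2 N _ hx; apply: subsp_sum => // -[i l] _.
apply: subspZ => //; rewrite /pgen /=; case: ifP => _; last exact: hS.1.
apply: (@gsubZ k d F (imp psi)) => //; exists (gbas k d_gt0 _ (enum_rank i)).
rewrite psiE (bigD1 (enum_rank i)) //= ffunE eqxx scale1r big1 ?addr0.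
  by rewrite /q' enum_rankK.
by move=> j /negPf ne; rewrite ffunE ne scale0r.
Qed.
End RankDims.

(** * Tor and the syzygy modules *)
Section Numerics.
Variables (k : fieldType) (d : nat) (d_gt0 : (0 < d)%N).
Local Notation B := (vring k d).
Local Notation kc := (@vconst k d).
Local Notation w := (@w k d).
Local Notation u := (@u k d).
Local Notation v := (@v k d).

Lemma pred_ext (T : Type) (P Q : T -> Prop) : (forall x, P x <-> Q x) -> P = Q.
Proof.
by move=> h; apply: functional_extensionality => x; apply: propositional_extensionality.
Qed.

Definition qdim (M : lmodType B) (U W : M -> Prop) : nat :=
  epsilon (inhabits 0%N) (fun n => has_quot_dim U W n).
Lemma qdimP (M : lmodType B) (U W : M -> Prop) :
  (exists n, has_quot_dim U W n) -> has_quot_dim U W (qdim U W).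
Proof. exact: epsilon_spec. Qed.

Lemma in_mM_subsp (N : lmodType B) : subsp (@in_mM k d N).
Proof.
split=> [|c x y]; rewrite !in_mM_w //.
  by exists (fun=> 0); rewrite big1 // => i _; rewrite scaler0.
move=> [z ->] [t ->]; exists (fun i => kc c *: z i + t i).
rewrite scaler_sumr -big_split; apply: eq_bigr => i _ /=.
by rewrite scalerDr !scalerA mulrC.
Qed.

Section OneMap.
Variables (X Y : gmod k d) (f : {linear X -> Y}) (df : degree0 f).

Lemma ker_sat : (forall y : Y, u *: y = 0 -> v *: y = 0 -> y = 0) -> sat (kerp f).
Proof. by move=> h x; rewrite /kerp !linearZ_LR; apply: h. Qed.

(** For F_(i+1) -> F_i with image I, the homology of the complex modulo m is
    (I \cap m F_i) / m I, which makes Tor_(i+1) depend on I only.  This is the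
    case P = m F_i; for Tor_0 there is no condition P. *)
Lemma homology_im (P : Y -> Prop) j n : subsp P ->
  has_quot_dim (fun x => gpiece j x /\ P (f x))
    (fun x => gpiece j x /\ exists2 y, kerp f y & in_mM (x - y)) n ->
  has_quot_dim (fun y => hp (imp f) j y /\ P y) (mp (imp f) j) n.
Proof.
move=> hP; have hI := gsub_im df.
apply: (qd_map (f := f)).
- exact: linearP.
- exact: mp_subsp.
- by move=> x [hx hm]; split=> //; exact: im_hp.
- move=> y [hy hm]; have [x hx Ex] := hp_im df hy.
  exists x; last by rewrite Ex subrr; exact: (mp_subsp _ hI).1.
  by split=> //; rewrite Ex.
- move=> x [hx hm]; split.
    move=> /(im_mp df)[y hy Ey]; split=> //.
    exists (x - y); first by rewrite /kerp linearB Ey subrr.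
    by rewrite subKr; apply/in_mM_w => //; case: hy => t [_ ->]; exists t.
  move=> [_ [y Ky /(in_mM_w d_gt0)[t Et]]].
  have Ex : f x = \sum_(l < d.+1) w l *: f (t l).
    rewrite -[x](subrK y) linearD Ky addr0 Et linear_sum.
    by apply: eq_bigr => l _; rewrite linearZ_LR.
  apply: (homog_mp hI (df hx) _ Ex) => l.
  by exists (t l).
split; first by split; [exact: gpiece0 | rewrite linear0; exact: hP.1].
move=> c x y [hx hx'] [hy hy']; split; first exact: (gpiece_subsp _ _).2.
by rewrite linearP; apply: hP.2.
Qed.
End OneMap.

Section Res.
Variables (M : gmod k d) (R : resolution d_gt0 M).

(** The syzygy modules: kernels of the augmentation and of the differentials. *)
Definition Kr (i : nat) : resF R i -> Prop :=
  match i return resF R i -> Prop with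
  | 0 => kerp (res_aug R)
  | i'.+1 => kerp (res_diff R i')
  end.

Lemma Kr_gsub i : gsub (@Kr i).
Proof.
case: i => [|i]; apply: gsub_ker; [exact: res_aug_degree0 | exact: res_diff_degree0].
Qed.

Lemma Kr_im i : imp (res_diff R i) = @Kr i.
Proof.
apply: pred_ext; case: i => [|i] x; split.
- by move=> h; apply/res_aug_exact.
- by move/res_aug_exact.
- by move=> h; apply/res_diff_exact.
- by move/res_diff_exact.
Qed.

Lemma aug_im : imp (res_aug R) = @allp k d M.
Proof.
by apply: pred_ext => x; split=> // _; have [y <-] := res_aug_surj R x; exists y.
Qed.

Lemma tor_succ i j n : has_tor_dim R i.+1 j n ->
  has_quot_dim (nomin (@Kr i) j) (mp (@Kr i) j) n.
Proof.
rewrite -Kr_im => h; have df := @res_diff_degree0 _ _ _ _ R i.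
apply: (qd_ext _ _ (homology_im df (P := @in_mM k d _) (j := j) (in_mM_subsp _) _)) => [y|//|].
  by split=> -[h1 h2]; split=> //; exact/(in_mM_mp d_gt0 h1.1).
apply: qd_ext h => x //; split; [move=> [hx [y hy]] | move=> [hx [y Ky hy]]]; split=> //.
  by exists (res_diff R i.+1 y) => //; apply/res_diff_exact; exists y.
by have [z Ez] := (@res_diff_exact _ _ _ _ R i y).1 Ky; exists z; rewrite Ez.
Qed.

Lemma tor_zero j n : has_tor_dim R 0 j n -> has_quot_dim (@hp _ _ M allp j) (mp allp j) n.
Proof.
move=> h; rewrite -aug_im; have df := @res_aug_degree0 _ _ _ _ R.
apply: (qd_ext _ _ (homology_im df (P := @allp k d M) (j := j) _ _)) => [y|//|//|].
  by split=> [[]|].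
apply: qd_ext h => x; first by split=> [|[]].
split; [move=> [hx [y hy]] | move=> [hx [y Ky hy]]]; split=> //.
  by exists (res_diff R 0 y) => //; apply/res_aug_exact; exists y.
by have [z Ez] := (@res_aug_exact _ _ _ _ R y).1 Ky; exists z; rewrite Ez.
Qed.

Lemma Kr_qdim i j (U W : resF R i -> Prop) : subsp U -> subsp W ->
  (forall x, U x -> gpiece j x) -> has_quot_dim U W (qdim U W).
Proof. by move=> hU hW h; apply: qdimP; exact: free_qd_exists hU hW h. Qed.

Hypothesis nosoc : forall x : M, u *: x = 0 -> v *: x = 0 -> x = 0.

(** Free modules and M itself contain no nonzero element killed by u and v. *)
Lemma Kr_sat i : sat (@Kr i).
Proof.
case: i => [|i]; apply: ker_sat => //.
by move=> y hy _; apply: (free_torsionfree (bmon_neq0 k d 1 d)).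
Qed.

Lemma Kr_uvreg i : uvreg (@Kr i).
Proof. exact: free_sat_uvreg (Kr_gsub i) (@Kr_sat i). Qed.

Variable beta : nat -> int -> nat.
Hypothesis hbeta : forall i j, has_tor_dim R i j (beta i j).

(** For the i-th syzygy module K in F_i: the number of generators of F_i of
    degree j, and the dimensions in degree j of K / (K \cap m F_i) and of m K / (u, v) K. *)
Definition rk i j : nat := ngens (@res_deg _ _ _ _ R i) j.
Definition cK i j : nat := qdim (hp (@Kr i) j) (nomin (@Kr i) j).
Definition sK i j : nat := qdim (mp (@Kr i) j) (up (@Kr i) j).

Lemma cKP i j : has_quot_dim (hp (@Kr i) j) (nomin (@Kr i) j) (cK i j).
Proof.
have h := Kr_gsub i; apply: (@Kr_qdim i j); [exact: hp_subsp | exact: nomin_subsp |].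
by move=> x [].
Qed.
Lemma sKP i j : has_quot_dim (mp (@Kr i) j) (up (@Kr i) j) (sK i j).
Proof.
have h := Kr_gsub i; apply: (@Kr_qdim i j); [exact: mp_subsp | exact: up_subsp |].
by move=> x hx; have [] := mp_hp h hx.
Qed.

Lemma t0KP i j : has_quot_dim (hp (@Kr i) j) (mp (@Kr i) j) (beta i.+1 j + cK i j).
Proof.
have h := Kr_gsub i; apply: (qd_add (V := nomin (@Kr i) j)).
- exact: hp_subsp.
- exact: nomin_subsp.
- exact: mp_subsp.
- by move=> x hx; split; [exact: mp_hp | exact: mp_sub hx].
- by move=> x [].
- exact: tor_succ.
exact: cKP.
Qed.

Lemma rk0 j : rk 0 j = (cK 0 j + beta 0 j)%N.
Proof.
apply: (dim_gens (f := res_aug R)); first exact: res_aug_degree0.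
  exact: cKP.
by rewrite aug_im; apply: tor_zero.
Qed.

Lemma rkS i j : rk i.+1 j = (cK i.+1 j + (beta i.+1 j + cK i j))%N.
Proof.
apply: (dim_gens (f := res_diff R i)); first exact: res_diff_degree0.
  exact: cKP.
by rewrite Kr_im; apply: t0KP.
Qed.

Lemma linear_syz i j :
  (sK i (j + 1) + beta i.+2 (j + 1)%R + d.-1 * cK i.+1 j = d.-1 * rk i.+1 j)%N.
Proof.
apply: (dim_linear_syzygies (f := res_diff R i)).
- exact: res_diff_degree0.
- by rewrite Kr_im; exact: Kr_uvreg.
- exact: cKP.
- by rewrite Kr_im; exact: sKP.
exact: (tor_succ (hbeta i.+2 (j + 1))).
Qed.

Lemma sKS i j : sK i.+1 (j + 1) = (d.-1 * cK i.+1 j)%N.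
Proof.
apply: (qd_uniq (up_subsp _ (Kr_gsub i.+1)) (sKP i.+1 (j + 1))).
apply: (dim_mK_upK (f := res_diff R i)); first exact: res_diff_degree0.
  by rewrite Kr_im; exact: Kr_uvreg.
exact: cKP.
Qed.

Lemma sK0 j : (d.-1 * cK 0 j <= sK 0 (j + 1))%N.
Proof.
apply: (dim_mK_ge (f := res_aug R)); [exact: res_aug_degree0 | exact: cKP | exact: sKP].
Qed.

(** The count of linear syzygies for F_(i+2) -> K_(i+1), in which [sKS] and [rkS]
    express the dimension of m K_(i+1) / (u, v) K_(i+1) and the rank of F_(i+2). *)
Lemma betti_tail i j : beta i.+3 (j + 1) = (d.-1 * beta i.+2 j)%N.
Proof. by have := linear_syz i.+1 j; rewrite sKS rkS !mulnDr; lia. Qed.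

Lemma betti_second (j : int) : (beta 2 (j + 1)%R <= d.-1 * beta 1 j)%N.
Proof.
have := linear_syz 0 j; have := sK0 j; rewrite rkS !mulnDr.
move: (sK 0 _) (d.-1 * cK 0 j)%N (d.-1 * cK 1 j)%N (d.-1 * beta 1 j)%N (beta 2 _); lia.
Qed.

End Res.
End Numerics.

(** * Partial sums of Betti numbers *)
Lemma sum_scaleD (R : nzRingType) (M : lmodType R) (I : finType) (b b' : I -> R)
    (e : I -> M) (x y : M) :
  (\sum_i b i *: e i + x) + (\sum_i b' i *: e i + y) = \sum_i (b i + b' i) *: e i + (x + y).
Proof.
rewrite addrACA -big_split; congr (_ + _); apply: eq_bigr => i _.
by rewrite /= scalerDl.
Qed.

Lemma shift_sum (f : int -> nat) lo n : f lo = 0%N ->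
  (\sum_(J < n) f (lo + J%:Z + 1)%R = \sum_(J < n.+1) f (lo + J%:Z)%R)%N.
Proof.
move=> f0; rewrite [RHS]big_ord_recl /= addr0 f0 add0n; apply: eq_bigr => J _.
by rewrite /bump /= add1n -addrA -PoszD addn1.
Qed.

Section Growth.
Variables (k : fieldType) (d : nat) (d_gt0 : (0 < d)%N).
Local Notation B := (vring k d).
Local Notation kc := (@vconst k d).
Local Notation u := (@u k d).
Local Notation v := (@v k d).

Section Truncation.
Variables (r : nat) (a : 'I_r -> int).
Let F := gfree k d_gt0 a.
Variable K : F -> Prop.
Hypothesis hK : gsub K.
Variables (lo : int) (D c : nat) (kap : 'I_c -> F).
Hypothesis hlo : forall i, lo <= a i.
Hypothesis hkap : qbasis (hp K (lo + D%:Z)) (nomin K (lo + D%:Z)) kap.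

(** The submodule of F spanned by the generators of degree < lo + D and by kap,
    a lift of a basis of K / (K \cap m F) in degree lo + D.  It contains K up to
    degree lo + D, and m K in degree lo + D + 1.  Its rank is at most the number
    of these generators, which is what makes it better than F in [rank_upper]. *)
Definition trunc (n : int) (x : F) : Prop :=
  exists (b : 'I_c -> B) (y : F),
    [/\ forall i, in_piece d 0 (n - (lo + D%:Z)) (vval (b i)), gpiece n y,
        forall t, ~~ (a t < lo + D%:Z) -> y t = 0 & x = \sum_i b i *: kap i + y].

Lemma trunc_scale n beta (b : B) x : in_piece d 0 beta (vval b) -> trunc n x ->
  trunc (beta + n) (b *: x).
Proof.
move=> hb [e [y [he hy hy0 ->]]].
exists (fun i => b * e i), (b *: y); split.
- by move=> i; have := in_pieceM hb (he i); rewrite addrA.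
- exact: gpieceZ.
- by move=> t /hy0 h; rewrite ffunE h [_ *: _]mulr0.
rewrite scalerDr scaler_sumr; congr (_ + _); apply: eq_bigr => i _.
by rewrite scalerA.
Qed.

Lemma truncD n x y : trunc n x -> trunc n y -> trunc n (x + y).
Proof.
move=> [b [x' [hb hx hx0 ->]]] [b' [y' [hb' hy hy0 ->]]].
exists (fun i => b i + b' i), (x' + y'); split.
- by move=> i; exact: in_pieceD (hb i) (hb' i).
- exact: gpieceD.
- by move=> t ht; rewrite ffunE hx0 // hy0 // addr0.
exact: sum_scaleD.
Qed.

Lemma trunc0 n : trunc n 0.
Proof.
exists (fun=> 0), 0; split=> [i||t _|]; rewrite ?ffunE //.
- exact: in_piece0.
- exact: gpiece0.
by rewrite big1 ?addr0 // => i _; rewrite scale0r.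
Qed.

Lemma free_coord0 n (x : F) t : gpiece n x -> n < a t -> x t = 0.
Proof.
move=> hx hn; have := hx t; case E: (n - a t) => [N|N]; first lia.
by move=> /eqP h; apply: val_inj.
Qed.

Lemma trunc_low (J : nat) x : (J < D)%N -> hp K (lo + J%:Z) x -> trunc (lo + J%:Z) x.
Proof.
move=> hJ [hx _]; exists (fun=> 0), x; split=> // [i|t ht|].
- exact: in_piece0.
- by apply: free_coord0 hx _; lia.
by rewrite big1 ?add0r // => i _; rewrite scale0r.
Qed.

Lemma trunc_top x : hp K (lo + D%:Z) x -> trunc (lo + D%:Z) x.
Proof.
have [k1 _ k3] := hkap => hx; have [b [_ hb]] := k3 x hx.
exists (fun i => kc (b i)), (x - lincomb kap b); split.
- by move=> i; rewrite subrr /= mul0n addn0 -[X in X \is _]mulr1 mul_mpolyC rpredZ ?dhomog1.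
- by have [] := mp_hp (@gsub_all k d F) hb.
- move=> t ht; have [E|ne] := eqVneq (a t) (lo + D%:Z); first exact: mp_free_const hb E.
  have [hx' _] := mp_hp (@gsub_all k d F) hb.
  by apply: free_coord0 hx' _; lia.
by rewrite subrKC.
Qed.

Lemma trunc_mp x : mp K (lo + D.+1%:Z) x -> trunc (lo + D.+1%:Z) x.
Proof.
move=> [z [hz ->]].
have E : lo + D.+1%:Z = 1 + (lo + D%:Z) by lia.
elim/big_ind: _ => [|x' y' hx' hy'|i _]; [exact: trunc0 | exact: truncD |].
rewrite E; apply: trunc_scale; first exact: w_piece.
by apply: trunc_top; have := hz i; congr (hp K _ _); lia.
Qed.

Let P (t : 'I_r) : bool := a t < lo + D%:Z.

Lemma trunc_growth N : exists (J : finType) (g : J -> F),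
  (#|J| <= (#|P| + c) * (N * d).+1)%N /\ forall x, trunc (lo + N%:Z) x -> inspan g x.
Proof.
set T := (N * d).+1.
pose gk (p : 'I_c * 'I_T) : F := bmon k d (N - D) p.2 *: kap p.1.
pose gm := @mongen k d d_gt0 r a P T (lo + N%:Z).
pose g (s : ({t | P t} * 'I_T) + ('I_c * 'I_T)) : F :=
  match s with inl p => gm p | inr p => gk p end.
exists _, g; split.
  by rewrite card_sum mongen_card card_prod !card_ord mulnDl.
move=> x [b [y [hb hy hy0 ->]]]; have hS := inspan_subsp g.
apply: subspD => //; last first.
  have hN i : P i -> (lo + N%:Z - a i) * d%:Z + 1 <= T%:Z by have := hlo i; rewrite /T; nia.
  have [cf ->] := mongen_span hN hy hy0.
  by apply: subsp_sum => // p _; apply: subspZ => //; exact: (inspan_gen g (inl p)).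
apply: subsp_sum => // i _; have := hb i.
have [lt|ge] := ltnP N D.
  case E : (lo + N%:Z - (lo + D%:Z)) => [m|m]; first lia.
  by move=> /eqP h; have -> : b i = 0 by [apply: val_inj]; rewrite scale0r; exact: hS.1.
have -> : lo + N%:Z - (lo + D%:Z) = (N - D)%N%:Z by lia.
move=> /(piece_expand d_gt0) ->; rewrite scaler_suml; apply: subsp_sum => // l _.
rewrite -scalerA; apply: subspZ => //.
have ltT : (l < T)%N by have := ltn_ord l; rewrite /T; nia.
exact: (inspan_gen g (inr (i, Ordinal ltT))).
Qed.

Lemma card_low : #|P| = (\sum_(J < D) ngens a (lo + J%:Z))%N.
Proof.
rewrite -sum1_card big_mkcond /=.
transitivity (\sum_(i < r) \sum_(J < D) (a i == (lo + J%:Z)%R))%N; last first.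
  rewrite exchange_big; apply: eq_bigr => J _; rewrite /ngens -sum1_card [RHS]big_mkcond.
  by apply: eq_bigr => i _; rewrite inE; case: eqP.
apply: eq_bigr => i _; have := hlo i; rewrite unfold_in /P.
case: ifP => h hi.
  have lt : (`|(a i - lo)%R| < D)%N by lia.
  rewrite (bigD1 (Ordinal lt)) //= big1 => [|J ne]; first by have -> : a i == lo + Posz `|(a i - lo)%R| by lia.
  by case: eqP => // E; case/eqP: ne; apply: val_inj => /=; lia.
by rewrite big1 // => J _; have := ltn_ord J; case: eqP => //; lia.
Qed.
End Truncation.

Section Res.
Variables (M : gmod k d) (R : resolution d_gt0 M).
Hypothesis nosoc : forall x : M, u *: x = 0 -> v *: x = 0 -> x = 0.
Variable beta : nat -> int -> nat.
Hypothesis hbeta : forall i j, has_tor_dim R i j (beta i j).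
Variable lo : int.
Hypothesis hlo : forall i, lo <= @res_deg _ _ _ _ R 0 i.

Let K0 : resF R 0 -> Prop := kerp (res_aug R).
Let hK : gsub K0. Proof. exact: (Kr_gsub R 0). Qed.
Notation cK := (cK R).
Notation sK := (sK R).
Notation rk := (rk R).

Lemma nK j : has_quot_dim (hp K0 j) (up K0 j) (sK 0 j + (beta 1 j + cK 0 j)).
Proof.
apply: (qd_add (V := mp K0 j)).
- exact: hp_subsp.
- exact: mp_subsp.
- exact: up_subsp.
- by move=> x; apply: up_mp.
- by move=> x; apply: mp_hp.
- exact: (sKP R 0 j).
exact: (t0KP hbeta 0 j).
Qed.

Lemma sK_lo : sK 0 lo = 0%N.
Proof.
apply: (qd_uniq (up_subsp lo hK) (sKP R 0 lo)); apply: qd0 => x [z [hz ->]].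
rewrite big1; first exact: (up_subsp lo hK).1.
move=> i _; have [h _] := hz i.
by rewrite (free_low hlo _ h) ?scaler0 //; lia.
Qed.

(** [rank_upper] for the elements of K of degree at most lo + D and those of m K
    of degree lo + D + 1, inside [trunc].  The summands are the dimensions of
    K / (u, v) K, with m K / (u, v) K shifted by one degree: this shift is what
    brings in the next Betti number. *)
Lemma growth_upper D :
  (\sum_(J < D.+1) (beta 1 (lo + J%:Z)%R + cK 0 (lo + J%:Z)%R + sK 0 (lo + J%:Z + 1)%R)
    <= (\sum_(J < D) rk 0 (lo + J%:Z)%R + cK 0 (lo + D%:Z)%R) * d)%N.
Proof.
have [kap hkap] := (qdE _ _ _).1 (cKP R 0 (lo + D%:Z)).
pose m (J : 'I_D.+2) := if (J < D.+1)%N then (sK 0 (lo + J%:Z)%R + (beta 1 (lo + J%:Z)%R + cK 0 (lo + J%:Z)%R))%N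
  else sK 0 (lo + J%:Z)%R.
pose U (J : 'I_D.+2) := if (J < D.+1)%N then hp K0 (lo + J%:Z) else mp K0 (lo + J%:Z).
have : (\sum_J m J <= (#|(fun t : 'I_(res_rank R 0) => (@res_deg _ _ _ _ R 0 t < lo + D%:Z)%R)| + cK 0 (lo + D%:Z)%R) * d)%N.
  apply: (@rank_upper_dims k d d_gt0 _ _ K0 hK lo D.+2 m U _ _ (@trunc _ _ lo D _ kap)).
  - move=> J; rewrite /U /m; case: ifP => _; [exact: nK | exact: (sKP R 0)].
  - by move=> J x; rewrite /U; case: ifP => // _; apply: mp_hp.
  - exact: (@Kr_uvreg _ _ _ _ R nosoc 0).
  - move=> n x hx; split; rewrite [n + 1]addrC; apply: trunc_scale => //; exact: w_piece.
  - move=> J x; rewrite /U; case: ifP => hJ.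
      case: (ltngtP J D) => [lt|gt|E]; [exact: trunc_low | by rewrite ltnS leqNgt gt in hJ |].
      by rewrite E; apply: trunc_top.
    have -> : J = D.+1 :> nat by have := ltn_ord J; move: hJ; lia.
    exact: trunc_mp.
  exact: trunc_growth.
rewrite (card_low _ hlo) => h; apply: leq_trans h.
have mE (J : 'I_D.+1) : m (widen_ord (leqnSn D.+1) J) =
    (sK 0 (lo + J%:Z)%R + (beta 1 (lo + J%:Z)%R + cK 0 (lo + J%:Z)%R))%N.
  by rewrite /m ifT //; exact: (ltn_ord J).
have mM : m ord_max = sK 0 (lo + D.+1%:Z)%R by rewrite /m ifF //; exact: ltnn.
rewrite [X in (_ <= X)%N]big_ord_recr mM (eq_bigr _ (fun J _ => mE J)).
rewrite !big_split /= (shift_sum _ sK_lo) [X in (_ + X <= _)%N]big_ord_recr /=.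
by rewrite addnA leq_add2r addnC.
Qed.

Variables (b0 : B) (bdeg : nat).
Hypotheses (b0_neq0 : b0 != 0) (b0_piece : in_piece d 0 bdeg%:Z (vval b0)).
Hypothesis b0_ann : forall x : M, b0 *: x = 0.

(** The annihilator of M maps F_0 into K, so [rank_lower] applies. *)
Lemma growth_lower : exists D0, forall D, (D0 <= D)%N ->
  (\sum_(J < D) rk 0 (lo + J%:Z)%R * d
    <= \sum_(J < D) (beta 1 (lo + J%:Z)%R + cK 0 (lo + J%:Z)%R + sK 0 (lo + J%:Z + 1)%R))%N.
Proof.
have [D0 hD0] := sat_vanish hK hlo (@Kr_sat _ _ _ _ R nosoc 0 : sat K0).
exists D0 => D hD.
pose m (J : 'I_D) := (sK 0 (lo + J%:Z)%R + (beta 1 (lo + J%:Z)%R + cK 0 (lo + J%:Z)%R))%N.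
have hrk : (\sum_(J < D) rk 0 (lo + J%:Z)%R <= res_rank R 0)%N.
  rewrite -(card_low D hlo); apply: leq_trans (max_card _) _; by rewrite card_ord.
have hlow : (res_rank R 0 * d <= \sum_J m J)%N.
  have hm (J : 'I_D) : has_quot_dim (hp K0 (lo + J%:Z)) (up K0 (lo + J%:Z)) (m J).
    exact: nK.
  have hd (n : int) (x : resF R 0) : lo + D%:Z <= n -> hp K0 n x -> up K0 n x.
    by move=> hn; apply: hD0; lia.
  apply: (rank_lower hlo hm hd b0_neq0 b0_piece) => x.
  by rewrite /K0 /kerp linearZ_LR b0_ann.
rewrite -big_distrl /=; apply: leq_trans (leq_mul hrk (leqnn d)) _; apply: leq_trans hlow _.
rewrite /m !big_split /= addnC leq_add2l (shift_sum _ sK_lo) big_ord_recr.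
exact: leq_addr.
Qed.
End Res.
End Growth.

(** * Modules of depth one *)
Section Package.
Variables (k : fieldType) (d : nat) (d_gt0 : (0 < d)%N).
Local Notation B := (vring k d).
Local Notation w := (@w k d).
Local Notation u := (@u k d).
Local Notation v := (@v k d).

(** Positive depth, in the form used for the syzygy modules. *)
Definition no_socle (M : lmodType B) : Prop :=
  forall x : M, u *: x = 0 -> v *: x = 0 -> x = 0.
Definition homog_annihilated (M : lmodType B) : Prop :=
  exists (b : B) (n : nat), [/\ b != 0, in_piece d 0 n%:Z (vval b) & annihilates M b].

Lemma ngens0 (r : nat) (a : 'I_r -> int) j : (forall i, a i <> j) -> ngens a j = 0%N.
Proof. by move=> h; apply: eq_card0 => i; rewrite inE; apply/eqP/h. Qed.

Lemma int_bounds (r r' : nat) (a : 'I_r -> int) (a' : 'I_r' -> int) : exists (lo : int) (D : nat),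
  (forall i, lo <= a i < lo + D%:Z) /\ (forall i, lo <= a' i < lo + D%:Z).
Proof.
pose h := (\sum_i `|a i| + \sum_i `|a' i|)%N.
exists (- h%:Z), (h + h).+1; split=> i.
  have : (`|a i| <= h)%N by rewrite /h (bigD1 i) //= -addnA leq_addr.
  lia.
have : (`|a' i| <= h)%N by rewrite /h (bigD1 i) //= addnCA leq_addr.
lia.
Qed.

(** The numerical constraints on the Betti numbers of a module of depth and
    dimension one. *)
Record cm1_numbers (beta : nat -> int -> nat) (lo : int) (D0 : nat) : Prop := CM1Numbers {
  cm1_tail : forall i (j : int), beta i.+3 (j + 1) = (d.-1 * beta i.+2 j)%N;
  cm1_second : forall j : int, (beta 2 (j + 1)%R <= d.-1 * beta 1 j)%N;
  cm1_supp : forall j, (j < lo) || (lo + D0%:Z <= j) -> beta 0 j = 0%N /\ beta 1 j = 0%N;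
  cm1_partial : forall D,
    (d * \sum_(J < D.+1) beta 1 (lo + J%:Z)%R <= d * \sum_(J < D) beta 0 (lo + J%:Z)%R
      + \sum_(J < D.+1) beta 2 (lo + J%:Z + 1)%R)%N;
  cm1_total : forall D, (D0 <= D)%N ->
    (d * \sum_(J < D) beta 0 (lo + J%:Z)%R + \sum_(J < D) beta 2 (lo + J%:Z + 1)%R
      <= d * \sum_(J < D) beta 1 (lo + J%:Z)%R)%N }.

Lemma betti_numerics (M : gmod k d) (R : resolution d_gt0 M) beta :
  no_socle M -> homog_annihilated M -> (forall i j, has_tor_dim R i j (beta i j)) ->
  exists lo D0, cm1_numbers beta lo D0.
Proof.
move=> hs [b [n [b0 hb bM]]] hbeta.
have [lo [D1 [h0 h1]]] := int_bounds (@res_deg _ _ _ _ R 0) (@res_deg _ _ _ _ R 1).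
have hlo i : lo <= @res_deg _ _ _ _ R 0 i by case/andP: (h0 i).
have [D0 hD0] := growth_lower hs hbeta hlo b0 hb bM.
(* the count of linear syzygies for F_1 -> K, its rank being expressed by [rkS] *)
have key j : (beta 1 j + cK R 0 j + sK R 0 (j + 1)%R + beta 2 (j + 1)%R
    = d * beta 1 j + d * cK R 0 j)%N.
  have hd n' : (d * n' = d.-1 * n' + n')%N by rewrite -mulSnr prednK.
  have := linear_syz hs hbeta 0 j; rewrite (rkS hbeta 0 j) !hd !mulnDr.
  move: (sK R 0 _) (beta 2 _) (d.-1 * cK R 1 j)%N (d.-1 * cK R 0 j)%N (d.-1 * beta 1 j)%N; lia.
have keyS D : (\sum_(J < D) (beta 1 (lo + J%:Z)%R + cK R 0 (lo + J%:Z)%R + sK R 0 (lo + J%:Z + 1)%R)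
    + \sum_(J < D) beta 2 (lo + J%:Z + 1)%R
    = d * \sum_(J < D) beta 1 (lo + J%:Z)%R + d * \sum_(J < D) cK R 0 (lo + J%:Z)%R)%N.
  by rewrite !big_distrr -!big_split; apply: eq_bigr => J _; exact: key.
have rkE D : (\sum_(J < D) rk R 0 (lo + J%:Z)%R
    = \sum_(J < D) cK R 0 (lo + J%:Z)%R + \sum_(J < D) beta 0 (lo + J%:Z)%R)%N.
  by rewrite -big_split; apply: eq_bigr => J _; exact: (rk0 hbeta).
exists lo, (maxn D0 D1); split.
- exact: (betti_tail hs hbeta).
- exact: (betti_second hs hbeta).
- move=> j hj.
  have r0 : rk R 0 j = 0%N.
    by apply: ngens0 => i E; have := h0 i; move: hj; rewrite -E; lia.
  have r1 : rk R 1 j = 0%N.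
    by apply: ngens0 => i E; have := h1 i; move: hj; rewrite -E; lia.
  have := rk0 hbeta j; have := rkS hbeta 0 j; rewrite r0 r1.
  move=> /esym/eqP; rewrite !addn_eq0 => /and3P[_ /eqP b1 _] /esym/eqP.
  by rewrite addn_eq0 => /andP[_ /eqP].
- move=> D; have := growth_upper hs hbeta hlo D; have := keyS D.+1; rewrite rkE.
  rewrite [X in (_ = _ + d * X)%N -> _]big_ord_recr /= !mulnDl !mulnDr.
  rewrite ![(_ * d)%N]mulnC; lia.
move=> D; rewrite geq_max => /andP[hD _]; have := hD0 D hD; have := keyS D.
rewrite -big_distrl /= rkE mulnDl ![(_ * d)%N]mulnC => E h.
rewrite -(leq_add2l (d * \sum_(J < D) cK R 0 (lo + J%:Z)%R)) [X in (_ <= X)%N]addnC -E addnA.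
by rewrite leq_add2r.
Qed.

(** The regular element b of m is a combination of the w i.  If u and v kill x,
    so does m^2 = (u, v) m, and b m x = 0 forces m x = 0, then x = 0. *)
Lemma depth1_socle (M : lmodType B) : has_depth M 1 -> no_socle M /\ exists x : M, x != 0.
Proof.
move=> [[xs hreg sz] _]; case: xs sz hreg => [|b [|//]] // _ [hirr hr hn].
have binj (x : M) : b *: x = 0 -> x = 0.
  move=> E; have [||y ->] := hr 0%N _ x; rewrite //=.
    by exists (fun=> 0); rewrite big_ord0.
  by rewrite big_ord0.
have [c Ec] := irrelevantE d_gt0 (hirr b (mem_head _ _)).
have killed (x : M) : (forall i : 'I_d.+1, w i *: x = 0) -> x = 0.
  move=> h; apply: binj; rewrite Ec scaler_suml big1 // => i _.
  by rewrite mulrC -scalerA h scaler0.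
split=> [x ux vx|].
  apply: (killed) => i; apply: (killed) => j.
  have [l [hl]] := w_mul_uv k d_gt0 (ltn_ord j : (j <= d)%N) (ltn_ord i : (i <= d)%N).
  by rewrite scalerA; case=> ->; rewrite mulrC -scalerA ?ux ?vx scaler0.
apply: NNPP => h; apply: hn => x.
have -> : x = 0 by apply: NNPP => /eqP x0; apply: h; exists x.
by exists (fun=> 0); rewrite big1 // => i _; rewrite scaler0.
Qed.

Lemma mcoeff0M (p q : {mpoly k[2]}) : (p * q)@_0 = p@_0 * q@_0.
Proof. by have [h _] := @mcoeff0_is_multiplicative 2 k; rewrite h. Qed.

(** Divisibility by x^m in S. *)
Definition xdiv (m : nat) (p : {mpoly k[2]}) : bool :=
  all (fun e : 'X_{1..2} => (m <= e ord0)%N) (msupp p).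

Lemma xdivP m p : reflect (forall e, p@_e != 0 -> (m <= e ord0)%N) (xdiv m p).
Proof.
apply: (iffP allP) => h e; first by rewrite -mcoeff_msupp; apply: h.
by rewrite mcoeff_msupp; apply: h.
Qed.

Lemma xdivD m p q : xdiv m p -> xdiv m q -> xdiv m (p + q).
Proof.
move=> /xdivP hp /xdivP hq; apply/xdivP => e; rewrite mcoeffD.
have [->|/hp//] := eqVneq p@_e 0; by rewrite add0r; apply: hq.
Qed.

Lemma xdivM m n p q : xdiv m p -> xdiv n q -> xdiv (m + n) (p * q).
Proof.
move=> /allP hp /allP hq; apply/allP => e /msuppM_le /allpairsP[[a b] /= [ha hb ->]].
by rewrite mnmDE leq_add ?hp ?hq.
Qed.

Lemma xdiv0p p : xdiv 0 p. Proof. exact/allP. Qed.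
Lemma xdiv0 m : xdiv m 0. Proof. by apply/xdivP => e; rewrite mcoeff0 eqxx. Qed.

Lemma xdivX m p n : xdiv m p -> xdiv (n * m) (p ^+ n).
Proof.
move=> hp; elim: n => [|n IH]; first exact: xdiv0p.
by rewrite exprS mulSn; apply: xdivM.
Qed.

(** x is prime in S: divisibility by x is vanishing under x |-> 0, y |-> X. *)
Lemma xdiv1_prime p q : xdiv 1 (p * q) -> xdiv 1 p || xdiv 1 q.
Proof.
pose h := fun i : 'I_2 => if i == ord0 then 0 else 'X : {poly k}.
have E (s : {mpoly k[2]}) : xdiv 1 s = (mmap (@polyC k) h s == 0).
  have mE (m : 'X_{1..2}) : mmap1 h m = if m ord0 == 0%N then 'X^(m ord_max) else 0.
    rewrite /mmap1 big_ord_recl big_ord_recl big_ord0 mulr1 /h /=.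
    have -> : lift ord0 ord0 = ord_max :> 'I_2 by apply: val_inj.
    by case: (m ord0) => [|n]; rewrite ?expr0 ?mul1r // exprS !mul0r.
  have coefE n : (mmap (@polyC k) h s)`_n = s@_(m2 0 n).
    rewrite /mmap coef_sum.
    rewrite (eq_bigr (fun m => s@_m * (m == m2 0 n)%:R)); last first.
      move=> m _; rewrite mE eq_m2; case: eqP => _ /=; last by rewrite mulr0 coef0 mulr0.
      by rewrite coefCM coefXn eq_sym.
    have [hm|hm] := boolP (m2 0 n \in msupp s); last first.
      rewrite (memN_msupp_eq0 hm) big_seq big1 // => m hm'.
      case: (m =P m2 0 n) => [Em|_]; last by rewrite mulr0.
      by rewrite -Em hm' in hm.
    rewrite (bigD1_seq _ hm (msupp_uniq s)) /= eqxx mulr1 big1 ?addr0 // => m /negPf->.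
    by rewrite mulr0.
  apply/xdivP/eqP => [hx|h0 e].
    by apply/polyP => n; rewrite coefE coef0; apply/eqP; apply: contraT => /hx; rewrite m2_0.
  rewrite (m2P e); case: (e ord0) => [|n]; rewrite ?m2_0 // -coefE h0 coef0 eqxx //.
by rewrite !E rmorphM /= mulf_eq0.
Qed.
End Package.

(** * Modules of dimension one *)
Section Dimension.
Variables (k : fieldType) (d : nat) (d_gt0 : (0 < d)%N).
Local Notation B := (vring k d).
Local Notation u := (@u k d).
Local Notation v := (@v k d).

(** The chain 0 < x S \cap B < m of primes of B. *)
Definition zero_ideal : {pred B} := fun b => b == 0.
Definition x_ideal : {pred B} := fun b => xdiv 1 (vval b).
Definition max_ideal : {pred B} := fun b => (vval b)@_0%MM == 0.

Lemma xdiv_ideal m (a b c : B) : xdiv m (vval b) -> xdiv m (vval c) ->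
  xdiv m (vval (a * b + c)).
Proof. by move=> hb hc; apply: xdivD hc; rewrite -[m]add0n; apply: xdivM hb; exact: xdiv0p. Qed.

Lemma xdiv_one m : (0 < m)%N -> xdiv m (vval (1 : B)) = false.
Proof.
move=> m0; apply/negP => /xdivP/(_ 0%MM); rewrite mcoeff1 eqxx oner_eq0 mnm0E => /(_ isT).
by rewrite leqNgt m0.
Qed.

Lemma zero_idealP : idealr_closed zero_ideal /\ prime_idealr_closed zero_ideal.
Proof.
split; first split=> [||a b c]; rewrite ?unfold_in ?eqxx ?oner_eq0 //.
  by move=> /eqP-> /eqP->; rewrite mulr0 addr0.
by move=> a b; rewrite ?unfold_in => /eqP/vmul_eq0[]->; rewrite eqxx ?orbT.
Qed.

Lemma x_idealP : idealr_closed x_ideal /\ prime_idealr_closed x_ideal.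
Proof.
split; first split=> [||a b c]; rewrite ?unfold_in /x_ideal ?xdiv_one //.
- exact: xdiv0.
- exact: xdiv_ideal.
by move=> a b; rewrite ?unfold_in; apply: xdiv1_prime.
Qed.

Lemma max_idealP : idealr_closed max_ideal /\ prime_idealr_closed max_ideal.
Proof.
split; first split=> [||a b c]; rewrite ?unfold_in /max_ideal.
- by rewrite mcoeff0.
- by rewrite mcoeff1 eqxx oner_eq0.
- by rewrite ?unfold_in mcoeffD mcoeff0M => /eqP-> /eqP->; rewrite mulr0 addr0.
by move=> a b; rewrite ?unfold_in mcoeff0M mulf_eq0.
Qed.

Lemma uX0 : x_ideal u.
Proof.
apply/xdivP => e; rewrite vval_u mcoeffX; case: (m2 d 0 =P e) => [<-|]; rewrite ?eqxx //.
by rewrite m2_0.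
Qed.

Lemma max_v : max_ideal v.
Proof.
rewrite /max_ideal vval_v mcoeffX; case: (m2 0 d =P 0%MM) => // /(congr1 mdeg).
by rewrite mdeg0 mdeg_m2 m2_0 m2_1; lia.
Qed.

Lemma x_idealNv : ~~ x_ideal v.
Proof.
apply/negP => /xdivP/(_ (m2 0 d)); rewrite vval_v mcoeffX eqxx oner_eq0 m2_0.
by move=> /(_ isT).
Qed.

(** Otherwise the chain of three primes above would consist of primes containing
    the annihilator 0 of M. *)
Lemma dim1_annihilator (M : lmodType B) : has_dim M 1 -> exists b : B, b != 0 /\ annihilates M b.
Proof.
move=> [_ hmax]; apply: NNPP => hn.
pose p (i : nat) : {pred B} := match i with 0 => zero_ideal | 1 => x_ideal | _ => max_ideal end.
suff /hmax : prime_chain M 2 p by [].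
split=> [i _|b hb|i].
- by case: i => [|[|i]]; [exact: zero_idealP | exact: x_idealP | exact: max_idealP].
- rewrite unfold_in /p /zero_ideal; apply/negPn/negP => b0; apply: hn; by exists b.
case: i => [|[|//]] _ /=; split.
- by move=> b; rewrite ?unfold_in => /eqP->; exact: xdiv0.
- move=> /(_ u uX0); rewrite unfold_in => /eqP; apply/eqP; exact: bmon_neq0.
- move=> b; rewrite ?unfold_in /x_ideal /max_ideal => /xdivP h.
  by apply/eqP/eqP/negPn/negP => /h; rewrite mnm0E.
move=> /(_ v max_v); rewrite unfold_in; apply/negP; exact: x_idealNv.
Qed.

(** A homogeneous component of a nonzero annihilating element kills every
    homogeneous element, hence M. *)
Lemma homog_annihilator (M : gmod k d) : has_dim M 1 -> homog_annihilated M.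
Proof.
move=> /dim1_annihilator[b [b0 hb]].
pose G := greg k d_gt0.
have [L uL EL] := @gpr_span k d G b.
have [n nL hn] : exists2 n, n \in L & gpr n (b : G) <> 0.
  apply: NNPP => h; case/eqP: b0; rewrite EL big_seq big1 // => n nL.
  by apply: NNPP => h'; apply: h; exists n.
have hp := @gpr_piece k d G n b; set c : B := gpr n (b : G) in hn hp.
have c_ann j (x : M) : gpiece j x -> c *: x = 0.
  move=> hx; have := hb x; rewrite [in X in X -> _]EL scaler_suml => E.
  have := congr1 (gpr (n + j)) E; rewrite gpr_sum.
  rewrite (bigD1_seq n nL uL) /= (gpr_homog _ (gpieceZ hp hx)) eqxx big1 ?addr0.
    by rewrite (gpr_homog _ (gpiece0 _ (n + j))) eqxx.
  move=> m ne; rewrite (gpr_homog _ (gpieceZ (@gpr_piece k d G m b) hx)).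
  by rewrite (inj_eq (addIr j)) (negPf ne).
case: n @c hp {nL} hn c_ann => [n|n] c hp hn c_ann; last first.
  by case: hn; apply: val_inj; apply/eqP.
exists c, n; split=> [||x]; [exact/eqP | exact: hp |].
have [L' _ ->] := gpr_span x; rewrite scaler_sumr big1 // => j _.
exact/c_ann/gpr_piece.
Qed.

Lemma CM_depth1P (M : gmod k d) : CM_depth1 M ->
  [/\ no_socle M, homog_annihilated M & exists x : M, x != 0].
Proof.
move=> [[n [hn hdim]] h1]; have [hs hx] := depth1_socle d_gt0 h1.
split=> //; apply: homog_annihilator.
suff -> : 1%N = n by [].
apply/eqP; rewrite eqn_leq.
have [[xs hxs <-] hmax] := h1; have [[ys hys <-] hmax'] := hn.
by rewrite hmax // hmax'.
Qed.
End Dimension.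

(** * Decomposition into pure tables *)
Section Cones.
Variable d : nat.
Hypothesis d_gt0 : (0 < d)%N.

(** The numerical table of 0 -> M^(l)(-d1) -> B(-d0): M^(l) has l + 1 generators,
    and a linear resolution with ranks d l (d-1)^(i-1) in step i > 0. *)
Definition pureT (d0 d1 : int) (l : nat) : btable := fun i j =>
  match i with
  | 0 => (j == d0)%:R
  | 1 => (l.+1 * (j == d1))%:R
  | i'.+2 => (d * l * d.-1 ^ i' * (j == d1 + i'.+1%:Z))%:R
  end.

Definition is_pureT (T : btable) : Prop :=
  exists (d0 d1 : int) (l : nat), [/\ d0 < d1, l = 0%N \/ l = d.-1
    & forall i j, T i j = pureT d0 d1 l i j].

Lemma cone_ext G (T T' : btable) : (forall i j, T i j = T' i j) -> cone G T -> cone G T'.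
Proof. by move=> h [n [c [g [h1 h2]]]]; exists n, c, g; split=> // i j; rewrite -h. Qed.

Lemma cone0 G : cone G (fun _ _ => 0).
Proof.
exists 0%N, (fun=> 0), (fun=> (fun _ _ => 0)); split=> [[]//|i j].
by rewrite big_ord0.
Qed.

Lemma cone_add G c g T : 0 <= c -> G g -> cone G T ->
  cone G (fun i j => c * g i j + T i j).
Proof.
move=> c0 hg [n [e [f [h1 h2]]]].
exists n.+1, (fun a => if unlift ord0 a is Some b then e b else c),
  (fun a => if unlift ord0 a is Some b then f b else g); split.
  by move=> a; case: unliftP.
move=> i j; rewrite big_ord_recl unlift_none h2; congr (_ + _).
by apply: eq_bigr => a _; rewrite liftK.
Qed.

(** Rows i > 0 of pureT, which do not depend on d0. *)
Definition lin_row (d1 : int) (l : nat) : btable := fun i j =>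
  if i is 0 then 0 else pureT 0 d1 l i j.

(** The two values of l. *)
Definition lval (b : bool) : nat := if b then d.-1 else 0.

Section Match.
Variables (lo : int) (D : nat).

(** A table given by f J generators in degree lo + J and, for p = (b, J), the
    amount q p of copies of M^(lval b) in degree lo + J as first syzygies. *)
Definition tab (f : 'I_D -> rat) (q : bool * 'I_D -> rat) : btable := fun i j =>
  if i is 0 then \sum_J f J * (j == lo + J%:Z)%:R
  else \sum_p q p * lin_row (lo + p.2%:Z) (lval p.1) i j.

Lemma sum_delta (I : finType) (P : pred I) (i0 : I) (c : rat) :
  \sum_(i | P i) c * (i == i0)%:R = c * (P i0)%:R.
Proof.
case: (boolP (P i0)) => h.
  rewrite (bigD1 i0) //= eqxx big1 ?addr0 // => i /andP[_ /negPf->].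
  by rewrite mulr0.
rewrite mulr0 big1 // => i Pi; case: eqP => [E|_]; rewrite ?mulr0 //.
by rewrite E (negPf h) in Pi.
Qed.

Lemma pureT_rows d0 d1 l i j : pureT d0 d1 l i j =
  (if i is 0 then (j == d0)%:R else lin_row d1 l i j).
Proof. by case: i. Qed.

(** Greedy matching: a first syzygy p of least degree is matched with any
    generator J0 of smaller degree, which exists by the partial sum condition,
    and as much as possible of the table pureT is subtracted.  The condition
    persists: before the degree of p its left side is 0, and from there on both
    sides lose the same amount.  The condition on totals leaves no generator at
    the end.  The induction is on the number of nonzero entries of f and q. *)
Lemma tab_cone (f : 'I_D -> rat) (q : bool * 'I_D -> rat) :
  (forall J, 0 <= f J) -> (forall p, 0 <= q p) ->
  (forall t : nat, \sum_(p : bool * 'I_D | (p.2 <= t)%N) q p <= \sum_(J < D | (J < t)%N) f J) ->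
  \sum_J f J <= \sum_p q p ->
  cone is_pureT (tab f q).
Proof.
have [n] := ubnP (#|[pred J | f J != 0]| + #|[pred p | q p != 0]|).
elim: n f q => // n IH f q; rewrite ltnS => hn f0 q0 hpart htot.
have [/existsP[p1 hp1]|/existsPn hq] := boolP [exists p, q p != 0]; last first.
  have qz p : q p = 0 by have /negPn/eqP := hq p.
  have fz J : f J = 0.
    apply/eqP; rewrite eq_le f0 andbT; apply: le_trans (_ : \sum_J f J <= _).
      by rewrite (bigD1 J) //= lerDl sumr_ge0.
    by apply: le_trans htot _; rewrite big1.
  apply: cone_ext (cone0 _) => i j; rewrite /tab; case: i => [|i].
    by rewrite big1 // => J _; rewrite fz mul0r.
  by rewrite big1 // => p _; rewrite qz mul0r.
case: (@arg_minnP _ p1 (fun p => q p != 0) (fun p => p.2 : nat) hp1) => p hp pmin.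
have qp : 0 < q p by rewrite lt_def hp q0.
have low (t : nat) : (t < p.2)%N -> \sum_(p' : bool * 'I_D | (p'.2 <= t)%N) q p' = 0.
  move=> ht; apply: big1 => p' hp'; apply/eqP; apply: contraLR hp' => /pmin h.
  by rewrite -ltnNge; apply: leq_trans h.
have [J0 /andP[hJ0 fJ0]] : exists J : 'I_D, (J < p.2)%N && (f J != 0).
  apply/existsP; rewrite -[X in is_true X]negbK; apply/negP => /existsPn h.
  have : \sum_(J < D | (J < p.2)%N) f J = 0.
    by apply: big1 => J hJ; have := h J; rewrite hJ /= negbK => /eqP.
  move=> E; have := hpart p.2; rewrite E (bigD1 p) //= => h'.
  have : 0 < 0 :> rat by apply: lt_le_trans h'; apply: ltr_wpDr => //; apply: sumr_ge0.
  by rewrite ltxx.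
have fp : 0 < f J0 by rewrite lt_def fJ0 f0.
pose c := Num.min (f J0) (q p).
have cf : c <= f J0 by rewrite /c ge_min lexx.
have cq : c <= q p by rewrite /c ge_min lexx orbT.
have c0 : 0 <= c by rewrite /c le_min !ltW.
pose f' J := f J - c * (J == J0)%:R.
pose q' p' := q p' - c * (p' == p)%:R.
have sf P : \sum_(J | P J) f' J = \sum_(J | P J) f J - c * (P J0)%:R.
  by rewrite sumrB sum_delta.
have sq (P : pred (bool * 'I_D)) : \sum_(p | P p) q' p = \sum_(p | P p) q p - c * (P p)%:R.
  by rewrite sumrB sum_delta.
have hc : cone is_pureT (tab f' q').
  apply: IH.
  - apply: leq_trans hn.
    have hf : [pred J | f' J != 0] \subset [pred J | f J != 0].
      apply/subsetP => J; rewrite !inE /f'.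
      by have [->|_] := eqVneq J J0; rewrite ?fJ0 // mulr0 subr0.
    have hq : [pred p | q' p != 0] \subset [pred p | q p != 0].
      apply/subsetP => p'; rewrite !inE /q'.
      by have [->|_] := eqVneq p' p; rewrite ?hp // mulr0 subr0.
    have [E|E] : f' J0 = 0 \/ q' p = 0.
      rewrite /f' /q' !eqxx !mulr1 /c; case: (leP (f J0) (q p)) => _.
        by left; rewrite subrr.
      by right; rewrite subrr.
      rewrite -addSn; apply: leq_add; last exact: subset_leq_card hq.
      apply: proper_card; apply/properP; split=> //.
      by exists J0; rewrite !inE ?fJ0 // E eqxx.
    rewrite -addnS; apply: leq_add; first exact: subset_leq_card hf.
    apply: proper_card; apply/properP; split=> //.
    by exists p; rewrite !inE ?hp // E eqxx.
  - move=> J; rewrite /f'; have [->|_] := eqVneq J J0; first by rewrite mulr1 subr_ge0.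
    by rewrite mulr0 subr0.
  - move=> p'; rewrite /q'; have [->|_] := eqVneq p' p; first by rewrite mulr1 subr_ge0.
    by rewrite mulr0 subr0.
  - move=> t; rewrite sf (sq (fun p => p.2 <= t)%N).
    have [ht|ht] := leqP p.2 t.
      by rewrite (leq_trans hJ0 ht) lerB // hpart.
    rewrite low // mulr0 subr0.
    case: ltnP => hJt; last first.
      by rewrite mulr0 subr0; apply: sumr_ge0.
    rewrite mulr1 subr_ge0 (bigD1 J0) //=; apply: le_trans cf _.
    by rewrite lerDl; apply: sumr_ge0.
  - by rewrite (sf xpredT) (sq xpredT) lerB.
have hg : is_pureT (pureT (lo + J0%:Z) (lo + p.2%:Z) (lval p.1)).
  exists (lo + J0%:Z), (lo + p.2%:Z), (lval p.1); split=> //; first by lia.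
  by rewrite /lval; case: p.1; [right | left].
apply: cone_ext (cone_add c0 hg hc) => i j; rewrite /tab pureT_rows.
case: i => [|i].
  rewrite -[RHS](subrK (\sum_J c * (J == J0)%:R * (j == lo + J%:Z)%:R)) -sumrB addrC.
  congr (_ + _); first by apply: eq_bigr => J _; rewrite /f' mulrBl.
  rewrite (bigD1 J0) //= eqxx mulr1 big1 ?addr0 // => J /negPf->.
  by rewrite mulr0 mul0r.
rewrite -[RHS](subrK (\sum_p' c * (p' == p)%:R * lin_row (lo + p'.2%:Z) (lval p'.1) i.+1 j)) -sumrB addrC.
congr (_ + _); first by apply: eq_bigr => p' _; rewrite /q' mulrBl.
rewrite (bigD1 p) //= eqxx mulr1 big1 ?addr0 // => p' /negPf->.
by rewrite mulr0 mul0r.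
Qed.
End Match.

(** The copies of M^(d-1) are counted by T(2, j+1), the rest of T(1, j) being
    copies of M^(0); the inequalities are those needed for the matching.  For
    d = 1 the two modules coincide, T(2, _) vanishes and all is counted as
    M^(0), division by d - 1 = 0 giving 0. *)
Lemma betti_cone_pure beta lo D0 : cm1_numbers d beta lo D0 ->
  cone is_pureT (fun i j => (beta i j)%:R).
Proof.
move=> [N1 N2 N5 N3 N4]; set D := D0.
have dn0 : d%:R != 0 :> rat by rewrite pnatr_eq0 -lt0n.
pose T1 (J : nat) : rat := (beta 1%N (lo + J%:Z)%R)%:R.
pose T2 (J : nat) : rat := (beta 2%N (lo + J%:Z + 1)%R)%:R.
pose q (p : bool * 'I_D) : rat :=
  if p.1 then T2 p.2 / (d * d.-1)%:R else T1 p.2 - T2 p.2 / d.-1%:R.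
pose f (J : 'I_D) : rat := (beta 0%N (lo + J%:Z)%R)%:R.
have hT2 J : T2 J <= d.-1%:R * T1 J.
  rewrite /T1 /T2 -natrM ler_nat. exact: N2.
have T2z J : d.-1 = 0%N -> T2 J = 0.
  move=> E; apply/eqP; rewrite eq_le; have := hT2 J; rewrite E mul0r => ->.
  by rewrite ler0n.
(* the rank of the part of the first syzygy module in one degree *)
have qsum J : q (true, J) + q (false, J) = T1 J - T2 J / d%:R.
  rewrite /q /=; have [E|E] := eqVneq d.-1 0%N.
    by rewrite T2z // !mul0r subr0 add0r.
  have e0 : d.-1%:R != 0 :> rat by rewrite pnatr_eq0.
  rewrite natrM; have -> : d%:R = d.-1%:R + 1 :> rat by rewrite natr1 prednK.
  have e1 : d.-1%:R + 1 != 0 :> rat by rewrite natr1 pnatr_eq0.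
  by field; rewrite e0 e1.
have qsumP (P : pred nat) : \sum_(p : bool * 'I_D | P p.2) q p = \sum_(J < D | P J) (T1 J - T2 J / d%:R).
  rewrite (reindex_onto (fun p : 'I_D * bool => (p.2, p.1)) (fun p => (p.2, p.1))) /=; last by case.
  rewrite (eq_bigl (fun p : 'I_D * bool => P p.1 && true)); last by case=> a b /=; rewrite eqxx.
  rewrite -(pair_big (fun J : 'I_D => P J) xpredT (fun J b => q (b, J))) /=.
  by apply: eq_bigr => J _; rewrite big_bool; exact: qsum.
have f0 J : 0 <= f J by rewrite ler0n.
have q0 p : 0 <= q p.
  rewrite /q; case: p.1; first by rewrite divr_ge0 ?ler0n.
  have [E|E] := eqVneq d.-1 0%N; first by rewrite T2z // mul0r subr0 ler0n.
  rewrite subr_ge0 ler_pdivrMr; first by rewrite mulrC.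
  by rewrite ltr0n lt0n.
have T10 (J : nat) : (D <= J)%N -> T1 J = 0.
  by move=> hJ; rewrite /T1; have [|_ ->] := N5 (lo + J%:Z); [lia|].
have T20 (J : nat) : (D <= J)%N -> T2 J = 0.
  by move=> hJ; apply/eqP; rewrite eq_le ler0n andbT (le_trans (hT2 J)) // T10 // mulr0.
have f00 (J : nat) : (D <= J)%N -> (beta 0%N (lo + J%:Z)%R)%:R = 0 :> rat.
  by move=> hJ; have [|-> _] := N5 (lo + J%:Z); [lia|].
have trunc (F : nat -> rat) t : (forall J, (D <= J)%N -> F J = 0) ->
    \sum_(J < D | (J < t)%N) F J = \sum_(J < t) F J.
  move=> hF; rewrite -(big_mkord (fun J => J < t)%N F) -(big_mkord xpredT F).
  rewrite (@big_nat_widen _ _ _ 0 D (maxn D t)) ?leq_maxl //.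
  rewrite [RHS](@big_nat_widen _ _ _ 0 t (maxn D t)) ?leq_maxr //.
  rewrite big_mkcond [RHS]big_mkcond; apply: eq_bigr => J _.
  by rewrite andTb; case: (J < t)%N => //=; case: ltnP => // /hF.
have key : cone is_pureT (tab lo f q).
  apply: tab_cone => //.
  - move=> t; rewrite (qsumP (fun J => J <= t)%N).
    rewrite (trunc (fun J => T1 J - T2 J / d%:R) t.+1); last first.
      by move=> J hJ; rewrite T10 // T20 // mul0r subr0.
    rewrite (trunc (fun J => (beta 0%N (lo + J%:Z)%R)%:R) t) //.
    rewrite sumrB -mulr_suml lerBlDr -(@ler_pM2l _ d%:R) ?ltr0n // mulrDr.
    rewrite mulrCA divff // mulr1 /T1 /T2 -!natr_sum -!natrM -natrD ler_nat.
    exact: N3.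
  rewrite (qsumP xpredT) sumrB -mulr_suml lerBrDr -(@ler_pM2l _ d%:R) ?ltr0n // mulrDr.
  rewrite mulrCA divff // mulr1 /f /T1 /T2 -!natr_sum -!natrM -natrD ler_nat.
  exact: N4.
apply: cone_ext key => i j; rewrite /tab.
have out j0 : (j0 < lo) || (lo + D%:Z <= j0) -> forall J : 'I_D, (j0 == lo + J%:Z) = false.
  by move=> h J; apply/eqP; have := ltn_ord J; lia.
have inn j0 : ~~ ((j0 < lo) || (lo + D%:Z <= j0)) -> exists J : 'I_D, j0 = lo + J%:Z.
  move=> h; have lt : (`|(j0 - lo)%R| < D)%N by lia.
  by exists (Ordinal lt) => /=; lia.
have pick (F : 'I_D -> rat) (J0 : 'I_D) : \sum_J F J * (lo + J0%:Z == lo + J%:Z)%:R = F J0.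
  rewrite (bigD1 J0) //= eqxx mulr1 big1 ?addr0 // => J ne.
  case: eqP => [E|_]; rewrite ?mulr0 //; case/eqP: ne; apply: val_inj => /=; lia.
have pick0 (F : 'I_D -> rat) j0 : (j0 < lo) || (lo + D%:Z <= j0) -> \sum_J F J * (j0 == lo + J%:Z)%:R = 0.
  by move=> h; apply: big1 => J _; rewrite (out _ h) mulr0.
case: i => [|i].
  have [h|/inn[J ->]] := boolP ((j < lo) || (lo + D%:Z <= j)); last by rewrite pick.
  by rewrite pick0 // (N5 j h).1.
have split_rows (i' : nat) (c : nat -> rat) (j0 : int) :
    (forall p : bool * 'I_D, lin_row (lo + p.2%:Z) (lval p.1) i'.+1 j = c (lval p.1) * (j0 == lo + p.2%:Z)%:R) ->
    \sum_p q p * lin_row (lo + p.2%:Z) (lval p.1) i'.+1 j =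
    \sum_J (q (true, J) * c d.-1 + q (false, J) * c 0%N) * (j0 == lo + J%:Z)%:R.
  move=> h; rewrite (reindex_onto (fun p : 'I_D * bool => (p.2, p.1)) (fun p => (p.2, p.1))) /=; last by case.
  rewrite (eq_bigl xpredT); last by case=> a b /=; rewrite eqxx.
  rewrite -(pair_bigA _ (fun (J : 'I_D) b => q (b, J) * lin_row (lo + J%:Z) (lval b) i'.+1 j)) /=.
  apply: eq_bigr => J _; have := h (true, J); have := h (false, J); rewrite big_bool /= => -> ->; ring.
case: i => [|i].
  rewrite (split_rows _ (fun l => l.+1%:R) j); last by move=> p; rewrite /lin_row /pureT natrM.
  have [h|/inn[J ->]] := boolP ((j < lo) || (lo + D%:Z <= j)); last first.
    rewrite pick /q /= prednK // -/(T1 J).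
    have [E|E] := eqVneq d.-1 0%N; first by rewrite T2z // !mul0r subr0 mulr1 add0r.
    have e0 : d.-1%:R != 0 :> rat by rewrite pnatr_eq0.
    by rewrite natrM; field; rewrite e0 dn0.
  by rewrite pick0 // (N5 j h).2.
rewrite (split_rows _ (fun l => (d * l * d.-1 ^ i)%:R) (j - i.+1%:Z)); last first.
  move=> p; rewrite /lin_row /pureT natrM; congr (_ * (nat_of_bool _)%:R).
  by apply/eqP/eqP; lia.
have tail : beta i.+2 j = (d.-1 ^ i * beta 2%N (j - i%:Z)%R)%N.
  elim: i j {split_rows} => [|i IHi] j; first by rewrite mul1n subr0.
  rewrite -{1}(subrK 1 j) N1 IHi expnS mulnA; congr (_ * beta 2%N _)%N; lia.
rewrite tail; have [h|] := boolP ((j - i.+1%:Z < lo) || (lo + D%:Z <= j - i.+1%:Z)).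
  rewrite pick0 //; have := N2 (j - i.+1%:Z); rewrite (N5 _ h).2 muln0 leqn0.
  have -> : j - i.+1%:Z + 1 = j - i%:Z by lia.
  by move=> /eqP->; rewrite muln0.
move=> /inn[J EJ]; rewrite EJ pick /q /= [RHS]natrM.
have -> : (beta 2%N (j - i%:Z)%R)%:R = T2 J :> rat.
  by rewrite /T2; congr (beta 2%N _)%:R; lia.
rewrite muln0 mul0n mulr0 addr0.
have [E|E] := eqVneq d.-1 0%N; first by rewrite T2z // !mul0r mulr0.
have e0 : d.-1%:R != 0 :> rat by rewrite pnatr_eq0.
by rewrite !natrM; field; rewrite e0 dn0.
Qed.
End Cones.

(** * Comparison of covers and the rank of free modules *)
Section Compare.
Variables (k : fieldType) (d : nat) (d_gt0 : (0 < d)%N).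
Local Notation B := (vring k d).
Local Notation w := (@w k d).

Section Abstract.
Variables (X Y M : gmod k d).
Variables (f : {linear X -> M}) (g : {linear Y -> M}) (h : {linear X -> Y}) (h' : {linear Y -> X}).
Hypotheses (df : degree0 f) (dg : degree0 g) (dh : degree0 h) (dh' : degree0 h').
Hypotheses (gh : forall x, g (h x) = f x) (fh' : forall y, f (h' y) = g y).

Lemma nomin_map j x : nomin (kerp f) j x -> nomin (kerp g) j (h x).
Proof.
move=> [[hx Kx] [z [hz Ez]]]; split; first by split; [exact: dh | rewrite /kerp gh].
exists (fun i => h (z i)); split=> [i|].
  by split=> //; apply: dh; have [] := hz i.
by rewrite Ez linear_sum; apply: eq_bigr => i _; rewrite linearZ_LR.
Qed.

Lemma mp_map j x : mp (kerp f) j x -> mp (kerp g) j (h x).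
Proof.
move=> [z [hz Ez]]; exists (fun i => h (z i)); split=> [i|].
  by have [h1 h2] := hz i; split; [exact: dh | rewrite /kerp gh].
by rewrite Ez linear_sum; apply: eq_bigr => i _; rewrite linearZ_LR.
Qed.
End Abstract.

(** An endomorphism of a cover of M over M acts as the identity on Tor_1: on
    x = \sum_i (w i) (z i) it differs from the identity by \sum_i (w i) (z i - e (z i)),
    and z i - e (z i) is in the kernel. *)
Lemma endo_perturb (X M : gmod k d) (f : {linear X -> M}) (e : X -> X) :
  linear e -> degree0 e -> (forall x, f (e x) = f x) ->
  forall j x, nomin (kerp f) j x -> mp (kerp f) j (x - e x).
Proof.
move=> le de fe j x [_ [z [hz ->]]]; exists (fun i => z i - e (z i)); split=> [i|].
  have [h1 _] := hz i; split; first by apply: gpieceB => //; apply: de.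
  by rewrite /kerp linearB fe subrr.
have e0 : e 0 = 0 by have := le (-1) 0 0; rewrite scaler0 addr0 scaleN1r addNr.
have eD y t : e (y + t) = e y + e t by have := le 1 y t; rewrite !scale1r.
rewrite (big_morph e eD e0) -sumrB; apply: eq_bigr => i _.
by have := le (w i) (z i) 0; rewrite e0 !addr0 => ->; rewrite scalerBr.
Qed.

(** Tor_1, read as (K \cap m X) / m K with K the kernel of a cover X of M, is the
    same for two covers with lifts in both directions. *)
Lemma tor1_compare (X Y M : gmod k d) (f : {linear X -> M}) (g : {linear Y -> M})
    (h : {linear X -> Y}) (h' : {linear Y -> X}) :
  degree0 f -> degree0 g -> degree0 h -> degree0 h' ->
  (forall x, g (h x) = f x) -> (forall y, f (h' y) = g y) ->
  forall j n, has_quot_dim (nomin (kerp f) j) (mp (kerp f) j) n ->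
    has_quot_dim (nomin (kerp g) j) (mp (kerp g) j) n.
Proof.
move=> df dg dh dh' gh fh' j n.
have hKf := gsub_ker df; have hKg := gsub_ker dg.
apply: (qd_map (f := h)).
- exact: linearP.
- exact: mp_subsp.
- by move=> x; apply: nomin_map.
- move=> y hy; exists (h' y); first exact: (nomin_map dh' fh' hy).
  apply: (@endo_perturb Y M g (fun y => h (h' y))) => //.
  - by move=> b s t; rewrite !linearP.
  - by move=> m t ht; apply: dh; apply: dh'.
  by move=> t; rewrite gh fh'.
- move=> x hx; split; last exact: mp_map.
  move=> hm; rewrite -[x](subrK (h' (h x))); apply: subspD; first exact: mp_subsp.
    apply: (@endo_perturb X M f (fun y => h' (h y))) => //.
    - by move=> b s t; rewrite !linearP.
    - by move=> m t ht; apply: dh'; apply: dh.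
    by move=> t; rewrite fh' gh.
  exact: (mp_map dh' fh' hm).
exact: nomin_subsp.
Qed.

(** Free modules are graded projective. *)
Lemma cover_lift (r : nat) (a : 'I_r -> int) (Y M : gmod k d)
    (f : {linear gfree k d_gt0 a -> M}) (g : {linear Y -> M}) :
  degree0 f -> degree0 g -> (forall z, exists y, g y = z) ->
  exists h : {linear gfree k d_gt0 a -> Y}, degree0 h /\ forall x, g (h x) = f x.
Proof.
move=> df dg gs.
have hy i : exists y, gpiece (a i) y /\ g y = f (gbas k d_gt0 a i).
  have [|y h1 h2] := @hp_im _ _ _ _ g dg (a i) (f (gbas k d_gt0 a i)); last by exists y.
  by split; [apply: df; exact: gbas_piece | exact: gs].
have [y /all_and2[y1 y2]] := fin_all_exists hy.
have [h [dh hE]] := free_lift d_gt0 y1; exists h; split=> // x.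
rewrite hE linear_sum {2}(gbas_expand (x : gfree k d_gt0 a)) linear_sum.
by apply: eq_bigr => i _; rewrite !linearZ_LR y2.
Qed.

(** By comparison of dimensions in large degrees: injecting a free module of
    rank r into one of rank r' gives r d N <= r' d N + constant. *)
Lemma free_rank (r r' : nat) (a : 'I_r -> int) (a' : 'I_r' -> int)
    (y : 'I_r -> gfree k d_gt0 a') :
  (forall i, gpiece (a i) (y i)) ->
  (forall f : 'I_r -> B, \sum_i f i *: y i = 0 -> forall i, f i = 0) -> (r <= r')%N.
Proof.
move=> hy hi; have [h [dh hE]] := free_lift d_gt0 hy.
have [lo [D [h0 h1]]] := int_bounds d_gt0 a a'.
have key N : (r * (N * d).+1 <= r' * ((D + N) * d).+1)%N.
  pose n := lo + D%:Z + N%:Z.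
  have hN i : (N * d).+1%:Z <= (n - a i) * d%:Z + 1.
    by have := h0 i; rewrite /n => /andP[_ hh]; nia.
  have -> : (r * (N * d).+1 = #|{: 'I_r * 'I_(N * d).+1}|)%N by rewrite card_prod !card_ord.
  have <- : #|{: {i : 'I_r' | predT i} * 'I_((D + N) * d).+1}| = (r' * ((D + N) * d).+1)%N.
    by rewrite mongen_card cardT size_enum_ord.
  have s0 := subsp0 (gfree k d_gt0 a').
  apply: (steinitz (U := gpiece n) (e := h \o @lowmon k d d_gt0 r a (N * d).+1 n)
    (g := @mongen k d d_gt0 r' a' predT ((D + N) * d).+1 n) s0).
  - move=> p; apply: dh.
    have := gpieceZ (bmon_piece k d `|(n - a p.1)%R|%N p.2) (gbas_piece k d_gt0 a p.1).
    by congr (gpiece _ _); have := h0 p.1; rewrite /n; lia.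
  - move=> c hc; apply: (lowmon_indep hN).
    move: hc; rewrite -lincomb_map; last exact: linearP.
    rewrite hE => /hi h'; apply/ffunP => i; rewrite ffunE; exact: h'.
  apply: inspan_spans => // x hx; apply: mongen_span => // i _.
  by have := h1 i; rewrite /n => /andP[hh _]; nia.
rewrite leqNgt; apply/negP => lt.
have h2 := key (r' * (D * d).+1)%N; set N := (r' * _)%N in h2.
have h3 : (r'.+1 * (N * d).+1 <= r' * ((D + N) * d).+1)%N.
  by apply: leq_trans h2; rewrite leq_mul2r lt orbT.
have h4 : (r' * ((D + N) * d).+1 = r' * (N * d) + N)%N.
  have -> : (((D + N) * d).+1 = N * d + (D * d).+1)%N by rewrite mulnDl; lia.
  by rewrite mulnDr.
move: h3; rewrite h4 mulSn mulnS; nia.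
Qed.
End Compare.

(** * Betti tables of modules with a pure resolution *)
Section PureModules.
Variables (k : fieldType) (d : nat) (d_gt0 : (0 < d)%N).
Local Notation B := (vring k d).
Local Notation kc := (@vconst k d).
Local Notation w := (@w k d).
Local Notation S := {mpoly k[2]}.

Section Shifted.
Variable l : nat.
Hypothesis l_lt_d : (l < d)%N.
Local Notation N := (gvmod k d_gt0 l).

Lemma mval_inj : injective (@mval k d l). Proof. exact: val_inj. Qed.
Lemma mvalD (x y : vmod k d l) : mval (x + y) = mval x + mval y. Proof. by []. Qed.
Lemma mval0 : mval (0 : vmod k d l) = 0. Proof. by []. Qed.
Lemma mvalZ (b : B) (x : vmod k d l) : mval (b *: x) = vval b * mval x. Proof. by []. Qed.
Lemma mval_sum (I : Type) (r : seq I) (P : pred I) (F : I -> vmod k d l) :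
  mval (\sum_(i <- r | P i) F i) = \sum_(i <- r | P i) mval (F i).
Proof. exact: (big_morph _ mvalD mval0). Qed.

Fact mmon_subproof n i : ('X_[m2 (minn i (n * d + l)) (n * d + l - i)] : S) \in in_veronese d l.
Proof.
apply/in_veroneseP => m; rewrite mcoeffX; case: (_ =P m) => [<- _|]; last by rewrite eqxx.
by exists n; rewrite mdeg_m2 m2_0 m2_1; lia.
Qed.
(** The monomial x^i y^(nd+l-i) of M^(l), for i <= nd + l. *)
Definition mmon n i : vmod k d l := VMod (mmon_subproof n i).

Lemma mmonE n i : (i <= n * d + l)%N -> mval (mmon n i) = 'X_[m2 i (n * d + l - i)].
Proof. by move=> h; rewrite /= (minn_idPl h). Qed.

Lemma mmon_piece n i : in_piece d l n%:Z (mval (mmon n i)).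
Proof. by rewrite /= dhomogX /= mdeg_m2 m2_0 m2_1; apply/eqP; lia. Qed.

Lemma mmon_expand n (x : vmod k d l) : in_piece d l n%:Z (mval x) ->
  x = \sum_(i < (n * d + l).+1) kc ((mval x)@_(m2 i (n * d + l - i))) *: mmon n i.
Proof.
move=> /(in_pieceP _ _ l_lt_d) h; apply: mval_inj.
rewrite mval_sum {1}(@hom_expand k (n * d + l) (mval x)); last by move=> m /h; lia.
apply: eq_bigr => i _; rewrite mvalZ mmonE; last by rewrite -ltnS.
by rewrite /= mul_mpolyC.
Qed.

Lemma mmonS n i : (i <= n.+1 * d + l)%N ->
  mmon n.+1 i = w (i - minn i (n * d + l)) *: mmon n (minn i (n * d + l)).
Proof.
move=> hi; apply: mval_inj.
rewrite mvalZ !mmonE ?geq_minr // wE; last by rewrite mulSn in hi; lia.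
rewrite -mpolyXD m2D; congr 'X_[m2 _ _]; rewrite mulSn in hi *; lia.
Qed.

(** M^(l) is generated in degree 0. *)
Lemma vmod_gen j (x : vmod k d l) : in_piece d l j (mval x) -> j <> 0 ->
  exists c : 'I_d.+1 -> vmod k d l, x = \sum_(i < d.+1) w i *: c i.
Proof.
case: j => [[|n]|n] hx //; last first.
  move=> _; exists (fun=> 0); rewrite big1 => [|i _]; last by rewrite scaler0.
  by apply: val_inj; apply/eqP.
move=> _; rewrite -in_mM_w // (mmon_expand hx); apply: subsp_sum => [|i _].
  exact: in_mM_subsp.
apply: subspZ; first exact: in_mM_subsp.
rewrite mmonS; last by rewrite -ltnS.
apply/in_mM_w => //.
have lt : (i - minn i (n * d + l) < d.+1)%N by have := ltn_ord i; move: (nat_of_ord i) => i'; rewrite mulSn; lia.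
exists (fun j => if j == Ordinal lt then mmon n (minn i (n * d + l)) else 0).
by rewrite (bigD1 (Ordinal lt)) //= eqxx big1 ?addr0 // => j /negPf->; rewrite scaler0.
Qed.

Section Sum.
Variables (r : nat) (d1 : int).
Let E := gsum_twist N (fun _ : 'I_r => d1).

Lemma sum_coord (I : Type) (s : seq I) (P : pred I) (G : I -> E) i :
  (\sum_(t <- s | P t) G t) i = \sum_(t <- s | P t) (G t i : vmod k d l).
Proof. exact: sum_ffunE. Qed.

(** The element x in the i-th summand. *)
Definition ebas (i : 'I_r) (x : vmod k d l) : E := [ffun i' => if i' == i then x else 0].

Lemma sum_coordE (c : 'I_r * 'I_l.+1 -> k) i :
  lincomb (fun p : 'I_r * 'I_l.+1 => ebas p.1 (mmon 0 p.2)) c i = \sum_(p < l.+1) kc (c (i, p)) *: mmon 0 p.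
Proof.
rewrite /lincomb sum_coord.
transitivity (\sum_(i' < r) \sum_(p < l.+1) (if i' == i then kc (c (i', p)) *: mmon 0 p else 0)).
  rewrite pair_bigA /=; apply: eq_bigr => -[i' p] _; rewrite !ffunE /= eq_sym.
  by case: eqP => // _; exact: scaler0.
rewrite (bigD1 i) //= [X in _ + X]big1 ?addr0; last first.
  by move=> i' /negPf ne; apply: big1 => p _; rewrite ne.
by apply: eq_bigr => p _; rewrite eqxx.
Qed.

Lemma mmon_indep (c : 'I_l.+1 -> k) : \sum_(p < l.+1) kc (c p) *: mmon 0 p = 0 -> forall p, c p = 0.
Proof.
move=> /(congr1 (@mval k d l)) h p.
have := congr1 (fun q : S => q@_(m2 p (l - p))) h.
have hm (p' : 'I_l.+1) : mval (mmon 0 p') = 'X_[m2 p' (l - p')].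
  by rewrite mmonE mul0n add0n // -ltnS.
rewrite mcoeff0 => <-; rewrite mval_sum mcoeff_sumE (bigD1 p) // mvalZ mul_mpolyC mcoeffZ hm.
rewrite mcoeffX eqxx mulr1 big1 => [|p' ne]; first by rewrite /= addr0.
rewrite mvalZ mul_mpolyC mcoeffZ hm mcoeffX eq_m2 m2_0; case: (_ =P _ :> nat) => [E'|_]; rewrite ?mulr0 //.
by case/eqP: ne; apply: val_inj.
Qed.

(** dim (E / m E)_j, the l + 1 monomials of degree l generating each summand. *)
Lemma shifted_gens j : has_quot_dim (@hp _ _ E allp j) (mp allp j) (r * l.+1 * (j == d1)).
Proof.
have hA := @gsub_all k d E.
case: eqP => [->|ne]; last first.
  rewrite muln0; apply: qd0 => x [hx _].
  have hc i : exists c : 'I_d.+1 -> vmod k d l, x i = \sum_(t < d.+1) w t *: c t.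
    by apply: vmod_gen (hx i) _ => E'; apply: ne; apply/eqP; rewrite -subr_eq0 E'.
  have [c hc'] := fin_all_exists hc.
  apply: (@homog_mp k d E allp j x (fun t => [ffun i => c i t])) => //.
  apply/ffunP => i; rewrite hc' sum_coord; apply: eq_bigr => t _.
  by rewrite !ffunE.
rewrite muln1; have -> : (r * l.+1 = #|{: 'I_r * 'I_l.+1}|)%N by rewrite card_prod !card_ord.
apply: (@qd_fin k d E _ _ _ (fun p : 'I_r * 'I_l.+1 => ebas p.1 (mmon 0 p.2))); split.
- move=> [i p]; split=> // i'; rewrite ffunE subrr; case: eqP => _.
    exact: mmon_piece.
  exact: in_piece0.
- move=> c [z [hz Ez]] [i p]; apply: (@mmon_indep (fun p => c (i, p))).
  rewrite -sum_coordE Ez sum_coord big1 // => t _.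
  have [h _] := hz t; have := h i; have -> : d1 - 1 - d1 = Negz 0 by lia.
  by move=> /eqP h0; rewrite ffunE; have -> : z t i = 0 by [apply: val_inj]; exact: scaler0.
move=> x [hx _]; exists (fun p : 'I_r * 'I_l.+1 => (mval (x p.1))@_(m2 p.2 (l - p.2))).
suff <- : x = lincomb (fun p : 'I_r * 'I_l.+1 => ebas p.1 (mmon 0 p.2)) (fun p : 'I_r * 'I_l.+1 => (mval (x p.1))@_(m2 p.2 (l - p.2))).
  by rewrite subrr; exact: (mp_subsp _ hA).1.
apply/ffunP => i; rewrite sum_coordE.
by have := hx i; rewrite subrr => /(@mmon_expand 0); rewrite mul0n add0n.
Qed.
End Sum.
End Shifted.

(** Minimality gives T(0, _) from the generators of F_0 and T(1, _) from those of
    M^(l)(-d1)^r, by [tor1_compare].  As M is torsion, r = a: a free module of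
    rank r embeds into F_0, and a multiple b F_0 into a free module of rank r.
    Then T(2, _) follows from the numerical constraints of [betti_numerics], in
    which only one value of each of the first three rows is left, and the other
    rows from T(2, _). *)
Lemma pure_betti (M : gmod k d) (d0 d1 : int) (l : nat) (T : btable) :
  (l < d)%N -> no_socle M -> homog_annihilated M -> (exists x : M, x != 0) ->
  pure_resolution d_gt0 M d0 d1 l -> betti_table d_gt0 M T ->
  exists2 a : nat, (0 < a)%N & forall i j, T i j = a%:R * pureT d d0 d1 l i j.
Proof.
move=> ld hs hann [x0 x0_neq0] [a [r [phi [psi [[dphi dpsi] phi_inj exct psi_s minl]]]]].
move=> [beta [R hbeta] hT].
set G := gfree k d_gt0 (fun _ : 'I_a => d0) in phi psi dphi dpsi phi_inj exct psi_s minl.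
set E := gsum_twist _ _ in phi dphi phi_inj exct minl.
have kerE : kerp psi = imp phi by apply: pred_ext => x; exact: exct.
have hI := gsub_im dphi.
have im_mp' j x : hp (imp phi) j x -> mp allp j x.
  move=> hx; have [hx' [y Ey]] := hx; apply/in_mM_mp => //; rewrite -Ey; exact: minl.
have b0 j : beta 0%N j = (a * (j == d0))%N.
  have h0 : has_quot_dim (hp (kerp psi) j) (nomin (kerp psi) j) 0.
    by rewrite kerE; apply: qd0 => x hx; split=> //; apply: im_mp'.
  have hpsi : imp psi = allp by apply: pred_ext => z; split=> // _; exact: psi_s.
  have := dim_gens dpsi h0 (t := beta 0%N j).
  rewrite hpsi => /(_ (tor_zero (hbeta 0%N j))).
  rewrite add0n => <-; rewrite /ngens; case: (j =P d0) => [->|ne].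
    by rewrite muln1 -[RHS]card_ord; apply: eq_card => i; rewrite inE eqxx.
  by rewrite muln0; apply: eq_card0 => i; rewrite inE; apply/eqP => E'; apply: ne.
have b1 j : beta 1%N j = (r * l.+1 * (j == d1))%N.
  have [h [dh hh]] := cover_lift (@res_aug_degree0 _ _ _ _ R) dpsi psi_s.
  have [h' [dh' hh']] := cover_lift dpsi (@res_aug_degree0 _ _ _ _ R) (@res_aug_surj _ _ _ _ R).
  have := tor1_compare (@res_aug_degree0 _ _ _ _ R) dpsi dh dh' hh hh' (tor_succ (hbeta 1%N j)).
  rewrite kerE => q1.
  have q2 : has_quot_dim (hp (imp phi) j) (mp (imp phi) j) (r * l.+1 * (j == d1)).
    apply: (qd_map (f := phi) _ _ _ _ _ _ (shifted_gens ld r d1 j)).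
    - exact: linearP.
    - exact: mp_subsp.
    - by move=> x [hx _]; apply: im_hp.
    - move=> y /(hp_im dphi)[x hx <-]; exists x => //; rewrite subrr; exact: (mp_subsp _ hI).1.
    - move=> x hx; split=> [/(im_mp dphi)[y hy /phi_inj <-]//|]; exact: mp_im.
    exact/hp_subsp/gsub_all.
  apply: (qd_uniq (mp_subsp j hI) _ q2); apply: qd_ext q1 => // x.
  by split=> [[]|hx] //; split=> //; exact: im_mp'.
have phiD (m : nat) (b : 'I_m -> B) (e : 'I_m -> E) :
    phi (\sum_i b i *: e i) = \sum_i b i *: phi (e i).
  by rewrite linear_sum; apply: eq_bigr => i _; rewrite linearZ_LR.
have hra : (r <= a)%N.
  apply: (@free_rank k d d_gt0 r a (fun=> d1) (fun=> d0) (fun i => phi (ebas d1 i (mmon ld 0 0)))).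
    move=> i; apply: dphi => i'; rewrite ffunE subrr; case: eqP => _; last exact: in_piece0.
    exact: mmon_piece.
  move=> f; rewrite -phiD -(linear0 phi) => /phi_inj hf i.
  have := congr1 (fun e : E => e i) hf; rewrite sum_coord (bigD1 i) //= big1; last first.
    by move=> i' ne; rewrite !ffunE eq_sym (negPf ne); exact: scaler0.
  rewrite !ffunE eqxx addr0 => /(congr1 (@mval k d l)); rewrite mvalZ mval0 => /eqP.
  rewrite mulf_eq0 => /orP[/eqP h|/eqP/(congr1 (fun q : S => q@_(m2 0 l)))].
    exact: val_inj.
  by rewrite mmonE // mul0n add0n subn0 mcoeffX eqxx mcoeff0 => /eqP; rewrite oner_eq0.
(* b F_0 lies in M^(l)(-d1)^r, and y^(d-l) M^(l) lies in B(1) *)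
have har : (a <= r)%N.
  have [b [n [bn0 hb bM]]] := hann.
  have hy (i : 'I_a) : exists y : E, gpiece (n%:Z + d0) y /\ phi y = b *: gbas k d_gt0 (fun _ : 'I_a => d0) i.
    have hbas := gbas_piece k d_gt0 (fun _ : 'I_a => d0) i.
    have [|y h1 h2] := @hp_im _ _ _ _ phi dphi (n%:Z + d0) (b *: gbas k d_gt0 (fun _ : 'I_a => d0) i);
      last by exists y.
    split; first exact: gpieceZ.
    by apply/exct; rewrite linearZ_LR bM.
  have [y /all_and2[y1 y2]] := fin_all_exists hy.
  have hyB (x : vmod k d l) : 'X_[m2 0 (d - l)] * mval x \in in_vring d.
    have /in_veroneseP hx := valP x.
    apply/in_veroneseP => m /mcoeffXM_supp[m' -> /hx[t Et]]; exists t.+1.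
    by rewrite mdegD mdeg_m2 m2_0 m2_1 Et mulSn; lia.
  pose z (i : 'I_a) : gfree k d_gt0 (fun _ : 'I_r => d1 - 1) := [ffun t => VRing (hyB (y i t))].
  apply: (@free_rank k d d_gt0 a r (fun=> n%:Z + d0) (fun=> d1 - 1) z).
    move=> i t; have /(in_pieceP _ _ ld) hx := y1 i t.
    rewrite ffunE; apply/in_pieceP => // m /= /mcoeffXM_supp[m' -> /hx Et].
    rewrite mdegD mdeg_m2 m2_0 m2_1; have := Et; nia.
  move=> f hf.
  have hsum : \sum_i f i *: y i = 0.
    apply/ffunP => t; rewrite sum_coord ffunE; apply: val_inj; apply: (@mulX_inj k (m2 0 (d - l))).
    have := congr1 (fun e : gfree k d_gt0 (fun _ : 'I_r => d1 - 1) => vval (e t)) hf.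
    rewrite free_sumE vval_sum /= ffunE => hf'; rewrite -[RHS]hf'.
    change ('X_[m2 0 (d - l)] * mval (\sum_(i < a) (f i *: y i) t) = \sum_(i < a) vval ((f i *: z i) t)).
    rewrite mval_sum mulr_sumr; apply: eq_bigr => i _.
    by rewrite !ffunE [in RHS]/= mulrCA.
  have : \sum_i f i *: (b *: gbas k d_gt0 (fun _ : 'I_a => d0) i) = 0.
    have h0 : \sum_i f i *: phi (y i) = 0 by rewrite -phiD hsum linear0.
    by rewrite -[RHS]h0; apply: eq_bigr => i _; rewrite y2.
  move=> h i.
  have : b *: (\sum_i f i *: gbas k d_gt0 (fun _ : 'I_a => d0) i) = 0.
    rewrite -[RHS]h scaler_sumr; apply: eq_bigr => i' _.
    by rewrite !scalerA mulrC.
  move=> /(free_torsionfree bn0)/(congr1 (fun g : G => g i)).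
  rewrite free_sumE (bigD1 i) //= big1; last first.
    by move=> i' ne; rewrite !ffunE eq_sym (negPf ne) [_ *: _]mulr0.
  by rewrite !ffunE eqxx addr0 [_ *: _]mulr1.
have Ear : r = a by apply/eqP; rewrite eqn_leq hra har.
subst r.
have [lo [D0 [N1 N2 N5 N3 N4]]] := betti_numerics hs hann hbeta.
have a_gt0 : (0 < a)%N.
  case: (posnP a) => // a0; case/eqP: x0_neq0; have [y <-] := psi_s x0.
  suff -> : y = 0 by rewrite linear0.
  by apply/ffunP => i; have := ltn_ord i; lia.
have inD (j : int) : beta 0%N j <> 0%N \/ beta 1%N j <> 0%N -> exists2 J : 'I_D0, True & j = lo + J%:Z.
  move=> hj; have h : ~~ ((j < lo) || (lo + D0%:Z <= j)).
    by apply/negP => /N5[e0 e1]; case: hj.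
  have lt : (`|(j - lo)%R| < D0)%N by lia.
  by exists (Ordinal lt) => //=; lia.
have [J0 _ EJ0] : exists2 J : 'I_D0, True & d0 = lo + J%:Z.
  by apply: inD; left; rewrite b0 eqxx; lia.
have [J1 _ EJ1] : exists2 J : 'I_D0, True & d1 = lo + J%:Z.
  by apply: inD; right; rewrite b1 eqxx; lia.
have b2z (j : int) : j != d1 -> beta 2%N (j + 1) = 0%N.
  by move=> /negPf ne; have := N2 j; rewrite b1 ne !muln0 leqn0 => /eqP.
have pick D (F : int -> nat) (J : 'I_D0) : (D0 <= D)%N ->
    (forall j : int, j != lo + J%:Z -> F j = 0%N) ->
    (\sum_(J' < D) F (lo + J'%:Z)%R = F (lo + J%:Z)%R)%N.
  move=> hD hF; have lt : (J < D)%N by have := ltn_ord J; lia.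
  rewrite (bigD1 (Ordinal lt)) //= big1 ?addn0 // => J' ne; apply: hF.
  apply: contra ne => /eqP E'; apply/eqP; apply: val_inj => /=; lia.
have b2 : beta 2%N (d1 + 1) = (d * (a * l))%N.
  have s0 D : (D0 <= D)%N -> (\sum_(J < D) beta 0%N (lo + J%:Z)%R = a)%N.
    move=> hD; rewrite (pick D (beta 0%N) J0 hD) -?EJ0 ?b0 ?eqxx ?muln1 // => j /negPf ne.
    by rewrite b0 ne muln0.
  have s1 D : (D0 <= D)%N -> (\sum_(J < D) beta 1%N (lo + J%:Z)%R = a * l.+1)%N.
    move=> hD; rewrite (pick D (beta 1%N) J1 hD) -?EJ1 ?b1 ?eqxx ?muln1 // => j /negPf ne.
    by rewrite b1 ne muln0.
  have s2 D : (D0 <= D)%N -> (\sum_(J < D) beta 2%N (lo + J%:Z + 1)%R = beta 2%N (d1 + 1)%R)%N.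
    by move=> hD; rewrite (pick D (fun j => beta 2%N (j + 1)%R) J1 hD) -?EJ1.
  have := N4 D0 (leqnn _); have := N3 D0; rewrite !s0 // !s1 // !s2 //; lia.
exists a => // i j; rewrite hT.
case: i => [|[|i]]; rewrite /pureT.
- by rewrite b0 natrM.
- by rewrite b1 -mulnA natrM.
have -> : beta i.+2 j = (d.-1 ^ i * beta 2%N (j - i%:Z)%R)%N.
  elim: i j => [|i IHi] j; first by rewrite mul1n subr0.
  by rewrite -{1}(subrK 1 j) N1 IHi expnS mulnA; congr (_ * beta 2%N _)%N; lia.
rewrite -natrM; congr (_%:R).
have -> : (j - i%:Z) = (j - i.+1%:Z) + 1 by lia.
case: (j =P d1 + i.+1%:Z) => [->|ne].
  by rewrite addrK b2 /=; lia.
rewrite b2z ?muln0 //; apply/eqP => E'; apply: ne; lia.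
Qed.
End PureModules.

(** * The ideals x^(m+1) S \cap B and their quotients *)
Local Open Scope quotient_scope.

Section QuotientModule.
Variables (k : fieldType) (d : nat).
Local Notation B := (vring k d).

Section Def.
Variable m : nat.
(** x^(m+1) S \cap B; the exponent is positive, so that the ideal is proper and
    the quotient is a ring with 1 <> 0. *)
Definition xpow : {pred B} := fun b => xdiv m.+1 (vval b).

Lemma xpow_closed : idealr_closed xpow.
Proof.
split=> [||a b c]; rewrite ?unfold_in /xpow ?xdiv_one //; first exact: xdiv0.
exact: xdiv_ideal.
Qed.
HB.instance Definition _ := isIdealr.Build B xpow xpow_closed.

Definition qmod : Type := {ideal_quot xpow}.
HB.instance Definition _ := GRing.ComNzRing.on qmod.
Definition pim (b : B) : qmod := \pi_({ideal_quot xpow}) b.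

Lemma pimD a b : pim (a + b) = pim a + pim b. Proof. by rewrite /pim !piE. Qed.
Lemma pimM a b : pim (a * b) = pim a * pim b. Proof. by rewrite /pim !piE. Qed.
Lemma pim1 : pim 1 = 1. Proof. by rewrite /pim !piE. Qed.
Lemma pim0 : pim 0 = 0. Proof. by rewrite /pim !piE. Qed.
Lemma pimP (x : qmod) : exists b, x = pim b.
Proof. by exists (repr x); rewrite /pim reprK. Qed.
Lemma pim_eq0 b : pim b = 0 <-> xpow b.
Proof.
rewrite -pim0 /pim; split=> [/eqP|h]; first by rewrite -Quotient.idealrBE subr0.
by apply/eqP; rewrite -Quotient.idealrBE subr0.
Qed.

(** B acts through the quotient map. *)
Definition qscale (b : B) (x : qmod) : qmod := pim b * x.
Fact qscaleA b c x : qscale b (qscale c x) = qscale (b * c) x.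
Proof. by rewrite /qscale pimM mulrA. Qed.
Fact qscale1 : left_id 1 qscale.
Proof. by move=> x; rewrite /qscale pim1 mul1r. Qed.
Fact qscaleDr : right_distributive qscale +%R.
Proof. by move=> b x y; rewrite /qscale mulrDr. Qed.
Fact qscaleDl x : {morph (fun b => qscale b x) : b c / b + c}.
Proof. by move=> b c; rewrite /qscale pimD mulrDl. Qed.
HB.instance Definition _ := GRing.Zmodule_isLmodule.Build B qmod qscaleA qscale1 qscaleDr qscaleDl.

Lemma pimZ b c : pim (b * c) = b *: pim c. Proof. exact: pimM. Qed.
End Def.
End QuotientModule.

Section QuotientGraded.
Variables (k : fieldType) (d : nat) (d_gt0 : (0 < d)%N).
Local Notation B := (vring k d).
Local Notation S := {mpoly k[2]}.

Section Graded.
Variables (m : nat) (d0 : int).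
Local Notation Q := (qmod k d m).
Local Notation pim := (@pim k d m).

Definition qpiece (n : int) (x : Q) : Prop :=
  exists b, in_piece d 0 (n - d0) (vval b) /\ x = pim b.

Lemma pim_sum (I : Type) (r : seq I) (P : pred I) (F : I -> B) :
  pim (\sum_(i <- r | P i) F i) = \sum_(i <- r | P i) pim (F i).
Proof. exact: (big_morph _ (@pimD k d m) (@pim0 k d m)). Qed.

(** B / (x^(m+1) S \cap B) with its generator in degree d0. *)
Definition gqmod : gmod k d.
Proof.
refine (@GMod k d Q qpiece _ _ _ _ _).
- by move=> n; exists 0; split; [exact: in_piece0 | rewrite pim0].
- move=> n _ _ [b [hb ->]] [c [hc ->]]; exists (b + c); split; last by rewrite pimD.
  exact: in_pieceD.
- move=> a n b _ hb [c [hc ->]]; exists (b * c); split; last by rewrite pimZ.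
  by rewrite -addrA; apply: in_pieceM.
- move=> x; have [b ->] := pimP x.
  have [L _ EL] := @gpr_span k d (greg k d_gt0) b.
  exists [seq (n + d0, pim (gpr n (b : greg k d_gt0))) | n <- L]; split.
    move=> p /mapP[n _ ->] /=; exists (gpr n (b : greg k d_gt0)); split=> //.
    by rewrite addrK; exact: (@gpr_piece k d (greg k d_gt0)).
  by rewrite big_map /= {1}EL pim_sum.
move=> s c us hc s0 n sn.
pose f n := proj1_sig (constructive_indefinite_description _ (hc n)).
have fP n' : in_piece d 0 (n' - d0) (vval (f n')) /\ c n' = pim (f n').
  by rewrite /f; case: constructive_indefinite_description.
have [_ ->] := fP n; apply/pim_eq0/xdivP => e he.
have : pim (\sum_(i <- s) f i) = 0.
  by rewrite pim_sum -[RHS]s0; apply: eq_bigr => i _; have [_ ->] := fP i.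
move=> /pim_eq0/xdivP; apply; rewrite vval_sum mcoeff_sumE (bigD1_seq n) //= big1 ?addr0 //.
move=> i ne; apply/eqP; apply: contraNT ne => hi.
have [/(in_pieceP _ _ d_gt0) h1 _] := fP n; have [/(in_pieceP _ _ d_gt0) h2 _] := fP i.
by have := h1 e he; have := h2 e hi => -> E; apply/eqP; nia.
Defined.

Lemma gqmod_fin_gen : fin_gen gqmod.
Proof.
exists 1%N, (fun=> pim 1 : gqmod) => x; have [b ->] := pimP x.
by exists (fun=> b); rewrite big_ord1 -{1}[b]mulr1 pimZ.
Qed.
End Graded.

Lemma xdiv_mulX m (p : S) : xdiv m ('X_[m2 m 0] * p).
Proof. by rewrite -[m]addn0; apply: xdivM; [apply/xdivP => e; rewrite mcoeffX; case: (_ =P e) => [<-|]; rewrite ?eqxx // addn0 m2_0 | exact: xdiv0p]. Qed.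

(** An element of x^(nd-l) S in B is x^(nd-l) times an element of S whose degrees
    are l modulo d, so multiplication by x^(nd-l) identifies M^(l)(-n) with the
    ideal. *)
Lemma quotient_pure (m n l : nat) (d0 d1 : int) : (l < d)%N -> (m.+1 = n * d - l)%N ->
  (0 < n)%N -> d1 = d0 + n%:Z -> pure_resolution d_gt0 (gqmod m d0) d0 d1 l.
Proof.
move=> ld Em n0 Ed1; pose M := gqmod m d0.
pose G := gfree k d_gt0 (fun _ : 'I_1 => d0).
pose E := gsum_twist (gvmod k d_gt0 l) (fun _ : 'I_1 => d1).
have nd : (d <= n * d)%N by rewrite leq_pmull.
have hin (x : vmod k d l) : 'X_[m2 m.+1 0] * mval x \in in_vring d.
  have /in_veroneseP hx := valP x.
  apply/in_veroneseP => e /mcoeffXM_supp[e' -> /hx[t Et]]; exists (t + n)%N.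
  by rewrite mdegD mdeg_m2 m2_0 m2_1 Et mulnDl; lia.
pose phi (e : E) : G := [ffun _ => VRing (hin (e ord0))].
have lphi : linear phi.
  move=> b e e'; apply/ffunP => i; rewrite !ffunE; apply: val_inj.
  by rewrite /= ?ffunE /= mulrDr mulrCA.
pose psi (f : G) : M := pim m (f ord0).
have lpsi : linear psi by move=> b f g; rewrite /psi !ffunE pimD pimZ.
pose phiL : {linear E -> G} := HB.pack phi (GRing.isLinear.Build B E G *:%R phi lphi).
pose psiL : {linear G -> M} := HB.pack psi (GRing.isLinear.Build B G M *:%R psi lpsi).
exists 1%N, 1%N, phiL, psiL; split.
- split=> [j e he|j f hf]; last by exists (f ord0); split=> //; exact: hf.
  move=> i; have /(in_pieceP _ _ ld) hx := he ord0.
  rewrite ffunE; apply/in_pieceP => // t /= /mcoeffXM_supp[t' -> /hx Et'].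
  by rewrite mdegD mdeg_m2 m2_0 m2_1; have := Et'; nia.
- move=> e e' h; apply/ffunP => i; rewrite ord1; apply: val_inj.
  have := congr1 (fun g : G => vval (g ord0)) h; rewrite !ffunE /= => h'.
  apply/eqP; rewrite -subr_eq0; apply/eqP; apply: (@mulX_inj k (m2 m.+1 0)).
  by rewrite mulrBr h' subrr.
- move=> f; split=> [/pim_eq0/xdivP h|[e <-]]; last first.
    by apply/pim_eq0; rewrite ffunE; exact: xdiv_mulX.
  have [q Eq] : exists q, vval (f ord0) = 'X_[m2 m.+1 0] * q.
    apply: mpoly_divX => e /h he; apply/mnm_lepP => i; rewrite mnmE.
    by case: eqP => // ->.
  have hq : q \in in_veronese d l.
    apply/in_veroneseP => e; rewrite -(mcoeffXM (m2 m.+1 0)) -Eq => he.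
    have /in_veroneseP/(_ _ he)[t] := vvalP (f ord0).
    rewrite mdegD mdeg_m2 m2_0 m2_1 => Et; exists (t - n)%N.
    have nt : (n <= t)%N.
      rewrite leqNgt; apply/negP => lt.
      have : (t * d + d <= n * d)%N by rewrite -mulSnr leq_mul2r lt orbT.
      by lia.
    by rewrite mulnBl; have := leq_mul nt (leqnn d); lia.
  exists [ffun _ => VMod hq]; apply/ffunP => i; rewrite ord1 !ffunE; apply: val_inj.
  by rewrite /= ?ffunE /= Eq.
- by move=> x; have [b ->] := pimP x; exists [ffun _ => b]; rewrite /= /psi ffunE.
move=> e; exists 1%N, (fun=> VRing (hin (e ord0))), (fun=> gbas k d_gt0 (fun _ : 'I_1 => d0) ord0).
split=> [_|].
  rewrite /irrelevant /=; apply: mcoeffXM_notle; apply/mnm_lepP => /(_ ord0).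
  by rewrite m2_0 mnm0E.
rewrite big_ord1; apply/ffunP => i; rewrite ord1 !ffunE eqxx; apply: val_inj.
by rewrite /= mulr1.
Qed.

End QuotientGraded.

(** * The quotients are Cohen-Macaulay of depth one *)
(** In the Artinian ring k[t] / (f), the descending chain of ideals (g^N) becomes
    stationary; the induction divides f by gcd(f, g). *)
Lemma poly_power_comaximal (k : fieldType) (f g : {poly k}) : f != 0 ->
  exists (N : nat) (a c : {poly k}), g ^+ N = g ^+ N.+1 * a + f * c.
Proof.
have [n] := ubnP (size f); elim: n f => // n IH f; rewrite ltnS => hn f0.
have [/Bezout_eq1_coprimepP[[a c] /= E]|hc] := boolP (coprimep f g).
  by exists 0%N, c, a; rewrite expr0 expr1 -E; ring.
pose h := gcdp f g; have h0 : h != 0 by rewrite gcdp_eq0 negb_and f0.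
have [f' Ef] := dvdpP _ _ (dvdp_gcdl f g); have [g' Eg] := dvdpP _ _ (dvdp_gcdr f g).
have f'0 : f' != 0 by apply: contraNneq f0 => E; rewrite Ef E mul0r.
have sz : (size f' < size f)%N.
  rewrite [in ltnRHS]Ef size_mul // -/h; move: hc; rewrite /coprimep -/h.
  have : (0 < size h)%N by rewrite size_poly_gt0.
  by case: (size h) => [|[|s]] // _ _; rewrite !addnS /= ltnS leq_addr.
have [|N [a [c E]]] := IH f' _ f'0; first exact: leq_trans sz hn.
exists N.+1, a, (g' * c).
have X : g * (f' * c) = f * (g' * c) by rewrite {1}Eg [in RHS]Ef -/h; ring.
by rewrite exprS {1}E mulrDr X mulrA -exprS.
Qed.

(** A nonzero prime ideal P1 of k[t] is maximal: its element f of least degree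
    is coprime to any g outside P1, so that 1 would be in P2. *)
Lemma poly_prime_chain (k : fieldType) (P1 P2 : {poly k} -> Prop) :
  (forall a b c, P1 b -> P1 c -> P1 (a * b + c)) -> (forall a b, P1 (a * b) -> P1 a \/ P1 b) ->
  P1 0 -> (forall a b c, P2 b -> P2 c -> P2 (a * b + c)) -> P2 0 -> ~ P2 1 ->
  (forall a, P1 a -> P2 a) -> (exists2 f, f != 0 & P1 f) -> forall g, P2 g -> P1 g.
Proof.
move=> i1 p1 z1 i2 z2 n2 h12 [f0 f0n Pf0] g P2g; apply: NNPP => nP1g.
have [f [fn Pf fmin]] : exists f, [/\ f != 0, P1 f & forall f', f' != 0 -> P1 f' -> (size f <= size f')%N].
  have [n] := ubnP (size f0); elim: n f0 f0n Pf0 => // n IH f fn Pf; rewrite ltnS => hn.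
  have [[f' [f'n Pf' lt]]|h] := classic (exists f', [/\ f' != 0, P1 f' & (size f' < size f)%N]).
    by apply: (IH f') => //; apply: leq_trans hn.
  exists f; split=> // f' f'n Pf'; rewrite leqNgt; apply/negP => lt; apply: h; by exists f'.
have m1 a b : P1 b -> P1 (a * b) by move=> hb; rewrite -[_ * _]addr0; apply: i1.
have m2 a b : P2 b -> P2 (a * b) by move=> hb; rewrite -[_ * _]addr0; apply: i2.
pose h := gcdp f g; have h0 : h != 0 by rewrite gcdp_eq0 negb_and fn.
have [f' Ef] := dvdpP _ _ (dvdp_gcdl f g); have [g' Eg] := dvdpP _ _ (dvdp_gcdr f g).
have f'n : f' != 0 by apply: contraNneq fn => E; rewrite Ef E mul0r.
have [Pf'|Ph] : P1 f' \/ P1 h by apply: p1; rewrite -Ef.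
  have := fmin f' f'n Pf'; rewrite [in leqLHS]Ef -/h size_mul // => hs.
  have hh : (0 < size h)%N by rewrite size_poly_gt0.
  have hf : (0 < size f')%N by rewrite size_poly_gt0.
  have cop : coprimep f g.
    rewrite /coprimep -/h; apply/eqP; move: hs hh hf.
    by move: (size h) (size f') => x y; lia.
  have [[a c] /= E] := Bezout_eq1_coprimepP _ _ cop.
  apply: n2; rewrite -E; apply: i2; first exact: h12.
  exact: m2.
by apply: nP1g; rewrite Eg; apply: m1.
Qed.

Section QuotientCM.
Variables (k : fieldType) (d : nat) (d_gt0 : (0 < d)%N).
Local Notation B := (vring k d).
Local Notation kc := (@vconst k d).
Local Notation v := (@v k d).
Local Notation xI := (@x_ideal k d).

(** The map k[t] -> B, t |-> y^d, whose composite with B -> B / (x S \cap B) is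
    onto. *)
Definition sig (p : {poly k}) : B := (map_poly kc p).[v].
Lemma sigD p q : sig (p + q) = sig p + sig q. Proof. by rewrite /sig rmorphD hornerD. Qed.
Lemma sigM p q : sig (p * q) = sig p * sig q. Proof. by rewrite /sig rmorphM hornerM. Qed.
Lemma sig1 : sig 1 = 1. Proof. by rewrite /sig rmorph1 hornerC. Qed.
Lemma sig0 : sig 0 = 0. Proof. by rewrite /sig rmorph0 horner0. Qed.
Lemma sigX p n : sig (p ^+ n) = sig p ^+ n.
Proof. by elim: n => [|n IH]; rewrite ?expr0 ?sig1 // !exprS sigM IH. Qed.

Lemma xI0 : xI 0. Proof. exact: xdiv0. Qed.
Lemma xIM a b : xI b -> xI (a * b).
Proof. by move=> h; rewrite -[_ * _]addr0; apply: xdiv_ideal => //; exact: xdiv0. Qed.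
Lemma xID a b : xI a -> xI b -> xI (a + b).
Proof. exact: xdivD. Qed.
Lemma xIB a b : xI a -> xI b -> xI (a - b).
Proof. by move=> ha hb; apply: xID => //; rewrite -mulN1r; apply: xIM. Qed.

Lemma bmon_v n : bmon k d n 0 = v ^+ n.
Proof. by elim: n => [|n IH]; rewrite ?bmon00 // exprS -IH /v /w bmonM. Qed.

(** Modulo x only the powers of y^d survive. *)
Lemma sig_mod (b : B) : exists p, xI (b - sig p).
Proof.
have sD x y : (exists p, xI (x - sig p)) -> (exists p, xI (y - sig p)) -> exists p, xI (x + y - sig p).
  move=> [p hp] [q hq]; exists (p + q); rewrite sigD opprD addrACA; exact: xID.
have s0 : exists p, xI (0 - sig p) by exists 0; rewrite sig0 subr0; exact: xI0.
have [L _ ->] := @gpr_span k d (greg k d_gt0) b.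
elim/big_ind: _ => // n _; have := @gpr_piece k d (greg k d_gt0) n b.
move: (@gpr k d (greg k d_gt0) n b) => y; case: n => [n|n] hy; last first.
  by have -> : y = 0 by apply: val_inj; apply/eqP.
rewrite (piece_expand d_gt0 hy); elim/big_ind: _ => // i _.
case: (posnP i) => [->|i0].
  exists (((vval y)@_(m2 0 (n * d - 0)))%:P * 'X^n).
  rewrite bmon_v sigM sigX /sig map_polyC hornerC map_polyX hornerX subrr; exact: xI0.
exists 0; rewrite sig0 subr0; apply: xIM; apply/xdivP => e.
rewrite bmonE; last by rewrite -ltnS.
by rewrite mcoeffX; case: (_ =P e) => [<- _|]; rewrite ?eqxx // m2_0.
Qed.

Section Prime.
Variable p : {pred B}.
Hypotheses (hI : idealr_closed p) (hP : prime_idealr_closed p) (hx : forall b, xI b -> b \in p).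

Lemma ideal_D a b : a \in p -> b \in p -> a + b \in p.
Proof. by case: hI => _ _ h ha hb; rewrite -[a]mul1r; apply: h. Qed.
Lemma ideal_M a b : b \in p -> a * b \in p.
Proof. by case: hI => h0 _ h hb; rewrite -[_ * _]addr0; apply: h. Qed.
Lemma ideal_N b : b \in p -> - b \in p.
Proof. by rewrite -mulN1r; apply: ideal_M. Qed.
Lemma ideal_X b n : b ^+ n \in p -> b \in p.
Proof.
case: hI => _ h1 _; elim: n => [|n IH]; first by rewrite expr0 (negPf h1).
by rewrite exprS => /hP/orP[].
Qed.
(** A prime p containing x S \cap B is determined by its preimage in k[t]. *)
Lemma ideal_sig b q : xI (b - sig q) -> (b \in p) = (sig q \in p).
Proof.
move=> /hx h; apply/idP/idP => hb.
  by rewrite -[sig q](subKr b); apply: ideal_D => //; exact: ideal_N.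
by rewrite -(subrK (sig q) b); apply: ideal_D.
Qed.
End Prime.

Section Quot.
Variables (m : nat) (d0 : int).
Let M := gqmod k d_gt0 m d0.
Let pim : B -> M := @pim k d m.

Lemma pimB a b : pim (a - b) = pim a - pim b.
Proof. by apply/eqP; rewrite eq_sym subr_eq -[_ + _]pimD subrK. Qed.

Lemma q_ann b : annihilates M b <-> xpow m b.
Proof.
split=> [h|hb x]; first by apply/pim_eq0; rewrite -[b]mulr1 pimZ; apply: h.
have [c ->] := pimP x; rewrite -pimZ; apply/pim_eq0; rewrite /xpow mulrC vvalM.
by rewrite -[m.+1]add0n; apply: xdivM => //; exact: xdiv0p.
Qed.

(** The ideals x S \cap B and x^(m+1) S \cap B have the same radical. *)
Lemma xI_pow b : xI b -> xpow m (b ^+ m.+1).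
Proof.
rewrite /xI /xpow => h.
have -> : vval (b ^+ m.+1) = vval b ^+ m.+1.
  by elim: (m.+1) => [|n IH] //; rewrite !exprS vvalM IH.
by rewrite -[m.+1 in X in xdiv X]muln1; apply: xdivX.
Qed.

Lemma xpow_xI b : xpow m b -> xI b.
Proof. by move=> /xdivP h; apply/xdivP => e /h; apply: leq_trans. Qed.

(** The chain x S \cap B < m shows that the dimension is at least 1.  Primes
    containing the annihilator contain x S \cap B, so they come from primes of
    k[t], and a chain of three is excluded by [poly_prime_chain]. *)
Lemma q_dim : has_dim M 1.
Proof.
split.
  exists (fun i => if i is 0 then xI else @max_ideal k d); split.
  - by move=> [|[|i]] // _; [exact: x_idealP | exact: max_idealP].
  - by move=> b /q_ann /xpow_xI.
  case=> [|//] _; split.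
    move=> b; rewrite !unfold_in /x_ideal /max_ideal => /xdivP h.
    by apply/eqP/eqP/negPn/negP => /h; rewrite mnm0E.
  move=> /(_ v (max_v k d_gt0)); rewrite unfold_in; apply/negP; exact: x_idealNv.
move=> n p [hp hann hch]; rewrite leqNgt; apply/negP => n2.
have n1 : (1 <= n)%N := ltnW n2.
have [[i0 q0] [i1 q1] [i2 q2]] := (And3 (hp 0%N (leq0n n)) (hp 1%N n1) (hp 2 n2)).
have [s01 n01] := hch 0%N n1; have [s12 n12] := hch 1%N n2.
have x0 b : xI b -> b \in p 0%N.
  by move=> /xI_pow hb; apply: (ideal_X i0 q0 (n := m.+1)); apply: hann; apply/q_ann.
have x1 b : xI b -> b \in p 1%N by move=> /x0/s01.
have x2 b : xI b -> b \in p 2 by move=> /x1/s12.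
apply: n12 => b hb; have [g hg] := sig_mod b.
rewrite (ideal_sig i1 x1 hg); rewrite (ideal_sig i2 x2 hg) in hb.
apply: (@poly_prime_chain k (fun f => sig f \in p 1%N) (fun f => sig f \in p 2)) => //.
- by move=> a c e hc he; rewrite sigD sigM; apply: (ideal_D i1) => //; apply: (ideal_M i1).
- by move=> a c; rewrite sigM => /q1/orP.
- by rewrite sig0; case: i1.
- by move=> a c e hc he; rewrite sigD sigM; apply: (ideal_D i2) => //; apply: (ideal_M i2).
- by rewrite sig0; case: i2.
- by rewrite sig1; case: i2 => _ /negP.
- by move=> a /s12.
apply: NNPP => hn; apply: n01 => c hc; have [f hf] := sig_mod c.
rewrite (ideal_sig i0 x0 hf); rewrite (ideal_sig i1 x1 hf) in hc.
have [->|f0] := eqVneq f 0; first by rewrite sig0; case: i0.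
by case: hn; exists f.
Qed.

Lemma in_seqM0 (N : lmodType B) (x : N) : in_seqM [::] x <-> x = 0.
Proof.
by split=> [[y ->]|->]; [rewrite big_ord0 | exists (fun=> 0); rewrite big_ord0].
Qed.
Lemma in_seqM1 (N : lmodType B) b (x : N) : in_seqM [:: b] x <-> exists y, x = b *: y.
Proof.
split=> [[y ->]|[y ->]]; first by exists (y ord0); rewrite big_ord1.
by exists (fun=> y); rewrite big_ord1.
Qed.
Lemma in_seqM2 (N : lmodType B) b1 b2 bs (y1 y2 : N) :
  in_seqM (b1 :: b2 :: bs) (b1 *: y1 + b2 *: y2).
Proof.
exists (fun i => if i == 0%N :> nat then y1 else if i == 1%N :> nat then y2 else 0).
rewrite !big_ord_recl /= big1 ?addr0 // => i _.
by rewrite scaler0.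
Qed.

Lemma q_one : pim 1 <> 0.
Proof. by move=> /pim_eq0; rewrite /xpow xdiv_one. Qed.

Lemma pow_regular (b1 b2 : B) n (x : M) :
  (forall x : M, in_seqM [:: b1] (b2 *: x) -> in_seqM [:: b1] x) ->
  in_seqM [:: b1] (b2 ^+ n *: x) -> in_seqM [:: b1] x.
Proof.
move=> h; elim: n x => [|n IH] x; first by rewrite expr0 scale1r.
by rewrite exprS -scalerA => /h; apply: IH.
Qed.

(** v = y^d is regular on S / x^(m+1) S, hence on B / (x^(m+1) S \cap B).  Let
    b1, b2 be a longer regular sequence, congruent to f(y^d) and g(y^d) modulo x.
    Then f <> 0, since otherwise b1 is nilpotent on M.  From
    g^N = g^(N+1) a + f c it follows that b2^N D - c b1, with D = 1 - b2 a, is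
    nilpotent on M, so that a power of b2^N D maps M into b1 M.  As b2 is regular on
    M / b1 M, a power of D alone does.  But D is 1 modulo b2, hence
    M = b1 M + b2 M, against the definition of a regular sequence. *)
Lemma q_depth : has_depth M 1.
Proof.
split.
  exists [:: v] => //; split.
  - by move=> b; rewrite inE => /eqP->; apply/eqP; exact: max_v.
  - case=> // _ x; rewrite /= !in_seqM0; have [b ->] := pimP x.
    rewrite -pimZ => /pim_eq0/xdivP h; apply/pim_eq0/xdivP => e he.
    have := h (m2 0 d + e)%MM; rewrite vvalM vval_v mcoeffXM mnmDE m2_0 => /(_ he).
    by [].
  move=> /(_ (pim 1))/in_seqM1[y Ey]; have [c Ec] := pimP y.
  have E1 : pim (v * c) = v *: y by rewrite Ec; exact: pimZ.
  have : pim (1 - v * c) = 0 by rewrite pimB E1 -Ey subrr.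
  move=> /pim_eq0/xdivP/(_ 0%MM); rewrite mnm0E => h.
  suff /h : (vval (1 - v * c))@_0%MM != 0 by [].
  change ((1 - vval v * vval c)@_0%MM != 0).
  have /eqP hv := max_v k d_gt0.
  by rewrite mcoeffB mcoeff1 eqxx mcoeff0M hv mul0r subr0 oner_eq0.
move=> [|b1 [|b2 bs]] // [hirr hr hn]; exfalso.
have inj1 (x : M) : b1 *: x = 0 -> x = 0.
  by move=> E; apply/in_seqM0; apply: (hr 0%N) => //; apply/in_seqM0.
have reg2 (x : M) : in_seqM [:: b1] (b2 *: x) -> in_seqM [:: b1] x by apply: (hr 1%N).
have [f hf] := sig_mod b1; have [g hg] := sig_mod b2.
have f0 : f != 0.
  apply/eqP => f0; rewrite f0 sig0 subr0 in hf.
  have /q_ann hk := xI_pow hf.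
  have injn n (x : M) : b1 ^+ n *: x = 0 -> x = 0.
    elim: n x => [|n IH] x; first by rewrite expr0 scale1r.
    by rewrite exprS -scalerA => /inj1/IH.
  exact: q_one (injn _ _ (hk (pim 1))).
have [N [a [c E]]] := poly_power_comaximal g f0.
pose D := 1 - b2 * sig a; pose A := b2 ^+ N * D; pose C := b1 * sig c.
have xX n : xI (b2 ^+ n - sig g ^+ n) by rewrite subrXX mulrC; apply: xIM.
have hAC : xI (A - C).
  have -> : A - C = (b2 ^+ N - sig g ^+ N) - sig a * (b2 ^+ N.+1 - sig g ^+ N.+1)
      - sig c * (b1 - sig f) + (sig g ^+ N - sig g ^+ N.+1 * sig a - sig f * sig c).
    rewrite /A /C /D !exprS; move: (b2 ^+ N) (sig g ^+ N) (sig a) (sig c) (sig f) (sig g) => *.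
    ring.
  apply: xID; last first.
    by rewrite -!sigX -!sigM {1}E sigD -addrA -opprD subrr; exact: xI0.
  by apply: xIB; [apply: xIB => //; apply: xIM | apply: xIM].
have hseq (x : M) : in_seqM [:: b1] (D ^+ m.+1 *: x).
  apply: (@pow_regular b1 b2 (N * m.+1)) => //.
  rewrite scalerA exprM -exprMn -/A; apply/in_seqM1.
  have /q_ann hk := xI_pow hAC.
  have EA : A ^+ m.+1 = (A - C) ^+ m.+1 + b1 * (sig c * \sum_(i < m.+1) A ^+ (m - i) * (A - C) ^+ i).
    by rewrite mulrA -/C -[in LHS](subrKC ((A - C) ^+ m.+1) (A ^+ m.+1)) subrXX subKr.
  exists ((sig c * \sum_(i < m.+1) A ^+ (m - i) * (A - C) ^+ i) *: x).
  by rewrite EA scalerDl hk add0r scalerA.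
apply: hn => x.
have [y Ey] := (in_seqM1 _ _).1 (hseq x).
have [e He] : exists e, 1 - D ^+ m.+1 = b2 * e.
  exists (sig a * \sum_(i < m.+1) 1 ^+ (m - i) * D ^+ i).
  by rewrite mulrA -{1}(expr1n _ m.+1) subrXX /D subKr.
have -> : x = b1 *: y + b2 *: (e *: x).
  by rewrite -Ey scalerA -He -scalerDl subrKC scale1r.
exact: in_seqM2.
Qed.

Lemma q_CM : CM_depth1 M.
Proof. by split; [exists 1%N; split; [exact: q_depth | exact: q_dim] | exact: q_depth]. Qed.
End Quot.
End QuotientCM.

(** * Existence of resolutions and Betti tables *)
Section ResolutionExists.
Variables (k : fieldType) (d : nat) (d_gt0 : (0 < d)%N).
Local Notation B := (vring k d).

(** A partial resolution, of which only the last free module and the saturated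
    submodule still to be covered matter. *)
Record stage := Stage {
  st_rank : nat;
  st_deg : 'I_st_rank -> int;
  st_K : gfree k d_gt0 st_deg -> Prop;
  st_sub : gsub st_K;
  st_sat : sat st_K
}.

(** A free module mapping onto the submodule. *)
Record cover (s : stage) := Cover {
  cv_rank : nat;
  cv_deg : 'I_cv_rank -> int;
  cv_map : {linear gfree k d_gt0 cv_deg -> gfree k d_gt0 (@st_deg s)};
  cv_degree0 : degree0 cv_map;
  cv_image : forall x, st_K x <-> imp cv_map x
}.

Lemma cover_inhabited s : inhabited (cover s).
Proof.
have [lo [D [h _]]] := int_bounds d_gt0 (@st_deg s) (fun _ : 'I_0 => 0).
have [|r [a [psi [h0 hi]]]] := @sat_cover k d d_gt0 _ _ _ (@st_sub s) lo _ (@st_sat s).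
  by move=> i; case/andP: (h i).
by split; apply: (Cover h0 hi).
Qed.

Definition some_cover s : cover s := epsilon (cover_inhabited s) (fun=> True).

Lemma free_no_socle r (a : 'I_r -> int) : no_socle (gfree k d_gt0 a).
Proof. by move=> x h _; exact: (free_torsionfree (bmon_neq0 k d 1 d) h). Qed.

Definition next_stage s : stage :=
  Stage (gsub_ker (@cv_degree0 s (some_cover s)))
        (ker_sat (f := cv_map (some_cover s)) (@free_no_socle _ _)).

Fixpoint nth_stage s0 n := if n is n'.+1 then next_stage (nth_stage s0 n') else s0.

Lemma resolution_exists (M : gmod k d) r (a : 'I_r -> int)
    (psi : {linear gfree k d_gt0 a -> M}) :
  degree0 psi -> (forall z, exists x, psi x = z) -> no_socle M ->
  inhabited (resolution d_gt0 M).
Proof.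
move=> h0 hs hM; pose s0 := Stage (gsub_ker h0) (ker_sat (f := psi) hM).
split; apply: (@Resolution k d d_gt0 M (fun i => st_rank (nth_stage s0 i))
  (fun i => @st_deg (nth_stage s0 i)) (fun i => cv_map (some_cover (nth_stage s0 i))) psi) => //.
- by move=> i; exact: (@cv_degree0 _ (some_cover (nth_stage s0 i))).
- by move=> y; exact: (cv_image (some_cover s0) y).
- by move=> i y; exact: (cv_image (some_cover (nth_stage s0 i.+1)) y).
Qed.

(** The graded pieces of a free module are finite dimensional. *)
Lemma tor_exists (M : gmod k d) (F : resolution d_gt0 M) i j : exists n, has_tor_dim F i j n.
Proof.
have mM (N : lmodType B) : subsp (@in_mM k d N) := in_mM_subsp d_gt0 N.
have [g0 gL] := @gpiece_subsp k d (resF F i) j.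
apply: free_qd_exists.
- case: i g0 gL => [|i] g0 gL; first by split.
  split; first by split=> //; rewrite linear0; exact: (mM _).1.
  move=> c x y [hx mx] [hy my]; split; first exact: gL.
  by rewrite linearP; apply: (mM _).2.
- split.
    by split=> //; exists 0; rewrite linear0 subr0; exact: (mM _).1.
  move=> c x y [hx [x' mx]] [hy [y' my]]; split; first exact: gL.
  exists (vconst d c *: x' + y').
  have -> : vconst d c *: x + y - res_diff F i (vconst d c *: x' + y') =
    vconst d c *: (x - res_diff F i x') + (y - res_diff F i y').
    by rewrite linearP scalerBr opprD addrACA.
  exact: (mM _).2.
- by case: i g0 gL => [|i] _ _ x //= [].
Qed.

Lemma betti_table_exists (M : gmod k d) : inhabited (resolution d_gt0 M) ->
  exists T, betti_table d_gt0 M T.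
Proof.
move=> [F]; pose beta i j := epsilon (inhabits 0%N) (has_tor_dim F i j).
exists (fun i j => (beta i j)%:R), beta => //; exists F => i j.
exact: (epsilon_spec (inhabits 0%N) _ (tor_exists F i j)).
Qed.
End ResolutionExists.

(** * Extremal rays *)
Section Cones.

Lemma cone_gen G (T : btable) : G T -> cone G T.
Proof.
move=> h; exists 1%N, (fun=> 1), (fun=> T); split=> // i j.
by rewrite big_ord1 mul1r.
Qed.

Lemma cone_scale G (c : rat) (T : btable) : 0 <= c -> cone G T -> cone G (fun i j => c * T i j).
Proof.
move=> c0 [n [e [g [h1 h2]]]]; exists n, (fun a => c * e a), g; split=> [a|i j].
  by have [h hG] := h1 a; split=> //; exact: mulr_ge0.
by rewrite h2 mulr_sumr; apply: eq_bigr => a _; rewrite mulrA.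
Qed.

Lemma cone_plus G (T T' : btable) : cone G T -> cone G T' -> cone G (fun i j => T i j + T' i j).
Proof.
move=> [n [c [g [h1 h2]]]] hT'.
suff : cone G (fun i j => \sum_(a < n) c a * g a i j + T' i j).
  by apply: cone_ext => i j; rewrite h2.
elim: n c g h1 {T h2} => [|n IH] c g h1.
  by apply: cone_ext hT' => i j; rewrite big_ord0 add0r.
have [h0 hg] := h1 ord0.
have := cone_add h0 hg (IH (c \o lift ord0) (g \o lift ord0) (fun a => h1 _)).
by apply: cone_ext => i j; rewrite big_ord_recl addrA.
Qed.

Lemma cone_trans G G' (T : btable) : (forall U, G U -> cone G' U) -> cone G T -> cone G' T.
Proof.
move=> hG [n [c [g [h1 h2]]]].
suff : cone G' (fun i j => \sum_(a < n) c a * g a i j).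
  by apply: cone_ext => i j; rewrite h2.
elim: n c g h1 {T h2} => [|n IH] c g h1.
  by apply: cone_ext (cone0 G') => i j; rewrite big_ord0.
have [h0 /hG hg] := h1 ord0.
have := cone_plus (cone_scale h0 hg) (IH (c \o lift ord0) (g \o lift ord0) (fun a => h1 _)).
by apply: cone_ext => i j; rewrite big_ord_recl.
Qed.

Lemma ray_eq (c : rat) (T U V : btable) : 0 < c -> (forall i j, T i j = c * U i j) ->
  ray T V <-> ray U V.
Proof.
move=> c0 E; split=> -[e e0 h].
  by exists (e * c) => [|i j]; rewrite ?mulr_ge0 ?(ltW c0) // h E mulrA.
exists (e / c) => [|i j]; first by rewrite mulr_ge0 ?invr_ge0 ?(ltW c0).
by rewrite h E mulrA mulfVK ?gt_eqF.
Qed.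

Variables (d : nat) (d_gt0 : (0 < d)%N).

Lemma is_pureT_ge0 g i j : is_pureT d g -> 0 <= g i j.
Proof. by move=> [d0 [d1 [l [_ _ ->]]]]; case: i => [|[|i]]; rewrite ler0n. Qed.

(** A linear functional in two entries that is nonnegative on all pure tables and
    vanishes on P, hence on U + V, vanishes on each pure table occurring in U. *)
Lemma pure_face n (c : 'I_n -> rat) (g : 'I_n -> btable) (U V P : btable) (e : rat)
    (x y : rat) i j i' j' :
  (forall a, 0 <= c a /\ is_pureT d (g a)) ->
  (forall i j, U i j = \sum_(a < n) c a * g a i j) ->
  cone (is_pureT d) V -> (forall i j, U i j + V i j = e * P i j) ->
  (forall T, is_pureT d T -> 0 <= x * T i j + y * T i' j') ->
  x * P i j + y * P i' j' = 0 ->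
  forall a, c a = 0 \/ x * g a i j + y * g a i' j' = 0.
Proof.
move=> hU EU [m [c' [g' [hV EV]]]] E hpos hP a.
have F (r : nat) (b : 'I_r -> rat) (h : 'I_r -> btable) :
    x * (\sum_a b a * h a i j) + y * (\sum_a b a * h a i' j') =
    \sum_a b a * (x * h a i j + y * h a i' j').
  by rewrite !mulr_sumr -big_split; apply: eq_bigr => z _ /=; ring.
have posU z : 0 <= c z * (x * g z i j + y * g z i' j').
  by have [h1 h2] := hU z; apply: mulr_ge0 => //; exact: hpos.
have posV z : 0 <= c' z * (x * g' z i j + y * g' z i' j').
  by have [h1 h2] := hV z; apply: mulr_ge0 => //; exact: hpos.
have : \sum_z c z * (x * g z i j + y * g z i' j') + \sum_z c' z * (x * g' z i j + y * g' z i' j') = 0.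
  rewrite -!F -!EU -!EV.
  have -> : x * U i j + y * U i' j' + (x * V i j + y * V i' j') =
    x * (U i j + V i j) + y * (U i' j' + V i' j') by ring.
  by rewrite !E mulrCA [y * _]mulrCA -mulrDr hP mulr0.
move/eqP; rewrite paddr_eq0 ?sumr_ge0 // psumr_eq0 // => /andP[/allP/(_ a)].
rewrite mem_index_enum => /(_ isT); rewrite mulf_eq0 => /orP[/eqP|/eqP]; by [left|right].
Qed.

(** The entries are nonnegative functionals, so each pure table occurring in U
    has its support in that of P, which fixes d0 and d1, and excludes
    l = d - 1 > 0 when P has l = 0.  The opposite case is excluded by the
    functional (d-1) T(1, d1) - T(2, d1 + 1), which vanishes for l = d - 1. *)
Lemma pure_extremal (d0 d1 : int) l (U V : btable) (e : rat) : d0 < d1 -> l = 0%N \/ l = d.-1 ->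
  cone (is_pureT d) U -> cone (is_pureT d) V ->
  (forall i j, U i j + V i j = e * pureT d d0 d1 l i j) -> ray (pureT d d0 d1 l) U.
Proof.
move=> lt hl [n [c [g [hU EU]]]] hV E.
have face := pure_face hU EU hV E.
have entry i j : pureT d d0 d1 l i j = 0 -> forall a, c a = 0 \/ g a i j = 0.
  move=> h0 a; have := @face 1 0 i j i j _ _ a; rewrite !mul1r !mul0r !addr0; apply=> //.
  by move=> T hT; rewrite mul0r addr0 mul1r; exact: is_pureT_ge0.
have steep := @face (d.-1)%:R (-1) 1%N d1 2 (d1 + 1).
exists (\sum_a c a) => [|i j]; first by apply: sumr_ge0 => a _; case: (hU a).
rewrite EU mulr_suml; apply: eq_bigr => a _.
have [->|/eqP ca] := eqVneq (c a) 0; first by rewrite !mul0r.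
have [_ [e0 [e1 [m [lt' hm Eg]]]]] := hU a.
have Z i' j' : pureT d d0 d1 l i' j' = 0 -> pureT d e0 e1 m i' j' = 0.
  by move/entry/(_ a); rewrite Eg => -[].
have e0d : e0 = d0.
  apply: NNPP => ne; have := Z 0%N e0; rewrite /= eqxx (introF eqP ne).
  by move=> /(_ erefl)/eqP; rewrite oner_eq0.
have e1d : e1 = d1.
  apply: NNPP => ne; have := Z 1%N e1; rewrite /= eqxx (introF eqP ne) muln0 muln1.
  by move=> /(_ erefl)/eqP; rewrite pnatr_eq0.
suff ml : m = l by rewrite Eg e0d e1d ml.
subst e0 e1; apply: NNPP => ne.
have dn0 : d != 0%N by rewrite -lt0n.
have d10 : d.-1 != 0%N by apply/eqP => d0'; apply: ne; move: hl hm; rewrite d0' => -[] -> -[] ->.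
case: hl hm Z steep Eg ne => [->|->] [->|->] Z steep Eg ne //.
- have := Z 2 (d1 + 1); rewrite /= muln0 !mul0n => /(_ erefl)/eqP.
  by rewrite eqxx !muln1 pnatr_eq0 muln_eq0 (negPf dn0) (negPf d10).
- have pos T : is_pureT d T -> 0 <= (d.-1)%:R * T 1%N d1 + -1 * T 2 (d1 + 1).
    move=> [f0 [f1 [q [_ hq ET]]]]; rewrite !ET /= expn0 (inj_eq (addIr _)).
    case: hq => ->; first by rewrite muln0 !mul0n mulr0 addr0 -natrM ler0n.
    by rewrite prednK // !muln1 [(d * _.-1)%N]mulnC -natrM mulnA mulN1r subrr.
  have zero : (d.-1)%:R * pureT d d0 d1 d.-1 1 d1 + -1 * pureT d d0 d1 d.-1 2 (d1 + 1) = 0.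
    by rewrite /= !eqxx prednK // !muln1 [(d * _.-1)%N]mulnC -natrM mulN1r subrr.
  have [//|] := steep pos zero a.
  rewrite !Eg /= !eqxx muln0 !mul0n mulr0 addr0 !muln1 mulr1 => /eqP.
  by rewrite pnatr_eq0 (negPf d10).
Qed.
End Cones.

Section Final.
Variables (k : fieldType) (d : nat) (d_gt0 : (0 < d)%N).

Lemma pure_realized (d0 d1 : int) l : d0 < d1 -> l = 0%N \/ l = d.-1 ->
  exists (M : gmod k d) T, [/\ fin_gen M, CM_depth1 M, betti_table d_gt0 M T
    & pure_resolution d_gt0 M d0 d1 l].
Proof.
move=> lt hl; pose n := `|d1 - d0|%N.
have En : d1 = d0 + n%:Z by rewrite /n; lia.
have n0 : (0 < n)%N by rewrite /n; lia.
have ld : (l < d)%N by case: hl => ->; lia.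
have hm : ((n * d - l).-1.+1 = n * d - l)%N.
  by rewrite prednK // subn_gt0 (leq_trans ld) // leq_pmull.
pose M := gqmod k d_gt0 (n * d - l).-1 d0.
have hM : CM_depth1 M := q_CM _ _ _ _.
have hp : pure_resolution d_gt0 M d0 d1 l := quotient_pure k d_gt0 ld hm n0 En.
have [hs _ _] := CM_depth1P d_gt0 hM.
have [a [r [phi [psi [[_ h0] _ _ h3 _]]]]] := hp.
have [T hT] := betti_table_exists (resolution_exists h0 h3 hs).
by exists M, T; split=> //; exact: gqmod_fin_gen.
Qed.

Lemma CM1_pure_table (M : gmod k d) d0 d1 l T : CM_depth1 M -> betti_table d_gt0 M T ->
  l = 0%N \/ l = d.-1 -> pure_resolution d_gt0 M d0 d1 l ->
  exists2 a : rat, 0 < a & forall i j, T i j = a * pureT d d0 d1 l i j.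
Proof.
move=> hM hT hl hp; have [h1 h2 h3] := CM_depth1P d_gt0 hM.
have ld : (l < d)%N by case: hl => ->; lia.
by have [a a0 E] := pure_betti ld h1 h2 h3 hp hT; exists a%:R; rewrite ?ltr0n.
Qed.

Lemma CM1_cone_pure (T : btable) :
  betti_cone d_gt0 (@CM_depth1 k d) T <-> cone (is_pureT d) T.
Proof.
split; apply: cone_trans => U.
  move=> [M [_ hM [beta [F hF] EU]]]; have [h1 h2 _] := CM_depth1P d_gt0 hM.
  have [lo [D h]] := betti_numerics h1 h2 hF.
  by apply: cone_ext (betti_cone_pure d_gt0 h) => i j; rewrite EU.
move=> [d0 [d1 [l [lt hl EU]]]]; have [M [T' [h1 h2 h3 h4]]] := pure_realized lt hl.
have [a a0 Ea] := CM1_pure_table h2 h3 hl h4.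
have aV : 0 <= a^-1 by rewrite invr_ge0 ltW.
have hG : betti_cone d_gt0 (@CM_depth1 k d) T' by apply: cone_gen; exists M.
apply: cone_ext (cone_scale aV hG) => i j.
by rewrite Ea EU mulKf // gt_eqF.
Qed.

Lemma pureT_neq0 d0 d1 l : pureT d d0 d1 l 0 d0 != 0.
Proof. by rewrite /= eqxx oner_eq0. Qed.

Lemma extremal_ray_ext (C C' R : btable -> Prop) : (forall T, C T <-> C' T) ->
  extremal_ray C R -> extremal_ray C' R.
Proof.
move=> E [[T [/E hT h1 h2]] h3]; split; first by exists T.
by move=> U V /E hU /E hV; exact: h3.
Qed.

(** An extremal ray is spanned by a pure table: one of the terms c g of a
    generator of the ray is nonzero at the given entry, and extremality applied
    to this term and the sum of the others puts it on the ray. *)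
Lemma extremal_pure R : extremal_ray (cone (is_pureT d)) R <->
  exists d0 d1 l, [/\ d0 < d1, l = 0%N \/ l = d.-1 & forall U, R U <-> ray (pureT d d0 d1 l) U].
Proof.
split=> [[[T [[n [c [g [hg ET]]]] [i [j nz]] RT]] hex]|[d0 [d1 [l [lt hl hR]]]]].
  have [a ha] : exists a, c a * g a i j != 0.
    apply: NNPP => h; case/eqP: nz; rewrite ET big1 // => a _.
    by apply/eqP; apply: NNPP => /negP ha; apply: h; exists a.
  have [ca [d0 [d1 [l [lt hl Eg]]]]] := hg a.
  exists d0, d1, l; split=> // X; rewrite RT.
  have : R (fun i j => c a * g a i j + \sum_(b < n | b != a) c b * g b i j).
    apply/RT; exists 1 => // i' j'; rewrite mul1r ET [RHS](bigD1 a) //=.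
  move=> /hex[| |/RT[e e0 Ee] _].
  - by apply: cone_scale => //; apply: cone_gen; case: (hg a).
  - exists n, (fun b => if b == a then 0 else c b), g; split=> [b|i' j'].
      by have [h1 h2] := hg b; case: eqP.
    by rewrite big_mkcond; apply: eq_bigr => b _; case: eqP => //=; rewrite mul0r.
  have c0 : 0 < c a by rewrite lt_def ca andbT; apply: contraNneq ha => ->; rewrite mul0r.
  have e1 : 0 < e.
    by rewrite lt_def e0 andbT; apply: contraNneq ha => e0'; rewrite Ee e0' mul0r.
  apply: (@ray_eq (c a / e)) => [|i' j']; first by rewrite mulr_gt0 ?invr_gt0.
  by rewrite -Eg mulrAC Ee mulrAC mulfV ?mul1r ?gt_eqF.
split.
  exists (pureT d d0 d1 l); split=> //; last by exists 0%N, d0; exact: pureT_neq0.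
  by apply: cone_gen; exists d0, d1, l.
move=> U V hU hV /hR[e _ E]; split; apply/hR.
  exact: (pure_extremal d_gt0 lt hl hU hV E).
have E' i j : V i j + U i j = e * pureT d d0 d1 l i j by rewrite addrC.
exact: (pure_extremal d_gt0 lt hl hV hU E').
Qed.
End Final.

Theorem mainTheorem2 (k : fieldType) (d : nat) (d_gt0 : (0 < d)%N)
    (R : btable -> Prop) :
  extremal_ray (betti_cone d_gt0 (@CM_depth1 k d)) R <->
  exists (M : gmod k d) (d0 d1 : int) (l : nat) (T : btable),
    [/\ fin_gen M, CM_depth1 M & betti_table d_gt0 M T] /\
    [/\ d0 < d1, l = 0%N \/ l = (d - 1)%N, pure_resolution d_gt0 M d0 d1 l
      & forall U, R U <-> ray T U].
Proof.
have E := @CM1_cone_pure k d d_gt0; rewrite subn1.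
split=> [/(extremal_ray_ext E)/(extremal_pure d_gt0)[d0 [d1 [l [lt hl hR]]]]|].
  have [M [T [h1 h2 h3 h4]]] := pure_realized k d_gt0 lt hl.
  have [a a0 Ea] := CM1_pure_table h2 h3 hl h4.
  exists M, d0, d1, l, T; split=> //; split=> // U.
  by rewrite hR; apply: iff_sym; apply: ray_eq a0 Ea.
move=> [M [d0 [d1 [l [T [[h1 h2 h3] [lt hl h4 hR]]]]]]].
apply: (@extremal_ray_ext _ _ _ (fun T => iff_sym (E T))).
apply/(extremal_pure d_gt0); exists d0, d1, l; split=> // U; rewrite hR.
have [a a0 Ea] := CM1_pure_table h2 h3 hl h4.
exact: ray_eq a0 Ea.
Qed.
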